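(* There exists a function $\varepsilon:\mathbb{N}\to[0,\infty)$ with $\lim_{n\to\infty}\varepsilon(n)=0$ such that for every $n\in\mathbb{N}$ there exists an integer parallelotope $K\subset\mathbb{R}^n$ whose surface area satisfies $\mathrm{vol}_{n-1}(\partial K)\le n^{\frac12+\varepsilon(n)}$. In other words, for every $n\in\mathbb{N}$ there is an integer parallelotope in $\mathbb{R}^n$ whose surface area is $n^{\frac12+o(1)}$.
   Context: For a lattice $\Lambda\subset\mathbb{R}^n$, a convex body $K\subset\mathbb{R}^n$ (compact, convex, with nonempty interior) is a $\Lambda$-parallelotope if $\mathbb{R}^n=\bigcup_{x\in\Lambda}(x+K)$ and the interior of $(x+K)\cap(y+K)$ is empty for all distinct $x,y\in\Lambda$. An integer parallelotope is a $\mathbb{Z}^n$-parallelotope. $\mathrm{vol}_{n-1}$ denotes the $(n-1)$-dimensional Hausdorff measure induced by the Euclidean metric.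
   Formalization: The bound is stated for n ≥ 2 only: for n = 1 the claim fails, since an integer parallelotope in R is an interval of length 1 whose boundary has vol_0 equal to 2, which exceeds 1^{1/2+ε(1)} = 1, and n = 0 is degenerate. *)

(* Defs.v *)
From HB Require Import structures.
From mathcomp Require Import all_boot all_order all_algebra.
From mathcomp Require Import all_classical all_reals all_analysis.
Set Implicit Arguments. Unset Strict Implicit. Unset Printing Implicit Defensive.
Import Order.TTheory GRing.Theory Num.Theory.
Import numFieldNormedType.Exports.
Local Open Scope classical_set_scope.
Local Open Scope ring_scope.

Section Defs.
Variable R : realType.

(* Points of R^n are row vectors 'rV[R]_n (topology: product topology, which
   coincides with the Euclidean one). *)

Definition eucl_dist (n : nat) (x y : 'rV[R]_n) : R :=
  Num.sqrt (\sum_(i < n) (x ord0 i - y ord0 i) ^+ 2).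

(* Euclidean diameter, with the convention diam(empty) = 0 *)
Definition ediam (n : nat) (A : set 'rV[R]_n) : \bar R :=
  ereal_sup [set d | d = 0%E \/
     exists x y, A x /\ A y /\ d = (eucl_dist x y)%:E].

Fixpoint unit_ball_vol (k : nat) : R :=
  match k with
  | 0%N => 1
  | 1%N => 2
  | (j.+2)%N => (2 * pi) / (j.+2)%:R * unit_ball_vol j
  end.

Definition hausdorff_const (s : nat) : R := unit_ball_vol s / 2 ^+ s.

Definition hausdorff_content (n s : nat) (delta : R) (A : set 'rV[R]_n) : \bar R :=
  ereal_inf [set v | exists E : nat -> set 'rV[R]_n,
     A `<=` \bigcup_i E i /\
     (forall i, (ediam (E i) <= delta%:E)%E) /\
     v = (\sum_(0 <= i <oo) (hausdorff_const s * (fine (ediam (E i))) ^+ s)%:E)%E].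

(* s-dimensional Hausdorff measure H^s = lim_{delta -> 0+} H^s_delta
   = sup_{delta > 0} H^s_delta (the content is nonincreasing in delta) *)
Definition hausdorff_measure (n s : nat) (A : set 'rV[R]_n) : \bar R :=
  ereal_sup [set hausdorff_content s delta A | delta in [set d : R | 0 < d]].

Definition boundary (n : nat) (K : set 'rV[R]_n) : set 'rV[R]_n :=
  closure K `\` interior K.

Definition surface_area (n : nat) (K : set 'rV[R]_n) : \bar R :=
  hausdorff_measure (n.-1) (boundary K).

Definition convex_set_n (n : nat) (K : set 'rV[R]_n) : Prop :=
  forall x y t, K x -> K y -> 0 <= t -> t <= 1 -> K ((1 - t) *: x + t *: y).

Definition convex_body (n : nat) (K : set 'rV[R]_n) : Prop :=
  compact K /\ convex_set_n K /\ interior K !=set0.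

Definition int_lattice (n : nat) : set 'rV[R]_n :=
  [set x | forall i, x ord0 i \is a Num.int].

Definition translate (n : nat) (x : 'rV[R]_n) (K : set 'rV[R]_n) : set 'rV[R]_n :=
  [set x + k | k in K].

Definition lattice_parallelotope (n : nat) (L K : set 'rV[R]_n) : Prop :=
  convex_body K /\
  setT = \bigcup_(x in L) translate x K /\
  (forall x y, L x -> L y -> x <> y ->
     interior (translate x K `&` translate y K) = set0).

Definition integer_parallelotope (n : nat) (K : set 'rV[R]_n) : Prop :=
  lattice_parallelotope (@int_lattice n) K.

End Defs.

(* Main.v *)
Require Import Defs.
From HB Require Import structures.
From mathcomp Require Import all_boot all_order all_algebra.
From mathcomp Require Import all_classical all_reals all_analysis.
From mathcomp Require Import ring lra zify.
Set Implicit Arguments. Unset Strict Implicit. Unset Printing Implicit Defensive.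
Import Order.TTheory GRing.Theory Num.Theory.
Import numFieldNormedType.Exports.
Local Open Scope classical_set_scope.
Local Open Scope ring_scope.


(** Call [good n S] the existence of a chain of mutually orthogonal projections P_0, ...,
    P_(t-1) of R^n summing to the identity and of lam_j > 0 such that an integer vector z
    killed by all P_i with i > j has z P_j = 0 or |z P_j| >= lam_j, with
    sum_j 2 rank(P_j) / lam_j <= S. The vectors z P_j of this kind form a lattice in the
    image of P_j; the product K of their Voronoi cells is an integer parallelotope (choose
    the nearest lattice point lexicographically). Thickening the facets of the j-th factor
    by b stays inside (1 + (2 b / lam_j) P_j) K, whose volume is at most
    (1 + 2 b / lam_j)^rank(P_j), so K has surface area at most S.

    If N is an n x k integer matrix with |x N| <= s |x| whose nonzero integer kernel vectors
    have norm at least d, then [good k S] implies [good n (2 n / d + s S)]. Sparse 0/1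
    matrices with about c ones per row, obtained from c hash functions such that every small
    set of indices has an element hashed uniquely by one of them, improve a bound
    S = O(n^(1/2 + t)) to the exponent 1/2 + max(2/c, t (1 - 2/c)). Starting from the unit
    cube (t = 1/2), finitely many steps give 1/2 + 2/c. *)

(** Lower bounds for volumes rest on superadditivity, which outer Jordan content has only for sets
    at positive distance. This shapes the proof: cubes, annuli and slabs are shrunk by a parameter
    that creates gaps, the estimate becomes a polynomial in the parameter, and the parameter tends
    to 0. The passage to Hausdorff measure depends on its normalization: a ball of diameter 1 costs
    [hausdorff_const], and this cost must not exceed the content of the ball, so the recursion
    [unit_ball_vol] has to be compared with actual contents. The exponent in the recursion comes
    from m about n^(1/c): the norm s of the matrix, about m, cancels against the square root of the
    drop in dimension from n to about n / m^2, so that only the excess exponent t is multiplied by 1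
    - 2/c; kernel vectors of norm about sqrt n / m^2 cost n^(1/2 + 2/c). *)

(** * Outer Jordan content and its additivity on separated sets *)

Section JordanContent.
Variable R : realType.

(** Continuity at 0, which stands in for limits below: an estimate is proved with a slack [e] in (0,
    1), its slack form is written as a polynomial in [e], and [e] tends to 0. *)
Lemma poly_ge_at0 (p : {poly R}) (v : R) :
  (forall e, 0 < e -> e < 1 -> v <= p.[e]) -> v <= p.[0].
Proof.
move=> H; rewrite leNgt; apply/negP => lt.
have := @cvgr_lt R _ (nbhs (0:R)) _ (horner p) _ (@continuous_horner R p 0) v lt.
move=> /(_ (nbhs_filter _)).
move=> /nbhs_ballP[e /= e0 He].
pose d := Num.min e 1 / 2.
have m1 : Num.min e 1 <= e by rewrite ge_min lexx.
have m2 : Num.min e 1 <= 1 by rewrite ge_min lexx orbT.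
have m0 : 0 < Num.min e 1 by rewrite lt_min e0 ltr01.
have [d0 de d1] : [/\ 0 < d, d < e & d < 1] by rewrite /d; split; lra.
have /He : ball 0 e d by rewrite /ball /= sub0r normrN gtr0_norm.
by rewrite /= ltNge H.
Qed.

Lemma poly_le_invn (p : {poly R}) (v : R) :
  (forall M : nat, p.[M.+1%:R^-1] <= v) -> p.[0] <= v.
Proof.
move=> H; rewrite leNgt; apply/negP => lt.
have := @cvgr_gt R _ (nbhs (0:R)) _ (horner p) _ (@continuous_horner R p 0) v lt.
move=> /(_ (nbhs_filter _)) /nbhs_ballP[e /= e0 He].
have /He : ball 0 e ((Num.truncn e^-1).+1%:R^-1 : R).
  rewrite /ball /= sub0r normrN gtr0_norm ?invr_gt0 ?ltr0n //.
  by rewrite invf_plt ?posrE ?ltr0n // truncnS_gt.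
by rewrite /= ltNge H.
Qed.

Lemma dyadic_small (e : R) : 0 < e -> exists N, (2 ^+ N)^-1 < e.
Proof.
move=> e0; exists (Num.truncn e^-1).
have := truncnS_gt e^-1; set k := Num.truncn _ => hk.
rewrite -ltf_pV2 ?posrE ?invr_gt0 ?exprn_gt0 // invrK.
apply: lt_le_trans hk _; rewrite -natrX ler_nat; exact: ltn_expl.
Qed.

Definition cell n N (x : 'rV[R]_n) : 'rV[int]_n :=
  map_mx (fun t => Num.floor (2 ^+ N * t)) x.

Definition covered n N (s : seq 'rV[int]_n) (A : set 'rV[R]_n) :=
  forall x, A x -> cell N x \in s.

(* Outer Jordan content, as an infimum over the dyadic grids; it is 0 for unbounded sets. *)
Definition cont n (A : set 'rV[R]_n) : R :=
  inf [set r | exists N s, covered N s A /\ r = (size s)%:R / 2 ^+ (N * n)].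

Definition bdd n (A : set 'rV[R]_n) :=
  exists r : R, forall x, A x -> forall i, `|x ord0 i| <= r.

Definition box n (a t : 'rV[R]_n) : set 'rV[R]_n :=
  [set x | forall i, a ord0 i <= x ord0 i <= a ord0 i + t ord0 i].

(** In direction [i] the box meets at most [truncn (2 ^+ N * t i) + 2] grid intervals, the excess
    accounting for the rounding at both ends. *)
Lemma box_covered n (a t : 'rV[R]_n) N : (forall i, 0 <= t ord0 i) ->
  exists2 s, covered N s (box a t) &
    (size s)%:R / 2 ^+ (N * n) <= \prod_i (t ord0 i + 2 / 2 ^+ N).
Proof.
move=> t0.
pose M (i : 'I_n) := (Num.truncn (2 ^+ N * t ord0 i)).+2.
pose g (f : {dffun forall i : 'I_n, 'I_(M i)}) : 'rV[int]_n :=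
  \row_i (Num.floor (2 ^+ N * a ord0 i) + (f i : nat)%:Z).
exists (map g (enum {: {dffun forall i : 'I_n, 'I_(M i)}})).
  move=> x bx.
  pose j (i : 'I_n) := `|Num.floor (2 ^+ N * x ord0 i) - Num.floor (2 ^+ N * a ord0 i)|%N.
  have jP i : Num.floor (2 ^+ N * x ord0 i) = Num.floor (2 ^+ N * a ord0 i) + (j i)%:Z.
    rewrite /j gez0_abs ?subr_ge0; last first.
      by apply: le_floor; rewrite ler_pM2l ?exprn_gt0 //; case/andP: (bx i).
    by rewrite addrCA subrr addr0.
  have jM i : (j i < M i)%N.
    have /andP[_ h] := bx i.
    have := floorD1_gt (2 ^+ N * a ord0 i).
    have := floor_le (2 ^+ N * x ord0 i).
    have := truncnS_gt (2 ^+ N * t ord0 i).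
    rewrite jP !intrD -pmulrn /M.
    have : 2 ^+ N * x ord0 i <= 2 ^+ N * a ord0 i + 2 ^+ N * t ord0 i.
      by rewrite -mulrDr ler_pM2l ?exprn_gt0.
    set T := Num.truncn _; set F := Num.floor _ => h1 h2 h3 h4.
    suff : (j i)%:R < (T.+2)%:R :> R by rewrite ltr_nat.
    rewrite -natr1 in h2 *; rewrite -natr1; lra.
  apply/mapP; exists [ffun i => Ordinal (jM i)]; first by rewrite mem_enum.
  by apply/rowP => i; rewrite !mxE ffunE /= jP.
rewrite size_map -cardE card_dep_ffun foldrE big_map big_enum /=.
have -> : (2 ^+ (N * n) : R) = \prod_(i < n) 2 ^+ N.
  by rewrite prodr_const card_ord exprM.
rewrite natr_prod -prodf_div; apply: ler_prod => i _.
rewrite divr_ge0 ?ler0n ?exprn_ge0 //= card_ord ler_pdivrMr ?exprn_gt0 //.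
rewrite mulrDl divfK ?expf_neq0 // /M -natr1 -natr1.
have := truncn_le (2 ^+ N * t ord0 i); rewrite mulr_ge0 ?exprn_ge0 //.
rewrite [t _ _ * _]mulrC; move: (Num.truncn _) => T; lra.
Qed.

Lemma covered_sub n N s (A B : set 'rV[R]_n) : A `<=` B -> covered N s B -> covered N s A.
Proof. by move=> AB h x /AB; exact: h. Qed.

Lemma bdd_covered n N (A : set 'rV[R]_n) : bdd A -> exists s, covered N s A.
Proof.
move=> [r hr].
have t0 i : 0 <= (const_mx (`|r| + `|r|) : 'rV[R]_n) ord0 i by rewrite mxE addr_ge0.
have [s hs _] := box_covered (const_mx (- `|r|)) N t0.
exists s; apply: covered_sub hs => x Ax i; rewrite !mxE addKr -ler_norml.
exact: le_trans (hr _ Ax i) (ler_norm _).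
Qed.

(** Each cell splits into [2 ^ (M * n)] finer ones, so the ratio in [cont] is unchanged and
    coverings may be taken as fine as desired. *)
Lemma covered_refine n N s (A : set 'rV[R]_n) M : covered N s A ->
  exists2 s', covered (N + M) s' A & size s' = (size s * 2 ^ (M * n))%N.
Proof.
move=> h; elim: M => [|M [s' h' e']]; first by exists s; rewrite ?addn0 ?muln1.
pose g (k : 'rV[int]_n) (f : {ffun 'I_n -> bool}) : 'rV[int]_n :=
  \row_i (k ord0 i * 2 + (f i)%:Z).
exists (allpairs g s' (enum {: {ffun 'I_n -> bool}})); last first.
  rewrite size_allpairs -cardE card_ffun card_bool card_ord e'.
  by rewrite -mulnA -expnD mulSn addnC.
move=> x Ax; pose k := cell (N + M) x.
have hk i : exists b : bool, Num.floor (2 ^+ (N + M.+1) * x ord0 i) = k ord0 i * 2 + b%:Z.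
  rewrite /k mxE addnS exprS -mulrA.
  (* The boolean is the next binary digit: whether [y] lies in the upper half of its unit
     interval. *)
  set y := _ * x _ _; exists ((Num.floor y)%:~R + 2^-1 <= y).
  apply: floor_def; have := floor_le y; have := floorD1_gt y.
  set F := Num.floor y; rewrite !intrD intrM.
  move=> h1 h2; case: (leP (F%:~R + 2^-1) y) => /= hy; rewrite -?[(Posz 1)%:~R]/(1:R) -?[(Posz 0)%:~R]/(0:R)
    -?[(Posz 2)%:~R]/(2:R); apply/andP; split; lra.
have [f fP] := fin_all_exists hk.
apply/allpairsP; exists (k, finfun f); split => /=; first exact: h'.
  by rewrite mem_enum.
by apply/rowP => i; rewrite !mxE ffunE fP mxE.
Qed.

Section Cont.
Variable n : nat.
Implicit Types A B : set 'rV[R]_n.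

Lemma cont_le N s A : covered N s A -> cont A <= (size s)%:R / 2 ^+ (N * n).
Proof.
move=> h; apply: ge_inf; last by exists N, s.
by exists 0 => _ [M [t [_ ->]]]; rewrite divr_ge0 ?ler0n ?exprn_ge0.
Qed.

(** Boundedness guarantees that a covering exists; the infimum of the empty set would be 0. *)
Lemma cont_ge A v : bdd A ->
  (forall N s, covered N s A -> v <= (size s)%:R / 2 ^+ (N * n)) -> v <= cont A.
Proof.
move=> /(bdd_covered 0)[s hs] h; apply: lb_le_inf; first by exists ((size s)%:R / 2 ^+ (0 * n)), 0, s.
by move=> _ [N [t [ht ->]]]; exact: h.
Qed.

Lemma cont_ge_fine A v N0 : bdd A ->
  (forall N s, (N0 <= N)%N -> covered N s A -> v <= (size s)%:R / 2 ^+ (N * n)) -> v <= cont A.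
Proof.
move=> bA h; apply: cont_ge => // N s hs.
have [s' hs' es] := covered_refine N0 hs.
apply: (le_trans (h _ _ (leq_addl _ _) hs')).
by rewrite es natrM mulnDl exprD natrX -mulrA ler_wpM2l // invfM mulrCA mulfV ?mulr1 ?expf_neq0.
Qed.

Lemma cont_ge0 A : 0 <= cont A.
Proof.
have [[s [N hN]]|h] := pselect (exists s N, covered N s A).
  apply: lb_le_inf; first by exists ((size s)%:R / 2 ^+ (N * n)), N, s.
  by move=> _ [M [t [ht ->]]]; rewrite divr_ge0 ?ler0n ?exprn_ge0.
rewrite /cont (_ : [set r | _] = set0) ?inf0 //.
by rewrite -subset0 => r [M [t [ht _]]]; apply: h; exists t, M.
Qed.

Lemma cont_approx A e N0 : bdd A -> 0 < e -> exists N s,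
  [/\ (N0 <= N)%N, covered N s A & (size s)%:R / 2 ^+ (N * n) < cont A + e].
Proof.
move=> bA e0; apply: contrapT => h.
have : cont A + e <= cont A.
  apply: (cont_ge_fine (N0 := N0)) => // N s hN hs; rewrite leNgt; apply/negP => lt.
  by apply: h; exists N, s.
lra.
Qed.

Lemma cont_mono A B : bdd B -> A `<=` B -> cont A <= cont B.
Proof.
by move=> bB AB; apply: cont_ge => // N s hs; apply: cont_le; exact: covered_sub hs.
Qed.

Lemma bdd_sub A B : A `<=` B -> bdd B -> bdd A.
Proof. by move=> AB [r h]; exists r => x /AB; exact: h. Qed.

Lemma bddU A B : bdd A -> bdd B -> bdd (A `|` B).
Proof.
move=> [r h] [q k]; exists (Num.max r q) => x [/h|/k] H i; rewrite le_max H ?orbT //.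
Qed.

Lemma contU A B : bdd A -> bdd B -> cont (A `|` B) <= cont A + cont B.
Proof.
move=> bA bB; apply/ler_addgt0Pr => e e0.
have e2 : 0 < e / 2 by lra.
have [N [s [_ hs es]]] := cont_approx 0 bA e2.
have [M [t [NM ht et]]] := cont_approx N bB e2.
have [s' hs' es'] := covered_refine (M - N) hs.
rewrite subnKC // in hs'.
have : covered M (s' ++ t) (A `|` B).
  by move=> x [/hs'|/ht] h; rewrite mem_cat h ?orbT.
move=> /cont_le; rewrite size_cat natrD mulrDl.
have -> : (size s')%:R / 2 ^+ (M * n) = (size s)%:R / 2 ^+ (N * n) :> R.
  rewrite es' natrM natrX -{2}(subnKC NM) mulnDl exprD invfM -!mulrA; congr (_ * _).
  by rewrite mulrCA mulfV ?mulr1 ?expf_neq0.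
lra.
Qed.

Lemma bdd_bigU (I : eqType) (r : seq I) (F : I -> set 'rV[R]_n) A :
  (forall i, i \in r -> bdd (F i)) -> (forall x, A x -> exists2 i, i \in r & F i x) ->
  bdd A.
Proof.
elim: r A => [|i r IH] A bF hA.
  by exists 0 => x /hA[].
have bi := bF i (mem_head _ _).
have bF' j : j \in r -> bdd (F j) by move=> jr; apply: bF; rewrite in_cons jr orbT.
have /(IH _ bF') bU : forall x, (A `\` F i) x -> exists2 i, i \in r & F i x.
  move=> x [/hA[j]]; rewrite in_cons => /orP[/eqP->//|jr Fj _]; by exists j.
apply: bdd_sub (bddU bi bU) => x Ax.
by have [|] := pselect (F i x); [left|right].
Qed.

Lemma cont_bigU (I : eqType) (r : seq I) (F : I -> set 'rV[R]_n) A :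
  (forall i, i \in r -> bdd (F i)) -> (forall x, A x -> exists2 i, i \in r & F i x) ->
  cont A <= \sum_(i <- r) cont (F i).
Proof.
elim: r A => [|i r IH] A bF hA.
  rewrite big_nil; have : covered 0 [::] A by move=> x /hA[].
  by move=> /cont_le; rewrite mul0r.
rewrite big_cons.
have bi := bF i (mem_head _ _).
have bF' j : j \in r -> bdd (F j) by move=> jr; apply: bF; rewrite in_cons jr orbT.
have hU : forall x, (A `\` F i) x -> exists2 i, i \in r & F i x.
  move=> x [/hA[j]]; rewrite in_cons => /orP[/eqP->//|jr Fj _]; by exists j.
have bU := bdd_bigU bF' hU.
have: cont A <= cont (F i) + cont (A `\` F i).
  apply: le_trans (contU bi bU); apply: cont_mono; first exact: bddU.
  by move=> x Ax; have [|] := pselect (F i x); [left|right].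
by move=> /le_trans; apply; rewrite lerD2l; exact: IH.
Qed.

Lemma cont_box (a t : 'rV[R]_n) : (forall i, 0 <= t ord0 i) -> cont (box a t) <= \prod_i t ord0 i.
Proof.
move=> t0.
have -> : \prod_i t ord0 i = (\prod_(i < n) ((t ord0 i)%:P + 'X)).[0].
  by rewrite horner_prod; apply: eq_bigr => i _; rewrite !hornerE.
apply: poly_ge_at0 => e e0 _.
have [|N hN] := @dyadic_small (e / 2); first by lra.
have [s hs es] := @box_covered n a t N t0.
apply: (le_trans (cont_le hs)); apply: (le_trans es).
rewrite horner_prod; apply: ler_prod => i _; rewrite !hornerE.
have := t0 i; have : 0 < (2 ^+ N)^-1 :> R by rewrite invr_gt0 exprn_gt0.
move: hN; set q := _^-1; lra.
Qed.

Lemma bdd_box (a t : 'rV[R]_n) : bdd (box a t).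
Proof.
exists (\sum_i (`|a ord0 i| + `|t ord0 i|)) => x bx i.
rewrite (bigD1 i) //=; apply: (@le_trans _ _ (`|a ord0 i| + `|t ord0 i|)).
  have := bx i; have := ler_norm (a ord0 i); have := ler_norm (t ord0 i).
  have := ler_norm (- a ord0 i); have := normr_ge0 (t ord0 i); rewrite normrN ler_norml; lra.
by rewrite lerDl; apply: sumr_ge0 => j _; rewrite addr_ge0.
Qed.

(** Positive distance in the sup norm. Disjointness alone would not make outer Jordan content
    additive. *)
Definition sep A B := exists2 e : R, 0 < e &
  forall x y, A x -> B y -> exists i, e <= `|x ord0 i - y ord0 i|.

Lemma cell_near N (x y : 'rV[R]_n) : cell N x = cell N y ->
  forall i, `|x ord0 i - y ord0 i| < (2 ^+ N)^-1.
Proof.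
move=> /rowP h i; have := h i; rewrite !mxE => e.
have := floor_le (2 ^+ N * x ord0 i); have := floorD1_gt (2 ^+ N * x ord0 i).
have := floor_le (2 ^+ N * y ord0 i); have := floorD1_gt (2 ^+ N * y ord0 i).
rewrite e !intrD; set f := (Num.floor _)%:~R => h1 h2 h3 h4.
rewrite -(ltr_pM2l (exprn_gt0 N (ltr0n R 2))) mulfV ?expf_neq0 //.
rewrite -[X in X * `|_|]gtr0_norm ?exprn_gt0 // -normrM mulrBr ltr_norml; lra.
Qed.

(** Once the grid is finer than [e], no cell meets both sets, so the cells meeting [A] and those
    meeting [B] are disjoint parts of a covering of the union. *)
Lemma cont_sep A B : bdd A -> bdd B -> sep A B -> cont A + cont B <= cont (A `|` B).
Proof.
move=> bA bB [e e0 hAB]; have [N0 hN0] := dyadic_small e0.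
apply: (cont_ge_fine (N0 := N0)); first exact: bddU.
move=> N s hN hs.
have hNe : (2 ^+ N)^-1 < e.
  apply: le_lt_trans hN0; rewrite lef_pV2 ?posrE ?exprn_gt0 //.
  by rewrite ler_eXn2l // ltr1n.
pose m (C : set 'rV[R]_n) (k : 'rV[int]_n) := `[< exists2 x, C x & cell N x = k >].
have cA : covered N (seq.filter (m A) s) A.
  move=> x Ax; rewrite mem_filter hs ?andbT; last by left.
  by apply/asboolP; exists x.
have cB : covered N (seq.filter (m B) s) B.
  move=> x Bx; rewrite mem_filter hs ?andbT; last by right.
  by apply/asboolP; exists x.
apply: (le_trans (lerD (cont_le cA) (cont_le cB))).
rewrite -mulrDl ler_wpM2r ?invr_ge0 ?exprn_ge0 // -natrD ler_nat !size_filter.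
rewrite -count_predUI [X in (_ + X)%N](_ : _ = 0%N) ?addn0 ?count_size //.
apply/eqP; rewrite -leqn0 leqNgt -has_count; apply/hasPn => k _ /=.
apply/negP => /andP[/asboolP[x Ax ex] /asboolP[y By ey]].
have [i] := hAB _ _ Ax By.
have := @cell_near N x y; rewrite ex ey => /(_ erefl i); lra.
Qed.

End Cont.
End JordanContent.


(** * Behaviour of content under affine and linear maps *)

Section LinearImages.
Variable R : realType.

Definition cbox n N (k : 'rV[int]_n) : set 'rV[R]_n :=
  box (\row_i ((k ord0 i)%:~R / 2 ^+ N)) (const_mx (2 ^+ N)^-1).

Lemma cell_cbox n N (x : 'rV[R]_n) : cbox N (cell N x) x.
Proof.
move=> i; rewrite !mxE -[X in _ + X]mul1r -mulrDl.
have p : 0 < 2 ^+ N :> R by rewrite exprn_gt0.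
rewrite ler_pdivrMr // ler_pdivlMr // [x _ _ * _]mulrC floor_le /= ltW //.
by have := floorD1_gt (2 ^+ N * x ord0 i); rewrite intrD.
Qed.

(** A covering of [A] by cells yields a covering of the image by the images of grid cubes, so only
    these have to be estimated. *)
Lemma cont_image_le n m (f : 'rV[R]_n -> 'rV[R]_m) v (A : set 'rV[R]_n) :
  bdd A -> 0 <= v -> (forall N k, bdd (f @` cbox N k)) ->
  (forall N k, cont (f @` cbox N k) <= v / 2 ^+ (N * n)) ->
  cont (f @` A) <= v * cont A.
Proof.
move=> bA v0 bf hf.
have main N s : covered N s A -> cont (f @` A) <= v * ((size s)%:R / 2 ^+ (N * n)).
  move=> hs; apply: (@le_trans _ _ (\sum_(k <- s) cont (f @` cbox N k))).
    apply: cont_bigU => [k _|_ [x Ax <-]]; first exact: bf.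
    by exists (cell N x); [exact: hs|exists x => //; exact: cell_cbox].
  apply: (@le_trans _ _ (\sum_(k <- s) v / 2 ^+ (N * n))); first exact: ler_sum.
  by rewrite big_const_seq count_predT iter_addr_0 -[leLHS]mulr_natl [leLHS]mulrCA.
(* The factor is moved across the infimum by division, so [v = 0] is treated apart. *)
have [v1|v1] := eqVneq v 0.
  by have [s /main] := bdd_covered 0 bA; rewrite v1 !mul0r.
have v2 : 0 < v by rewrite lt_def v1.
rewrite mulrC -ler_pdivrMr //; apply: cont_ge => // N s /main.
by rewrite ler_pdivrMr // mulrC.
Qed.

Definition affd n (d b : 'rV[R]_n) (x : 'rV[R]_n) : 'rV[R]_n :=
  \row_i (d ord0 i * x ord0 i + b ord0 i).

Lemma affd_box n (d b a t : 'rV[R]_n) : (forall i, 0 <= d ord0 i) ->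
  affd d b @` box a t `<=` box (affd d b a) (\row_i (d ord0 i * t ord0 i)).
Proof.
move=> d0 _ [x hx <-] i; rewrite !mxE; have /andP[h1 h2] := hx i.
have := ler_wpM2l (d0 i) h1; have := ler_wpM2l (d0 i) h2; rewrite mulrDr => *.
by apply/andP; split; lra.
Qed.

Lemma cont_affd_le n (d b : 'rV[R]_n) A : (forall i, 0 <= d ord0 i) -> bdd A ->
  cont (affd d b @` A) <= (\prod_i d ord0 i) * cont A.
Proof.
move=> d0 bA.
have e0 N : 0 <= (2 ^+ N)^-1 :> R by rewrite invr_ge0 exprn_ge0.
apply: cont_image_le => //; first exact: prodr_ge0.
  by move=> N k; apply: bdd_sub (bdd_box _ _); exact: affd_box.
move=> N k; apply: (le_trans (cont_mono (bdd_box _ _) (affd_box (t := const_mx (2 ^+ N)^-1) d0))).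
apply: (le_trans (cont_box _ _)) => [i|]; first by rewrite !mxE mulr_ge0.
have -> : (2 ^+ (N * n) : R) = \prod_(i < n) 2 ^+ N.
  by rewrite prodr_const card_ord exprM.
by rewrite -prodf_div; apply: ler_prod => i _; rewrite !mxE mulr_ge0 //=.
Qed.

Lemma bdd_affd n (d b : 'rV[R]_n) A : bdd A -> bdd (affd d b @` A).
Proof.
move=> [r hr]; exists (\sum_i (`|d ord0 i| * `|r| + `|b ord0 i|)) => _ [x Ax <-] i.
rewrite mxE (bigD1 i) //=; apply: (@le_trans _ _ (`|d ord0 i| * `|r| + `|b ord0 i|)).
  apply: (le_trans (ler_normD _ _)); rewrite lerD2r normrM ler_wpM2l //.
  exact: le_trans (hr _ Ax i) (ler_norm _).
by rewrite lerDl; apply: sumr_ge0 => j _; rewrite addr_ge0 // mulr_ge0.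
Qed.

Lemma affdE n (t : R) (b x : 'rV[R]_n) : affd (const_mx t) b x = t *: x + b.
Proof. by apply/rowP => i; rewrite !mxE. Qed.

Lemma bdd_scale n (t : R) (b : 'rV[R]_n) A : bdd A -> bdd ((fun x => t *: x + b) @` A).
Proof.
move=> bA; apply: bdd_sub (bdd_affd (const_mx t) b bA) => _ [x Ax <-].
by exists x => //; rewrite affdE.
Qed.

Lemma cont_scale_le n (t : R) (b : 'rV[R]_n) A : 0 <= t -> bdd A ->
  cont ((fun x => t *: x + b) @` A) <= t ^+ n * cont A.
Proof.
move=> t0 bA; have d0 i : 0 <= (const_mx t : 'rV[R]_n) ord0 i by rewrite mxE.
have := cont_affd_le b d0 bA.
rewrite (eq_bigr (fun=> t)) => [|i _]; last by rewrite mxE.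
rewrite prodr_const card_ord; apply: le_trans; apply: cont_mono; first exact: bdd_affd.
by move=> _ [x Ax <-]; exists x => //; rewrite affdE.
Qed.

(** The reverse inequality is the same bound for the inverse similarity. *)
Lemma cont_scale n (t : R) (b : 'rV[R]_n) A : 0 < t -> bdd A ->
  cont ((fun x => t *: x + b) @` A) = t ^+ n * cont A.
Proof.
move=> t0 bA; apply/eqP; rewrite eq_le cont_scale_le ?(ltW t0) //=.
have t1 : 0 <= t^-1 by rewrite invr_ge0 ltW.
have := cont_scale_le (- (t^-1 *: b)) t1 (bdd_scale t b bA).
rewrite -(ler_pM2l (exprn_gt0 n t0)) mulrA -exprMn mulfV ?gt_eqF // expr1n mul1r.
apply: le_trans; rewrite ler_pM2l ?exprn_gt0 //; apply: cont_mono.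
  by apply: bdd_scale; exact: bdd_scale.
move=> x Ax; exists (t *: x + b); first by exists x.
by rewrite scalerDr scalerA mulVf ?gt_eqF // scale1r addrK.
Qed.

Definition ucube n : set 'rV[R]_n := box 0 (const_mx 1).

Lemma bdd_ucube n : bdd (@ucube n).
Proof. exact: bdd_box. Qed.

Lemma cont_ucube_le n : cont (@ucube n) <= 1.
Proof.
apply: (le_trans (cont_box _ _)) => [i|]; first by rewrite mxE.
by rewrite big1 // => i _; rewrite mxE.
Qed.

(** The [2 ^ (N * n)] grid points [f / 2 ^+ N] of the cube have distinct cells, all of which a
    covering must list. *)
Lemma cont_ucube_ge n : 1 <= cont (@ucube n).
Proof.
apply: cont_ge; first exact: bdd_ucube.
move=> N s hs; rewrite ler_pdivlMr ?exprn_gt0 // mul1r -natrX ler_nat.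
pose g (f : {ffun 'I_n -> 'I_(2 ^ N)}) : 'rV[int]_n := \row_i (f i : nat)%:Z.
have gi : injective g.
  move=> f f' /rowP h; apply/ffunP => i; have := h i; rewrite !mxE => -[]; exact: val_inj.
have <- : size (map g (enum {: {ffun 'I_n -> 'I_(2 ^ N)}})) = (2 ^ (N * n))%N.
  by rewrite size_map -cardE card_ffun !card_ord expnM.
apply: uniq_leq_size; first by rewrite map_inj_uniq // enum_uniq.
move=> _ /mapP[f _ ->].
have -> : g f = cell N (\row_i ((f i : nat)%:R / 2 ^+ N) : 'rV[R]_n).
  apply/rowP => i; rewrite !mxE mulrC divfK ?expf_neq0 //.
  by rewrite -[(f i)%:R]/((f i : nat)%:Z%:~R) intrKfloor.
apply: hs => i; rewrite !mxE add0r divr_ge0 ?ler0n ?exprn_ge0 //=.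
by rewrite ler_pdivrMr ?exprn_gt0 // mul1r -natrX ler_nat ltnW.
Qed.

Definition img n m (L : 'M[R]_(n, m)) A := (fun x : 'rV[R]_n => x *m L) @` A.

Lemma bdd_img n m (L : 'M[R]_(n, m)) A : bdd A -> bdd (img L A).
Proof.
move=> [r hr]; exists (\sum_i \sum_j `|r| * `|L i j|) => _ [x Ax <-] j.
rewrite mxE; apply: (le_trans (ler_norm_sum _ _ _)); apply: ler_sum => i _.
rewrite (bigD1 j) //= normrM; apply: (@le_trans _ _ (`|r| * `|L i j|)).
  by rewrite ler_wpM2r //; exact: le_trans (hr _ Ax i) (ler_norm _).
by rewrite lerDl; apply: sumr_ge0 => l _; rewrite mulr_ge0.
Qed.

(* The factor by which L scales content, i.e. |det L|; only its multiplicativity is needed. *)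
Definition kap n (L : 'M[R]_n) : R := cont (img L (@ucube n)).

Lemma cbox_ucube n N (k : 'rV[int]_n) (t : R) : 0 < t ->
  box (\row_i ((k ord0 i)%:~R / 2 ^+ N)) (const_mx t) =
  (fun x => t *: x + \row_i ((k ord0 i)%:~R / 2 ^+ N)) @` (@ucube n).
Proof.
move=> t0; set a := \row_i _; apply/seteqP; split => [x hx|_ [x hx <-] i].
  exists (t^-1 *: (x - a)); last by rewrite scalerA mulfV ?gt_eqF // scale1r subrK.
  move=> i; have := hx i; rewrite !mxE => /andP[h1 h2].
  have ti : 0 < t^-1 by rewrite invr_gt0.
  rewrite add0r mulr_ge0 ?subr_ge0 ?(ltW ti) //=.
  by rewrite mulrC ler_pdivrMr // mul1r lerBlDl.
have := hx i; rewrite !mxE add0r => /andP[h1 h2].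
have := ler_wpM2l (ltW t0) h1; have := ler_wpM2l (ltW t0) h2.
by rewrite mulr0 mulr1 => *; apply/andP; split; lra.
Qed.

Lemma img_scale n m (L : 'M[R]_(n, m)) t b A :
  img L ((fun x => t *: x + b) @` A) = (fun x => t *: x + b *m L) @` (img L A).
Proof.
apply/seteqP; split => [_ [_ [x Ax <-] <-]|_ [_ [x Ax <-] <-]].
  by exists (x *m L); [exists x|rewrite mulmxDl scalemxAl].
by exists (t *: x + b); [exists x|rewrite mulmxDl scalemxAl].
Qed.

Lemma cont_img_le n (L : 'M[R]_n) A : bdd A -> cont (img L A) <= kap L * cont A.
Proof.
move=> bA; apply: cont_image_le => //; first exact: cont_ge0.
  by move=> N k; apply: bdd_img; exact: bdd_box.
move=> N k; rewrite -/(img L _) /cbox cbox_ucube ?invr_gt0 ?exprn_gt0 // img_scale.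
rewrite cont_scale ?invr_gt0 ?exprn_gt0 //; last by apply: bdd_img; exact: bdd_ucube.
by rewrite exprVn -exprM mulrC.
Qed.

Lemma kap_diag_le n (d : 'rV[R]_n) : (forall i, 0 <= d ord0 i) ->
  kap (diag_mx d) <= \prod_i d ord0 i.
Proof.
move=> d0; have := cont_affd_le 0 d0 (bdd_ucube n).
have -> : affd d 0 @` (@ucube n) = img (diag_mx d) (@ucube n).
  congr (_ @` _); apply/funext => x; apply/rowP => i.
  by rewrite mul_mx_diag !mxE addr0 mulrC.
move=> /le_trans; apply; rewrite -[leRHS]mulr1 ler_wpM2l ?cont_ucube_le //.
exact: prodr_ge0.
Qed.

Lemma img_comp n m p (L : 'M[R]_(n, m)) (M : 'M[R]_(m, p)) A : img M (img L A) = img (L *m M) A.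
Proof.
apply/seteqP; split => [_ [_ [x Ax <-] <-]|_ [x Ax <-]].
  by exists x => //; rewrite mulmxA.
by exists (x *m L); [exists x|rewrite mulmxA].
Qed.

Lemma img1 n (A : set 'rV[R]_n) : img 1%:M A = A.
Proof.
apply/seteqP; split => [_ [x Ax <-]|x Ax]; first by rewrite mulmx1.
by exists x; rewrite ?mulmx1.
Qed.

(** The entries of the inverse matrix bound the factor by which it enlarges the sup norm, so [L]
    brings points closer by at most a fixed factor. *)
Lemma img_sep n (L : 'M[R]_n) A B : L \in unitmx -> sep A B -> sep (img L A) (img L B).
Proof.
move=> uL [e e0 h]; pose S := 1 + \sum_i \sum_j `|invmx L i j|.
have S0 : 0 < S.
  by rewrite ltr_wpDr //; apply: sumr_ge0 => i _; apply: sumr_ge0.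
exists (e / S); first exact: divr_gt0.
move=> _ _ [x Ax <-] [y By <-]; apply: contrapT => hn.
have [i] := h x y Ax By.
rewrite leNgt => /negP; apply.
have hl j : `|(x *m L) ord0 j - (y *m L) ord0 j| <= e / S.
  by rewrite leNgt; apply/negP => lt; apply: hn; exists j; exact: ltW.
have -> : x ord0 i - y ord0 i = ((x *m L - y *m L) *m invmx L) ord0 i.
  by rewrite -mulmxBl mulmxK // !mxE.
rewrite mxE; apply: (le_lt_trans (ler_norm_sum _ _ _)).
apply: (@le_lt_trans _ _ (\sum_j e / S * `|invmx L j i|)).
  by apply: ler_sum => j _; rewrite normrM ler_wpM2r // !mxE; have := hl j; rewrite !mxE.
rewrite -mulr_sumr -[ltRHS](divfK (lt0r_neq0 S0)) ltr_pM2l ?divr_gt0 //.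
rewrite /S -[ltLHS]add0r; apply: ltr_leD => //; apply: ler_sum => j _.
by rewrite (bigD1 i) //= lerDl; apply: sumr_ge0.
Qed.

Lemma sep_bigU n (I : eqType) (r : seq I) (F : I -> set 'rV[R]_n) A :
  (forall i, i \in r -> sep A (F i)) -> sep A (fun x => exists2 i, i \in r & F i x).
Proof.
elim: r => [|i r IH] h; first by exists 1 => // x y _ [].
have [e e0 he] : sep A (F i) by apply: h; exact: mem_head.
have [|q q0 hq] := IH; first by move=> j jr; apply: h; rewrite in_cons jr orbT.
exists (Num.min e q); first by rewrite lt_min e0.
move=> x y Ax [j]; rewrite in_cons => /orP[/eqP->|jr] Fy.
  by have [k hk] := he _ _ Ax Fy; exists k; rewrite ge_min hk.
by have [|k hk] := hq x y Ax; [exists j|exists k; rewrite ge_min hk orbT].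
Qed.

Lemma cont_sep_big n (I : eqType) (r : seq I) (F : I -> set 'rV[R]_n) A :
  uniq r -> bdd A -> (forall i, i \in r -> F i `<=` A) ->
  (forall i j, i \in r -> j \in r -> i != j -> sep (F i) (F j)) ->
  \sum_(i <- r) cont (F i) <= cont A.
Proof.
move=> ur bA FA hs.
apply: (@le_trans _ _ (cont (fun x => exists2 i, i \in r & F i x))); last first.
  by apply: cont_mono => // x [i ir]; exact: FA.
elim: r ur FA hs => [|i r IH] /= ; first by rewrite big_nil cont_ge0.
move=> /andP[nir ur] FA hs; rewrite big_cons.
have bF j : j \in i :: r -> bdd (F j) by move=> jr; apply: bdd_sub bA; exact: FA.
have bi := bF i (mem_head _ _).
have bU : bdd (fun x => exists2 j, j \in r & F j x).
  apply: bdd_sub bA => x [j jr]; apply: FA; by rewrite in_cons jr orbT.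
have sU : sep (F i) (fun x => exists2 j, j \in r & F j x).
  apply: sep_bigU => j jr; apply: hs; rewrite ?mem_head ?in_cons ?jr ?orbT //.
  by apply: contraNneq nir => ->.
have := cont_sep bi bU sU.
have {}IH := IH ur; move=> /(le_trans _) H.
have ir j : j \in r -> j \in i :: r by rewrite in_cons => ->; rewrite orbT.
have {}IH := IH (fun j jr => FA j (ir j jr)) (fun j k jr kr => hs j k (ir j jr) (ir k kr)).
apply: (le_trans (lerD (lexx _) IH)).
apply: (le_trans (H _ (lexx _))); apply: cont_mono; first by apply: bdd_sub bA => x [j jr]; exact: FA.
move=> x [Fx|[j jr Fx]]; first by exists i => //; exact: mem_head.
by exists j => //; rewrite in_cons jr orbT.
Qed.

End LinearImages.


(** * Euclidean scalar product and norm *)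

Section DotProduct.
Variables (R : realType) (n : nat).
Implicit Types x y z : 'rV[R]_n.

Definition dot x y : R := \sum_i x ord0 i * y ord0 i.

Lemma dotE x y : dot x y = (x *m y^T) ord0 ord0.
Proof. by rewrite mxE; apply: eq_bigr => i _; rewrite !mxE. Qed.

Lemma dotC x y : dot x y = dot y x.
Proof. by apply: eq_bigr => i _; rewrite mulrC. Qed.

Lemma dotDl x y z : dot (x + y) z = dot x z + dot y z.
Proof. by rewrite -big_split; apply: eq_bigr => i _; rewrite mxE mulrDl. Qed.

Lemma dotZl a x y : dot (a *: x) y = a * dot x y.
Proof. by rewrite mulr_sumr; apply: eq_bigr => i _; rewrite mxE mulrA. Qed.

Lemma dotNl x y : dot (- x) y = - dot x y.
Proof. by rewrite -scaleN1r dotZl mulN1r. Qed.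

Lemma dotBl x y z : dot (x - y) z = dot x z - dot y z.
Proof. by rewrite dotDl dotNl. Qed.

Lemma dotDr x y z : dot z (x + y) = dot z x + dot z y.
Proof. by rewrite dotC dotDl !(dotC z). Qed.

Lemma dotZr a x y : dot x (a *: y) = a * dot x y.
Proof. by rewrite dotC dotZl dotC. Qed.

Lemma dotNr x y : dot x (- y) = - dot x y.
Proof. by rewrite dotC dotNl dotC. Qed.

Lemma dotBr x y z : dot z (x - y) = dot z x - dot z y.
Proof. by rewrite dotDr dotNr. Qed.

Lemma dot0l x : dot 0 x = 0.
Proof. by rewrite -(scale0r 0) dotZl mul0r. Qed.

Lemma dot0r x : dot x 0 = 0.
Proof. by rewrite dotC dot0l. Qed.

Lemma dot_ge0 x : 0 <= dot x x.
Proof. by apply: sumr_ge0 => i _; rewrite -expr2 sqr_ge0. Qed.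

Lemma sqr_le_dot x i : x ord0 i ^+ 2 <= dot x x.
Proof.
rewrite /dot (bigD1 i) //= -expr2 lerDl; apply: sumr_ge0 => j _.
by rewrite -expr2 sqr_ge0.
Qed.

Lemma dot_eq0 x : (dot x x == 0) = (x == 0).
Proof.
apply/eqP/eqP => [h|->]; last exact: dot0l.
apply/rowP => i; rewrite mxE; apply/eqP; rewrite -sqrf_eq0 eq_le sqr_ge0 andbT -h.
exact: sqr_le_dot.
Qed.

Lemma dot_gt0 x : x != 0 -> 0 < dot x x.
Proof. by move=> h; rewrite lt_def dot_ge0 dot_eq0 h. Qed.

Lemma dot_mxr x y (P : 'M[R]_n) : dot (x *m P) y = dot x (y *m P^T).
Proof. by rewrite !dotE trmx_mul trmxK mulmxA. Qed.

Definition enorm x : R := Num.sqrt (dot x x).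

Lemma enorm_ge0 x : 0 <= enorm x. Proof. exact: sqrtr_ge0. Qed.

Lemma sqr_enorm x : enorm x ^+ 2 = dot x x.
Proof. by rewrite sqr_sqrtr // dot_ge0. Qed.

Lemma enorm_gt0 x : x != 0 -> 0 < enorm x.
Proof. by move=> h; rewrite sqrtr_gt0 dot_gt0. Qed.

Lemma enormZ a x : enorm (a *: x) = `|a| * enorm x.
Proof.
by rewrite /enorm dotZl dotZr mulrA -expr2 sqrtrM ?sqr_ge0 // sqrtr_sqr.
Qed.

Lemma coord_le_enorm x i : `|x ord0 i| <= enorm x.
Proof. by rewrite -sqrtr_sqr ler_sqrt ?dot_ge0 // sqr_le_dot. Qed.

Lemma dot_le_enorm x y : dot x y <= enorm x * enorm y.
Proof.
have [->|x0] := eqVneq x 0; first by rewrite dot0l mulr_ge0 ?enorm_ge0.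
have [->|y0] := eqVneq y 0; first by rewrite dot0r mulr_ge0 ?enorm_ge0.
have px := enorm_gt0 x0; have py := enorm_gt0 y0.
(* The square of this vector is twice [enorm x * enorm y * (enorm x * enorm y - dot x y)]. *)
have := dot_ge0 (enorm y *: x - enorm x *: y).
rewrite dotBl !dotBr !dotZl !dotZr -!sqr_enorm (dotC y x) => h.
rewrite -(ler_pM2l (mulr_gt0 px py)); move: h; nra.
Qed.

Lemma enormD x y : enorm (x + y) <= enorm x + enorm y.
Proof.
rewrite -(ler_pXn2r (n := 2)) ?nnegrE ?addr_ge0 ?enorm_ge0 //.
rewrite sqr_enorm dotDl !dotDr -!sqr_enorm (dotC y x).
have := dot_le_enorm x y; nra.
Qed.

Lemma enorm_le_sup x d : 0 <= d -> (forall i, `|x ord0 i| <= d) -> enorm x <= n%:R * d.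
Proof.
move=> d0 h; rewrite -(ler_pXn2r (n := 2)) ?nnegrE ?mulr_ge0 ?enorm_ge0 ?ler0n //.
rewrite sqr_enorm /dot; apply: (@le_trans _ _ (\sum_(i < n) d ^+ 2)).
  apply: ler_sum => i _; rewrite -expr2 -real_normK ?num_real //.
  by rewrite ler_pXn2r ?nnegrE.
rewrite sumr_const card_ord exprMn -[leLHS]mulr_natl ler_wpM2r ?sqr_ge0 //.
by rewrite -natrX ler_nat; case: (n) => // m; rewrite expnS leq_pmulr // expn_gt0.
Qed.

End DotProduct.

(** * Exact scaling by linear maps, and contents of products *)

Section Multiplicativity.
Variable R : realType.

(* Sets that the dyadic grids approximate from inside and outside up to dilation. *)
Definition nice n (A : set 'rV[R]_n) := bdd A /\ forall e, 0 < e -> exists2 d, 0 < d &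
  forall x y : 'rV[R]_n, A x -> (forall i, `|y ord0 i - x ord0 i| <= d) ->
    exists2 z, A z & y = (1 + e) *: z.

Definition eball n (r : R) : set 'rV[R]_n := [set x | dot x x <= r ^+ 2].

(** The point [y / (1 + e)] is a convex combination of [x] and [(y - x) / e], and the latter has
    coordinates at most [r] once [y] is within [r * e] of [x]. *)
Lemma nice_convex n (A : set 'rV[R]_n) (r : R) : 0 < r -> bdd A -> convex_set_n A ->
  (forall y : 'rV[R]_n, (forall i, `|y ord0 i| <= r) -> A y) -> nice A.
Proof.
move=> r0 bA cA hr; split => // e e0; exists (r * e); first exact: mulr_gt0.
move=> x y Ax hy; exists ((1 + e)^-1 *: y); last first.
  by rewrite scalerA mulfV ?scale1r // gt_eqF //; lra.
have e1 : 0 < 1 + e by lra.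
have ei : e / (1 + e) <= 1 by rewrite ler_pdivrMr //; lra.
have -> : (1 + e)^-1 *: y = (1 - e / (1 + e)) *: x + (e / (1 + e)) *: (e^-1 *: (y - x)).
  have -> : 1 - e / (1 + e) = (1 + e)^-1 by field; rewrite gt_eqF.
  by rewrite scalerA mulrAC mulfV ?gt_eqF // mul1r -scalerDr addrCA subrr addr0.
apply: cA => //; last by rewrite divr_ge0 // ltW.
apply: hr => i; have := hy i; rewrite !mxE => h.
rewrite normrM gtr0_norm ?invr_gt0 // mulrC ler_pdivrMr //.
Qed.

Lemma convex_eball n (r : R) : convex_set_n (@eball n r).
Proof.
move=> x y t; rewrite /eball /= => hx hy t0 t1; rewrite dotDl !dotDr !dotZl !dotZr (dotC y x).
have := dot_ge0 (x - y); rewrite dotBl !dotBr (dotC y x) => h.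
set a := dot x x in hx h *; set b := dot y y in hy h *; set c := dot x y in h *.
have : 0 <= t * (1 - t) by rewrite mulr_ge0 // subr_ge0.
nra.
Qed.

Lemma bdd_eball n (r : R) : bdd (@eball n r).
Proof.
exists `|r| => x hx i; rewrite -(ler_pXn2r (n := 2)) ?nnegrE //.
by rewrite !real_normK ?num_real //; apply: le_trans hx; exact: sqr_le_dot.
Qed.

Lemma eball_sup n (r : R) (y : 'rV[R]_n) : 0 <= r ->
  (forall i, `|y ord0 i| <= r / n.+1%:R) -> eball r y.
Proof.
move=> r0 h; rewrite /eball /= -sqr_enorm ler_pXn2r ?nnegrE ?enorm_ge0 //.
apply: (le_trans (enorm_le_sup _ h)); first by rewrite divr_ge0.
rewrite mulrCA -[leRHS]mulr1 ler_wpM2l // ler_pdivrMr ?ltr0n // mul1r ler_nat //.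
Qed.

Lemma nice_eball n (r : R) : 0 < r -> nice (@eball n r).
Proof.
move=> r0; apply: (@nice_convex _ _ (r / n.+1%:R)).
- by rewrite divr_gt0 ?ltr0n.
- exact: bdd_eball.
- exact: convex_eball.
- by move=> y; apply: eball_sup; exact: ltW.
Qed.

Lemma cont_eball_gt0 n (r : R) : 0 < r -> 0 < cont (@eball n r).
Proof.
move=> r0; have q0 : 0 < r / n.+1%:R by rewrite divr_gt0 ?ltr0n.
apply: (@lt_le_trans _ _ ((r / n.+1%:R) ^+ n * cont (@ucube R n))).
  by rewrite mulr_gt0 ?exprn_gt0 // (lt_le_trans ltr01) // cont_ucube_ge.
rewrite -(cont_scale 0 q0 (@bdd_ucube R n)); apply: cont_mono; first exact: bdd_eball.
move=> _ [x hx <-]; apply: eball_sup; first exact: ltW.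
move=> i; have := hx i; rewrite !mxE addr0 add0r => /andP[h1 h2].
have := ler_wpM2l (ltW q0) h2; rewrite mulr1; apply: le_trans.
by rewrite ger0_norm // mulr_ge0 // ltW.
Qed.

(** For the lower bound, grid cubes meeting [A] are shrunk by [1 + e] towards their lower corners.
    They are then pairwise at positive distance and lie in [(1 + e) A]; their images have contents
    proportional to [kap L], with sum at most the content of the image of [(1 + e) A]. *)
Lemma cont_img_nice n (L : 'M[R]_n) A : nice A -> L \in unitmx ->
  cont (img L A) = kap L * cont A.
Proof.
move=> [bA nA] uL; apply/eqP; rewrite eq_le cont_img_le //=.
(* One factor [(1 + e) ^+ n] comes from shrinking the cubes, the other from dilating [A]. *)
have -> : cont (img L A) = ((1 + 'X) ^+ (n + n) * (cont (img L A))%:P).[0].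
  by rewrite !hornerE expr1n mul1r.
apply: poly_ge_at0 => e e0 _; rewrite !hornerE.
have e1 : 0 < 1 + e by lra.
have [d d0 hd] := nA e e0; have [N hN] := dyadic_small d0.
have [s hs] := bdd_covered N bA.
pose m k := `[< exists2 x, A x & cell N x = k >].
pose s' := undup (seq.filter m s).
have hs' : covered N s' A.
  move=> x Ax; rewrite mem_undup mem_filter hs // andbT.
  by apply/asboolP; exists x.
pose a (k : 'rV[int]_n) : 'rV[R]_n := \row_i ((k ord0 i)%:~R / 2 ^+ N).
pose q := (2 ^+ N)^-1 : R.
have q0 : 0 < q by rewrite invr_gt0 exprn_gt0.
pose t := q / (1 + e); have t0 : 0 < t by rewrite divr_gt0.
pose F k := img L (box (a k) (const_mx t)).
have bF k : bdd (F k) by apply: bdd_img; exact: bdd_box.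
have cF k : cont (F k) = t ^+ n * kap L.
  by rewrite /F cbox_ucube // img_scale cont_scale //; apply: bdd_img; exact: bdd_ucube.
have tq : t < q by rewrite ltr_pdivrMr // ltr_pMr //; lra.
have : \sum_(k <- s') cont (F k) <= cont ((fun x => (1 + e) *: x + 0) @` img L A).
  apply: cont_sep_big; first exact: undup_uniq.
  - by apply: bdd_scale; exact: bdd_img.
  - move=> k; rewrite mem_undup mem_filter => /andP[/asboolP[x Ax ex] _] _ [y hy <-].
    have [i|z Az ->] := hd x y Ax; last by exists (z *m L); [exists z|rewrite addr0 scalemxAl].
    have := hy i; have := cell_cbox N x i; rewrite ex !mxE -/q.
    by rewrite ler_norml => /andP[h1 h2] /andP[h3 h4]; rewrite -/q in hN; apply/andP; split; lra.
  - move=> k l _ _ kl; apply: img_sep => //; exists (q - t); first by rewrite subr_gt0.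
    move=> x y hx hy; have [i hi] : exists i, k ord0 i != l ord0 i.
      apply: contrapT => h; case/negP: kl; apply/eqP/rowP => i; apply/eqP.
      by apply: contrapT => /negP h'; apply: h; exists i.
    exists i; have := hx i; have := hy i; rewrite !mxE -/q => /andP[h1 h2] /andP[h3 h4].
    move: hi; rewrite neq_lt => /orP[]; rewrite -lezD1 -(ler_int R) intrD => h;
      have := ler_wpM2r (ltW q0) h; rewrite mulrDl mul1r => h'.
      by rewrite distrC; apply: le_trans (ler_norm _); lra.
    by apply: le_trans (ler_norm _); lra.
rewrite cont_scale //; last exact: bdd_img.
rewrite (eq_bigr (fun=> t ^+ n * kap L)) => [|k _]; last exact: cF.
rewrite big_const_seq count_predT iter_addr_0 -mulr_natr => h.
have := cont_le hs'; rewrite mulrC exprM -exprVn -/q => h2.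
have k0 : 0 <= kap L by exact: cont_ge0.
have p0 : 0 < (1 + e) ^+ n by rewrite exprn_gt0.
have := ler_wpM2l k0 h2; move=> /le_trans; apply.
have -> : kap L * (q ^+ n * (size s')%:R) = (1 + e) ^+ n * (t ^+ n * kap L * (size s')%:R).
  by rewrite /t expr_div_n; field; rewrite gt_eqF.
by rewrite exprD -[leRHS]mulrA ler_wpM2l // ltW.
Qed.

Lemma nice_img n (L : 'M[R]_n) A : nice A -> L \in unitmx -> nice (img L A).
Proof.
move=> [bA nA] uL; split; first exact: bdd_img.
move=> e e0; have [d d0 hd] := nA e e0.
pose S := 1 + \sum_i \sum_j `|invmx L i j|.
have S0 : 0 < S by rewrite ltr_wpDr //; apply: sumr_ge0 => i _; apply: sumr_ge0.
exists (d / S); first exact: divr_gt0.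
move=> _ y [x Ax <-] hy; have [i|z Az ez] := hd x (y *m invmx L) Ax; last first.
  by exists (z *m L); [exists z|rewrite scalemxAl -ez mulmxKV].
have -> : (y *m invmx L) ord0 i - x ord0 i = ((y - x *m L) *m invmx L) ord0 i.
  by rewrite mulmxBl mulmxK // !mxE.
rewrite mxE; apply: (le_trans (ler_norm_sum _ _ _)).
apply: (@le_trans _ _ (\sum_j d / S * `|invmx L j i|)).
  by apply: ler_sum => j _; rewrite normrM ler_wpM2r // !mxE; have := hy j; rewrite !mxE.
rewrite -mulr_sumr -[leRHS](divfK (lt0r_neq0 S0)) ler_wpM2l ?divr_ge0 ?(ltW d0) ?(ltW S0) //.
rewrite /S ler_wpDl //; apply: ler_sum => j _.
by rewrite (bigD1 i) //= lerDl; apply: sumr_ge0.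
Qed.

(** The unit ball serves as test set: its content is positive and can be cancelled. *)
Lemma kap_mul n (L M : 'M[R]_n) : L \in unitmx -> M \in unitmx -> kap (L *m M) = kap L * kap M.
Proof.
move=> uL uM; have b1 := nice_eball n ltr01.
apply: (mulIf (lt0r_neq0 (cont_eball_gt0 n ltr01))).
rewrite -cont_img_nice ?unitmx_mul ?uL // -img_comp cont_img_nice //; last exact: nice_img.
by rewrite cont_img_nice // mulrCA mulrA.
Qed.

Lemma kap1_le n : kap (1%:M : 'M[R]_n) <= 1.
Proof. by rewrite /kap img1 cont_ucube_le. Qed.

(** An orthogonal map preserves the unit ball, whose content is positive. *)
Lemma kap_orth n (O : 'M[R]_n) : O *m O^T = 1%:M -> kap O = 1.
Proof.
move=> hO; have [uO _] := mulmx1_unit hO.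
have hO' : O^T *m O = 1%:M by apply: mulmx1C.
have := cont_img_nice (nice_eball n ltr01) uO.
have -> : img O (@eball n 1) = @eball n 1.
  apply/seteqP; split => [_ [x hx <-]|x hx].
    by rewrite /eball /= dot_mxr -mulmxA hO mulmx1.
  exists (x *m O^T); last by rewrite -mulmxA hO' mulmx1.
  by rewrite /eball /= dot_mxr trmxK -mulmxA hO' mulmx1.
move=> h; apply: (mulIf (lt0r_neq0 (cont_eball_gt0 n ltr01))).
by rewrite mul1r -h.
Qed.

Lemma cont_orth n (O : 'M[R]_n) A : O *m O^T = 1%:M -> bdd A -> cont (img O A) <= cont A.
Proof. by move=> hO bA; rewrite -[leRHS]mul1r -(kap_orth hO) cont_img_le. Qed.

(** By multiplicativity the outer factors combine to that of [invmx B *m B], which is at most 1. *)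
Lemma kap_conj_le n (B D : 'M[R]_n) : B \in unitmx -> D \in unitmx ->
  kap (invmx B *m D *m B) <= kap D.
Proof.
move=> uB uD; rewrite !kap_mul ?unitmx_mul ?unitmx_inv ?uB ?uD //.
rewrite mulrAC -kap_mul ?unitmx_inv // mulVmx // -[leRHS]mul1r ler_wpM2r ?kap1_le //.
exact: cont_ge0.
Qed.

Definition prodset p q (A : set 'rV[R]_p) (B : set 'rV[R]_q) : set 'rV[R]_(p + q) :=
  [set x | A (lsubmx x) /\ B (rsubmx x)].

Lemma bdd_prodset p q (A : set 'rV[R]_p) (B : set 'rV[R]_q) :
  bdd A -> bdd B -> bdd (prodset A B).
Proof.
move=> [r hr] [t ht]; exists (Num.max r t) => x [Ax Bx] i.
rewrite -(hsubmxK x) mxE le_max; case: fintype.split => j.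
  by rewrite hr.
by rewrite ht ?orbT.
Qed.

(** If one cell meets [A] and another meets [B], the product cell meets the product set; a covering
    therefore contains all such pairs. *)
Lemma cont_prodset p q (A : set 'rV[R]_p) (B : set 'rV[R]_q) :
  bdd A -> bdd B -> cont A * cont B <= cont (prodset A B).
Proof.
move=> bA bB; apply: cont_ge; first exact: bdd_prodset.
move=> N s hs.
have cell_row x y : cell N (row_mx x y : 'rV[R]_(p + q)) = row_mx (cell N x) (cell N y).
  by rewrite /cell map_row_mx.
have [[b Bb]|nB] := pselect (exists b, B b); last first.
  have -> : cont B = 0.
    apply/eqP; rewrite eq_le cont_ge0 andbT.
    have : covered 0 [::] B by move=> x Bx; case: nB; exists x.
    by move=> /cont_le; rewrite mul0r.
  by rewrite mulr0 divr_ge0 ?ler0n ?exprn_ge0.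
have [[a Aa]|nA] := pselect (exists a, A a); last first.
  have -> : cont A = 0.
    apply/eqP; rewrite eq_le cont_ge0 andbT.
    have : covered 0 [::] A by move=> x Ax; case: nA; exists x.
    by move=> /cont_le; rewrite mul0r.
  by rewrite mul0r divr_ge0 ?ler0n ?exprn_ge0.
have inP x y : A x -> B y -> row_mx (cell N x) (cell N y) \in s.
  by move=> Ax By; rewrite -cell_row; apply: hs; split; rewrite ?row_mxKl ?row_mxKr.
pose mA k := `[< exists2 x, A x & cell N x = k >].
pose mB k := `[< exists2 x, B x & cell N x = k >].
pose sA := undup (seq.filter mA (map lsubmx s)).
pose sB := undup (seq.filter mB (map rsubmx s)).
have cA : covered N sA A.
  move=> x Ax; rewrite mem_undup mem_filter; apply/andP; split; first by apply/asboolP; exists x.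
  by apply/mapP; exists (row_mx (cell N x) (cell N b)); [exact: inP|rewrite row_mxKl].
have cB : covered N sB B.
  move=> x Bx; rewrite mem_undup mem_filter; apply/andP; split; first by apply/asboolP; exists x.
  by apply/mapP; exists (row_mx (cell N a) (cell N x)); [exact: inP|rewrite row_mxKr].
apply: (le_trans (ler_pM (cont_ge0 _) (cont_ge0 _) (cont_le cA) (cont_le cB))).
rewrite mulrACA -invfM -exprD -mulnDr ler_wpM2r ?invr_ge0 ?exprn_ge0 //.
rewrite -natrM ler_nat -(size_allpairs (fun x y => row_mx x y)).
apply: uniq_leq_size.
  rewrite allpairs_uniq ?undup_uniq // => -[k l] [k' l'] _ _ /= /eq_row_mx[-> ->] //.
move=> _ /allpairsP[[k l] [/= hk hl ->]].
move: hk hl; rewrite !mem_undup !mem_filter => /andP[/asboolP[x Ax <-] _].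
by move=> /andP[/asboolP[y By <-] _]; exact: inP.
Qed.

End Multiplicativity.


(** * Lower bound for the content of the unit ball *)

Section BallVolume.
Variable R : realType.

Definition ballc n : R := cont (@eball R n 1).

Lemma ballc_ge0 n : 0 <= ballc n. Proof. exact: cont_ge0. Qed.

Lemma cont_eball_ge n (r : R) : 0 <= r -> r ^+ n * ballc n <= cont (@eball R n r).
Proof.
rewrite le_eqVlt => /orP[/eqP<-|r0].
  case: n => [|n]; last by rewrite expr0n mul0r cont_ge0.
  rewrite mul1r; apply: cont_mono; first exact: bdd_eball.
  by move=> x; rewrite /eball /= /dot !big_ord0 // expr0n.
rewrite /ballc -(cont_scale 0 r0 (@bdd_eball R n 1)); apply: cont_mono; first exact: bdd_eball.
move=> _ [x hx <-]; rewrite /eball /= addr0 dotZl dotZr mulrA -expr2.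
by rewrite -[leRHS]mulr1 ler_wpM2l ?sqr_ge0 //; move: hx; rewrite /eball /= expr1n.
Qed.

Lemma cont_eball_le n (r : R) : 0 <= r -> cont (@eball R n r) <= r ^+ n * ballc n.
Proof.
move=> r0; pose p : {poly R} := (r%:P + 'X) ^+ n * (ballc n)%:P.
have -> : r ^+ n * ballc n = p.[0] by rewrite !hornerE.
apply: poly_ge_at0 => e e0 _; rewrite !hornerE.
have re : 0 < r + e by lra.
rewrite /ballc -(cont_scale 0 re (@bdd_eball R n 1)).
apply: cont_mono; first by apply: bdd_scale; exact: bdd_eball.
move=> x hx; exists ((r + e)^-1 *: x); last by rewrite addr0 scalerA mulfV ?gt_eqF // scale1r.
rewrite /eball /= dotZl dotZr mulrA -expr2 expr1n exprVn mulrC ler_pdivrMr ?exprn_gt0 //.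
by rewrite mul1r; apply: (le_trans hx); rewrite ler_pXn2r ?nnegrE //; lra.
Qed.

Lemma dot_split p q (x : 'rV[R]_(p + q)) :
  dot x x = dot (lsubmx x) (lsubmx x) + dot (rsubmx x) (rsubmx x).
Proof.
by rewrite /dot big_split_ord; congr (_ + _); apply: eq_bigr => i _; rewrite !mxE.
Qed.

Definition annulus n (r t : R) : set 'rV[R]_n := [set x | r ^+ 2 < dot x x <= t ^+ 2].

Lemma cont_annulus_ge n (r t : R) : 0 <= r -> 0 <= t ->
  (t ^+ n - r ^+ n) * ballc n <= cont (@annulus n r t).
Proof.
move=> r0 t0.
have bA : bdd (@annulus n r t) by apply: bdd_sub (@bdd_eball R n t) => x /andP[].
have bB := @bdd_eball R n r.
have h : cont (@eball R n t) <= cont (@eball R n r) + cont (@annulus n r t).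
  apply: le_trans (contU bB bA); apply: cont_mono; first exact: bddU.
  move=> x hx; rewrite /eball /annulus /=; have [h|h] := leP (dot x x) (r ^+ 2); first by left.
  by right; apply/andP.
have h1 := cont_eball_ge n t0.
have := cont_eball_le n r0; rewrite mulrBl; lra.
Qed.

(* Stack M products of an annulus in R^p and a ball in R^q inside the ball of R^(p + q). *)
Lemma ballc_layers p q M (rho sig : nat -> R) :
  (forall i, (i <= M)%N -> 0 <= rho i) -> (forall i, (i < M)%N -> 0 <= sig i) ->
  (forall i, (i < M)%N -> rho i < rho i.+1) ->
  (forall i, (i < M)%N -> rho i.+1 ^+ 2 + sig i ^+ 2 <= 1) ->
  \sum_(i < M) ((rho i.+1 ^+ p - rho i ^+ p) * ballc p * (sig i ^+ q * ballc q)) <= ballc (p + q).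
Proof.
move=> rho0 sig0 rhoS hrs; rewrite -subr_ge0.
(* Shrinking the outer radius of each annulus by [1 - e] separates the layers. *)
pose P : {poly R} := (ballc (p + q))%:P - \sum_(i < M)
  (((1 - 'X) ^+ p * (rho i.+1 ^+ p)%:P - (rho i ^+ p)%:P) * (ballc p * (sig i ^+ q * ballc q))%:P).
have -> : ballc (p + q) - \sum_(i < M)
   ((rho i.+1 ^+ p - rho i ^+ p) * ballc p * (sig i ^+ q * ballc q)) = P.[0].
  rewrite /P hornerD hornerN horner_sum hornerC; congr (_ - _); apply: eq_bigr => i _.
  rewrite !(hornerM, hornerD, hornerN, hornerC, horner_exp, hornerX) subr0 expr1n mul1r.
  by rewrite -mulrA.
apply: poly_ge_at0 => e e0 e1; rewrite /P hornerD hornerN horner_sum hornerC subr_ge0.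
have mono i j : (i <= j)%N -> (j <= M)%N -> rho i <= rho j.
  elim: j => [|j IH]; first by rewrite leqn0 => /eqP->.
  rewrite leq_eqVlt => /orP[/eqP->//|ij] jM.
  by apply: le_trans (IH ij (ltnW jM)) _; apply: ltW; exact: rhoS.
pose F (i : 'I_M) := prodset (@annulus p (rho i) ((1 - e) * rho i.+1)) (@eball R q (sig i)).
have t0 (i : 'I_M) : 0 <= (1 - e) * rho i.+1.
  by apply: mulr_ge0; [lra|exact: rho0].
have bann n r t : bdd (@annulus n r t) by apply: bdd_sub (@bdd_eball R n t) => x /andP[].
have bF i : bdd (F i) by apply: bdd_prodset => //; exact: bdd_eball.
apply: (@le_trans _ _ (\sum_(i <- enum 'I_M) cont (F i))).
  rewrite big_enum /=; apply: ler_sum => i _.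
  rewrite !(hornerM, hornerD, hornerN, hornerC, horner_exp, hornerX).
  have h1 := @cont_annulus_ge p _ _ (rho0 i (ltnW (ltn_ord i))) (t0 i).
  have h2 := @cont_eball_ge q _ (sig0 i (ltn_ord i)).
  apply: le_trans (cont_prodset (bann _ _ _) (@bdd_eball R q (sig i))).
  rewrite -exprMn (mulrA _ (ballc p)); apply: (@le_trans _ _ (cont (@annulus p (rho i) ((1 - e) * rho i.+1)) * (sig i ^+ q * ballc q))).
    by rewrite ler_wpM2r // mulr_ge0 ?ballc_ge0 // exprn_ge0 // sig0.
  by rewrite ler_wpM2l // cont_ge0.
apply: cont_sep_big; first exact: enum_uniq.
- exact: bdd_eball.
- move=> i _ x [/andP[_ h1] h2]; rewrite /eball /= dot_split expr1n.
  apply: le_trans (hrs i (ltn_ord i)); apply: lerD => //; apply: (le_trans h1).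
  rewrite ler_pXn2r ?nnegrE ?t0 ?rho0 //; have := rho0 i.+1 (ltn_ord i); nra.
have main (i j : 'I_M) : (i < j)%N -> sep (F i) (F j).
  move=> ij; have r1 : 0 < rho i.+1.
    by apply: le_lt_trans (rhoS i (ltn_ord i)); apply: rho0; exact: ltnW.
  exists (e * rho i.+1 / p.+1%:R); first by rewrite divr_gt0 ?ltr0n // mulr_gt0.
  move=> x y [/andP[_ hx] _] [/andP[hy _] _]; apply: contrapT => hn.
  have hc (k : 'I_p) : `|(lsubmx y - lsubmx x) ord0 k| <= e * rho i.+1 / p.+1%:R.
    rewrite leNgt; apply/negP => lt; apply: hn; exists (lshift q k); move: lt.
    by rewrite !mxE distrC => /ltW.
  have c0 : 0 <= e * rho i.+1 / p.+1%:R by rewrite divr_ge0 ?ler0n // mulr_ge0 // ltW.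
  have := enorm_le_sup c0 hc; have := enormD (lsubmx x) (lsubmx y - lsubmx x).
  rewrite addrCA subrr addr0.
  have h1 : enorm (lsubmx x) <= (1 - e) * rho i.+1.
    by rewrite -(ler_pXn2r (n := 2)) ?nnegrE ?enorm_ge0 ?t0 // sqr_enorm.
  have h2 : rho j < enorm (lsubmx y).
    by rewrite -(ltr_pXn2r (n := 2)) ?nnegrE ?enorm_ge0 ?rho0 ?(ltnW (ltn_ord j)) // sqr_enorm.
  have h3 := mono i.+1 j ij (ltnW (ltn_ord j)).
  have : p%:R * (e * rho i.+1 / p.+1%:R) <= e * rho i.+1.
    rewrite mulrCA -[leRHS]mulr1 ler_wpM2l ?mulr_ge0 ?(ltW e0) ?(ltW r1) //.
    by rewrite ler_pdivrMr ?ltr0n // mul1r ler_nat.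
  move: (p%:R * _) (enorm _) (enorm _) (enorm _) h1 h2 => u v w z h1 h2 h4 h5 h6.
  lra.
move=> i j _ _; rewrite neq_ltn => /orP[|/main[d d0 hd]]; first exact: main.
by exists d => // x y Fx Fy; have [k hk] := hd y x Fy Fx; exists k; rewrite distrC.
Qed.

Lemma ballc0_ge1 : 1 <= ballc 0.
Proof.
apply: (le_trans (@cont_ucube_ge R 0)); apply: cont_mono; first exact: bdd_eball.
by move=> x _; rewrite /eball /= /dot big_ord0 expr1n.
Qed.

Lemma ballc1_ge2 : 2 <= ballc 1.
Proof.
have h2 : 0 < 2 :> R by [].
apply: (@le_trans _ _ (2 ^+ 1 * cont (@ucube R 1))).
  by rewrite expr1 ler_peMr // cont_ucube_ge.
rewrite -(cont_scale (const_mx (-1)) h2 (@bdd_ucube R 1)).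
apply: cont_mono; first exact: bdd_eball.
move=> _ [x hx <-]; rewrite /eball /= /dot big_ord1 !mxE; have := hx ord0; rewrite !mxE; nra.
Qed.

(** The mean value theorem twice: [sin h = h * cos c], and [cos c = 1 - sin d * c] is at least
    [1 - h]. *)
Lemma sin_ge (h : R) : 0 < h -> h * (1 - h) <= sin h.
Proof.
move=> h0.
have cs (f : R -> R) (a b : R) : continuous f -> {within `[a, b], continuous f}.
  by move=> cf; apply: continuous_subspaceT.
have [c /andP[c0 ch]] := MVT h0 (fun x _ => is_derive_sin x) (cs _ _ _ (@continuous_sin R)).
rewrite sin0 !subr0 => ->; rewrite bnd_simp in c0; rewrite bnd_simp in ch.
have [d /andP[d0 dc]] := MVT c0 (fun x _ => is_derive_cos x) (cs _ _ _ (@continuous_cos R)).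
rewrite cos0 subr0 => e; have := sin_le1 d.
have -> : cos c = 1 - sin d * c by lra.
move=> s1; have s2 : sin d * c <= c by nra.
have s3 : 0 <= h - sin d * c by lra.
have := mulr_ge0 (ltW h0) s3; lra.
Qed.

(** Reversing the index turns cosines into sines, as the arguments add up to [pi / 2]. With [i = 0]
    included the sum is half the number [M + 2] of its terms; the term [i = 0] is 1. *)
Lemma sum_cos2 M (h : R) : M.+1%:R * h = pi / 2 ->
  \sum_(i < M.+1) cos (i.+1%:R * h) ^+ 2 = M%:R / 2.
Proof.
move=> hM; have e : \sum_(i < M.+2) cos (i%:R * h) ^+ 2 = M.+2%:R / 2.
  have : \sum_(i < M.+2) cos (i%:R * h) ^+ 2 + \sum_(i < M.+2) cos (i%:R * h) ^+ 2 = M.+2%:R.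
    rewrite {2}(reindex_inj rev_ord_inj) /= -big_split /=.
    rewrite (eq_bigr (fun=> 1)) => [|i _]; first by rewrite sumr_const card_ord.
    have iM : (i <= M.+1)%N by rewrite -ltnS.
    rewrite subSS natrB // mulrBl hM cosB cos_pihalf sin_pihalf mul0r mul1r add0r.
    exact: cos2Dsin2.
  lra.
move: e; rewrite big_ord_recl mul0r cos0 expr1n; rewrite -[M.+2%:R]natr1 -natr1.
rewrite (eq_bigr (fun i : 'I_M.+1 => cos (i.+1%:R * h) ^+ 2)) //; lra.
Qed.

(** Rectangles inscribed in the disc at equally spaced angles: the layer from [sin (i h)] to
    [sin ((i + 1) h)] has width at least [sin h * cos ((i + 1) h)] on either side and half-height
    [cos ((i + 1) h)]. *)
Lemma ballc2_ge : pi <= ballc 2.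
Proof.
(* The rectangles add up to at least [2 * M * sin h], hence to [2 * M * h * (1 - h)]; this is the
   latter in terms of [1 / (M + 1)]. *)
pose p : {poly R} := pi%:P * (1 - 'X) * (1 - (pi / 2)%:P * 'X).
have -> : pi = p.[0] by rewrite /p !hornerE !subr0 !mulr1.
apply: poly_le_invn => M.
pose h := pi / 2 / M.+1%:R : R.
have M0 : 0 < M.+1%:R :> R by rewrite ltr0n.
have hM : M.+1%:R * h = pi / 2 by rewrite /h mulrC divfK // gt_eqF.
have h0 : 0 < h by rewrite !divr_gt0 ?pi_gt0.
have hle i : (i <= M.+1)%N -> i%:R * h <= pi / 2 by rewrite -hM ler_pM2r // ler_nat.
have hge i : 0 <= i%:R * h by rewrite mulr_ge0 // ltW.
have pi0 := @pi_gt0 R.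
have sin0' i : (i <= M.+1)%N -> 0 <= sin (i%:R * h).
  by move=> iM; apply: sin_ge0_pi; rewrite hge /=; have := hle _ iM; lra.
have cos0' i : (i <= M.+1)%N -> 0 <= cos (i%:R * h).
  by move=> iM; apply: cos_ge0_pihalf; rewrite hle // andbT; have := hge i; lra.
have := @ballc_layers 1 1 M.+1 (fun i => sin (i%:R * h)) (fun i => cos (i.+1%:R * h)) _ _ _ _.
move=> /(_ sin0') /(_ (fun i iM => cos0' i.+1 iM)) H.
have {}H := H _ _; apply: le_trans (H _ _) => [|i iM|i iM]; last 2 first.
- have inI j : (j <= M.+1)%N -> j%:R * h \in `[(- (pi / 2)), (pi / 2)].
    by move=> jM; rewrite in_itv /= hle // andbT; have := hge j; lra.
  by rewrite ltr_sin ?inI ?(ltnW iM) // ltr_pM2r // ltr_nat.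
- by rewrite addrC cos2Dsin2.
apply: (@le_trans _ _ (\sum_(i < M.+1) (4 * sin h * cos (i.+1%:R * h) ^+ 2))); last first.
  apply: ler_sum => i _; rewrite !expr1.
  have c0 := cos0' i.+1 (ltn_ord i); have s0 := sin0' i.+1 (ltn_ord i).
  set c := cos (i.+1%:R * h) in c0 *; set s := sin (i.+1%:R * h) in s0 *.
  have -> : sin (i%:R * h) = s * cos h - c * sin h.
    by rewrite /s /c -sinB -[in RHS]natr1 mulrDl mul1r addrK.
  have ch := cos_le1 h; have b1 := ballc1_ge2.
  have : 0 <= sin h by have := sin0' 1%N isT; rewrite mul1r.
  set b := ballc 1 in b1 *; set sh := sin h; set chh := cos h in ch *; move=> sh0.
  have h1 : sh * c <= s - (s * chh - c * sh) by nra.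
  have h2 : 0 <= sh * c by exact: mulr_ge0.
  have h3 : 2 * (sh * c) <= (s - (s * chh - c * sh)) * b by nra.
  have h4 : 2 * c <= c * b by nra.
  have h5 : (2 * (sh * c)) * (2 * c) <= ((s - (s * chh - c * sh)) * b) * (c * b) by apply: ler_pM => //; nra.
  by apply: le_trans h5; rewrite expr2; lra.
rewrite -mulr_sumr (sum_cos2 hM) !(hornerM, hornerD, hornerN, hornerC, hornerX).
have e : M%:R = M.+1%:R * (1 - M.+1%:R^-1) :> R by rewrite mulrBr mulr1 mulfV ?gt_eqF // -natr1 addrK.
have := sin_ge h0; rewrite e => hs.
have m1 : 0 <= 1 - M.+1%:R^-1 :> R by rewrite subr_ge0 invf_le1 // ler1n.
have k0 : 0 <= 2 * M.+1%:R * (1 - M.+1%:R^-1) :> R by rewrite mulr_ge0 // mulr_ge0 // ler0n.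
have := ler_wpM2l k0 hs.
have -> : 2 * M.+1%:R * (1 - M.+1%:R^-1) * (h * (1 - h)) =
    pi * (1 - M.+1%:R^-1) * (1 - pi / 2 * M.+1%:R^-1).
  by rewrite /h; field; rewrite gt_eqF.
move=> /le_trans; apply; rewrite le_eqVlt; apply/orP; left; apply/eqP.
by move: (sin h) (M.+1%:R^-1) => a b; field.
Qed.

(** Tangent inequality at [u = b ^+ 2] for the convex function [u ^ ((j + 2) / 2)]; induction by
    steps of two avoids half-integral powers. *)
Lemma pow_diff_le j (a b : R) : 0 <= a <= b ->
  b ^+ j.+2 - a ^+ j.+2 <= j.+2%:R / 2 * b ^+ j * (b ^+ 2 - a ^+ 2).
Proof.
move=> /andP[a0 ab]; have b0 : 0 <= b by lra.
elim/ltn_ind: j => -[|[|j]] IH.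
- by rewrite expr0 mulr1 mulfV // mul1r.
- rewrite expr1 !exprS !expr0 !mulr1.
  have := mulr_ge0 (sqr_ge0 (b - a)) (addr_ge0 b0 (addr_ge0 a0 a0)); rewrite expr2; lra.
have := IH j (ltnW (ltnSn _)); set B := b ^+ j.+2; set A := a ^+ j.+2 => h.
have -> : b ^+ j.+4 = B * b ^+ 2 by rewrite /B -exprD addn2.
have -> : a ^+ j.+4 = A * a ^+ 2 by rewrite /A -exprD addn2.
have AB : A <= B by rewrite ler_pXn2r.
have eB : B = b ^+ j * b ^+ 2 by rewrite /B -exprD addn2.
have d0 : 0 <= b ^+ 2 - a ^+ 2 by rewrite subr_ge0 ler_pXn2r.
have := ler_wpM2l (sqr_ge0 b) h; have := ler_wpM2r d0 AB.
rewrite -[j.+4%:R]natr1 -[j.+3%:R]natr1; set J := j.+2%:R; set bj := b ^+ j in eB *.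
move: (b ^+ 2) (a ^+ 2) d0 eB => b2 a2 d0 ->; nra.
Qed.

Lemma sum_sqrt_pow_ge j M :
  Num.sqrt M%:R ^+ j.+2 <= j.+2%:R / 2 * \sum_(i < M) Num.sqrt i.+1%:R ^+ j :> R.
Proof.
elim: M => [|M IH]; first by rewrite sqrtr0 expr0n big_ord0 mulr0.
rewrite big_ord_recr /= mulrDr.
have := @pow_diff_le j (Num.sqrt M%:R) (Num.sqrt M.+1%:R).
rewrite sqrtr_ge0 ler_wsqrtr ?ler_nat // => /(_ isT).
have e : M.+1%:R - M%:R = 1 :> R by rewrite -natr1 addrAC subrr add0r.
rewrite !sqr_sqrtr ?ler0n // e mulr1; lra.
Qed.

(** The annuli between [sqrt (i / M)] and [sqrt ((i + 1) / M)] in the plane have equal area; the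
    balls over them give a Riemann sum for [u ^ (j / 2)] on [0, 1], whose integral is
    [2 / (j + 2)]. *)
Lemma ballc_step j : (2 * pi) / j.+2%:R * ballc j <= ballc (2 + j).
Proof.
pose p : {poly R} := ((2 / j.+2%:R)%:P - 'X) * (pi * ballc j)%:P.
have -> : (2 * pi) / j.+2%:R * ballc j = p.[0].
  rewrite !(hornerM, hornerD, hornerN, hornerC, hornerX) subr0.
  have : j.+2%:R != 0 :> R by rewrite pnatr_eq0.
  by move: (j.+2%:R) => J J0; field.
apply: poly_le_invn => M0; rewrite !(hornerM, hornerD, hornerN, hornerC, hornerX).
pose M := M0.+1; rewrite -/M.
have Mp : 0 < M%:R :> R by rewrite ltr0n.
pose a (i : nat) : R := Num.sqrt i%:R.
have aM : a M ^+ 2 = M%:R by rewrite sqr_sqrtr ?ler0n.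
have aMp : 0 < a M by rewrite sqrtr_gt0.
have ai i : a i ^+ 2 = i%:R by rewrite sqr_sqrtr ?ler0n.
have H := @ballc_layers 2 j M (fun i => a i / a M) (fun i => a (M - i.+1)%N / a M).
apply: le_trans (H _ _ _ _) => [|i _|i _|i iM|i iM]; last 4 first.
- by rewrite divr_ge0 ?sqrtr_ge0.
- by rewrite divr_ge0 ?sqrtr_ge0.
- by rewrite ltr_pM2r ?invr_gt0 // ltr_sqrt ?ltr0n // ltr_nat.
- by rewrite !expr_div_n -mulrDl !ai natrB // addrCA subrr addr0 mulfV // gt_eqF.
have -> : \sum_(i < M) (((a i.+1 / a M) ^+ 2 - (a i / a M) ^+ 2) * ballc 2 *
   ((a (M - i.+1)%N / a M) ^+ j * ballc j)) =
   (ballc 2 * ballc j) * ((\sum_(i < M) a i ^+ j) / (M%:R * a M ^+ j)).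
  rewrite [in RHS](reindex_inj rev_ord_inj) /= mulr_suml mulr_sumr; apply: eq_bigr => i _.
  rewrite !expr_div_n -mulrBl !ai -(natr1 i) addrAC subrr add0r mul1r invfM.
  by move: (M%:R^-1) (a M ^+ j)^-1 (a _ ^+ j) => u v w; ring.
(* [sum_sqrt_pow_ge] sums over 1 to M, the layers over 0 to M - 1; this shift costs at most
   [1 / M]. *)
have S : 2 / j.+2%:R - M%:R^-1 <= (\sum_(i < M) a i ^+ j) / (M%:R * a M ^+ j).
  have := sum_sqrt_pow_ge j M.
  have -> : \sum_(i < M) Num.sqrt i.+1%:R ^+ j = \sum_(i < M) a i ^+ j + a M ^+ j - a 0%N ^+ j :> R.
    have := @big_ord_recr R 0 +%R M (fun i => a i ^+ j); rewrite big_ord_recl /= => <-.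
    by rewrite addrAC subrr add0r.
  rewrite -/(a M) => h.
  have q0 : 0 < a M ^+ j by rewrite exprn_gt0.
  have z0 : 0 <= a 0%N ^+ j by rewrite exprn_ge0 // sqrtr_ge0.
  have J0 : 0 < j.+2%:R :> R by rewrite ltr0n.
  have e : a M ^+ j.+2 = M%:R * a M ^+ j by rewrite -aM -exprD.
  rewrite ler_pdivlMr ?mulr_gt0 //; rewrite {}e in h.
  move: (a M ^+ j) (a 0%N ^+ j) (\sum_(i < M) _) (M%:R) (j.+2%:R) Mp q0 z0 J0 h
    => Q z A m J m0 Q0 z0 J0 h.
  have -> : (2 / J - m^-1) * (m * Q) = 2 / J * (m * Q) - Q by field; rewrite !gt_eqF.
  have := ler_wpM2l (ltW (divr_gt0 (ltr0n R 2) J0)) h.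
  have -> : 2 / J * (J / 2 * (A + Q - z)) = A + Q - z by field; rewrite gt_eqF.
  lra.
have p0 : 0 <= pi :> R by exact: pi_ge0.
have b0 := ballc_ge0 j.
set A := \sum_(i < M) _ in S *.
have A0 : 0 <= A / (M%:R * a M ^+ j).
  apply: divr_ge0; last by rewrite mulr_ge0 ?exprn_ge0 ?(ltW aMp) ?ler0n.
  by apply: sumr_ge0 => i _; rewrite exprn_ge0 // sqrtr_ge0.
apply: (@le_trans _ _ ((pi * ballc j) * (A / (M%:R * a M ^+ j)))).
  by rewrite mulrC ler_wpM2l // mulr_ge0.
by rewrite ler_wpM2r // ler_wpM2r // ballc2_ge.
Qed.

Lemma unit_ball_vol_le n : unit_ball_vol R n <= ballc n.
Proof.
elim/ltn_ind: n => -[|[|n]] IH; [exact: ballc0_ge1|exact: ballc1_ge2|].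
apply: le_trans (ballc_step n); rewrite /= ler_wpM2l ?IH //.
by rewrite divr_ge0 ?ler0n // mulr_ge0 // pi_ge0.
Qed.

End BallVolume.


(** * From content to Hausdorff measure *)

Section FiniteCovers.
Variable R : realType.

Lemma unit_ball_vol_gt0 k : 0 < unit_ball_vol R k.
Proof.
elim/ltn_ind: k => -[|[|k]] IH //=.
by rewrite mulr_gt0 ?IH // divr_gt0 ?ltr0n // mulr_gt0 // pi_gt0.
Qed.

Lemma hausdorff_const_gt0 s : 0 < hausdorff_const R s.
Proof. by rewrite divr_gt0 ?unit_ball_vol_gt0 // exprn_gt0. Qed.

(** Finite covers by sets of diameter at most [delta], together with an upper bound of their cost.
    Unions and Lipschitz images are then handled by induction, without infinite sequences. *)
Inductive fcov (n s : nat) (delta : R) : set 'rV[R]_n -> R -> Prop :=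
| fcov_one A d : 0 <= d <= delta -> (forall x y, A x -> A y -> enorm (x - y) <= d) ->
    fcov s delta A (hausdorff_const R s * d ^+ s)
| fcov_U A B a b : fcov s delta A a -> fcov s delta B b -> fcov s delta (A `|` B) (a + b)
| fcov_le A B a b : A `<=` B -> a <= b -> fcov s delta B a -> fcov s delta A b.

Lemma eucl_dist_enorm n (x y : 'rV[R]_n) : eucl_dist x y = enorm (x - y).
Proof.
by rewrite /eucl_dist /enorm /dot; congr Num.sqrt; apply: eq_bigr => i _; rewrite !mxE expr2.
Qed.

Lemma ediam_le n (A : set 'rV[R]_n) (d : R) : 0 <= d ->
  (forall x y, A x -> A y -> enorm (x - y) <= d) -> (ediam A <= d%:E)%E.
Proof.
move=> d0 h; apply: ge_ereal_sup => _ [->|[x [y [Ax [Ay ->]]]]]; rewrite lee_fin //.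
by rewrite eucl_dist_enorm h.
Qed.

Lemma ediam_ge0 n (A : set 'rV[R]_n) : (0 <= ediam A)%E.
Proof. by apply: ereal_sup_ubound; left. Qed.

(** The finite list is continued by empty sets, of diameter 0 by convention. Their cost [0 ^+ s]
    vanishes only for [0 < s]; this is where dimension at least 2 enters. *)
Lemma fcov_content n s (delta : R) (A : set 'rV[R]_n) v : (0 < s)%N -> 0 <= delta ->
  fcov s delta A v -> (hausdorff_content s delta A <= v%:E)%E.
Proof.
move=> s0 delta0 H.
pose z : set 'rV[R]_n * R := (set0, 0).
have [l [h1 h2 h3]] : exists l : seq (set 'rV[R]_n * R),
  [/\ forall i, (i < size l)%N -> 0 <= (nth z l i).2 <= delta /\
       forall x y, (nth z l i).1 x -> (nth z l i).1 y -> enorm (x - y) <= (nth z l i).2,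
      forall x, A x -> exists2 i, (i < size l)%N & (nth z l i).1 x
    & \sum_(p <- l) hausdorff_const R s * p.2 ^+ s <= v].
  elim: H => {A v} [A d hd hA|A B a b _ [l [l1 l2 l3]] _ [k [k1 k2 k3]]|A B a b AB ab _ [l [l1 l2 l3]]].
  - exists [:: (A, d)]; split => [[|i]//|x Ax|]; first by exists 0%N.
    by rewrite big_seq1.
  - exists (l ++ k); split => [i|x [/l2[i il Fx]|/k2[i ik Fx]]|].
    + rewrite size_cat nth_cat; case: (ltnP i (size l)) => il h; first exact: l1.
      by apply: k1; rewrite ltn_subLR.
    + by exists i; rewrite ?size_cat ?nth_cat ?il // ltn_addr.
    + exists (size l + i)%N; first by rewrite size_cat ltn_add2l.
      by rewrite nth_cat ltnNge leq_addr /= addKn.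
    + by rewrite big_cat lerD.
  - exists l; split => // [x /AB|]; first exact: l2.
    exact: le_trans ab.
have good i : 0 <= (nth z l i).2 <= delta /\
    forall x y, (nth z l i).1 x -> (nth z l i).1 y -> enorm (x - y) <= (nth z l i).2.
  have [|il] := ltnP i (size l); first exact: h1.
  by rewrite nth_default //= lexx delta0.
pose E i := (nth z l i).1.
have dE i : (ediam (E i) <= (nth z l i).2%:E)%E.
  by have [/andP[d0 _] hd] := good i; exact: ediam_le.
have fE i : fine (ediam (E i)) ^+ s <= (nth z l i).2 ^+ s.
  have := dE i; have := ediam_ge0 (E i); case: (ediam (E i)) => [r||] //=.
  by rewrite !lee_fin => r0 rd; rewrite ler_pXn2r ?nnegrE //; apply: le_trans rd.
have c0 := ltW (hausdorff_const_gt0 s).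
apply: (@le_trans _ _ (\sum_(0 <= i <oo) (hausdorff_const R s * (fine (ediam (E i))) ^+ s)%:E)%E).
  apply: ereal_inf_lbound; exists E; split; first by move=> x /h2[i _ Ex]; exists i.
  split => // i; apply: (le_trans (dE i)); rewrite lee_fin.
  by have [/andP[]] := good i.
have t0 i : (0 <= (hausdorff_const R s * (fine (ediam (E i))) ^+ s)%:E)%E.
  by rewrite lee_fin mulr_ge0 // exprn_ge0 // fine_ge0 // ediam_ge0.
apply: lime_le; first exact: is_cvg_nneseries.
apply: nearW => N; rewrite sumEFin lee_fin; apply: le_trans h3.
rewrite (big_nth z) big_mkord.
apply: (@le_trans _ _ (\sum_(0 <= i < N) hausdorff_const R s * (nth z l i).2 ^+ s)).
  by apply: ler_sum => i _; rewrite ler_wpM2l.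
have q0 i : 0 <= hausdorff_const R s * (nth z l i).2 ^+ s.
  by rewrite mulr_ge0 // exprn_ge0 //; have [/andP[]] := good i.
have [NM|NM] := leqP N (size l).
  rewrite -(big_mkord xpredT (fun i => hausdorff_const R s * (nth z l i).2 ^+ s)).
  by rewrite [leRHS](big_cat_nat (n := N)) //= lerDl; apply: sumr_ge0.
rewrite [leLHS](big_cat_nat (n := size l)) //=; last exact: ltnW.
rewrite [X in _ + X]big_nat_cond [X in _ + X]big1 ?addr0 ?big_mkord //.
move=> i /andP[/andP[il _] _]; rewrite nth_default //= expr0n.
by case: (s) s0 => // k _; rewrite mulr0.
Qed.

Lemma fcov_lip n m s (delta t : R) (f : 'rV[R]_n -> 'rV[R]_m) A v : 0 <= t ->
  (forall x y, enorm (f x - f y) <= t * enorm (x - y)) ->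
  fcov s delta A v -> fcov s (t * delta) (f @` A) (t ^+ s * v).
Proof.
move=> t0 hf; elim=> {A v} [A d /andP[d0 hd] hA|A B a b _ hA _ hB|A B a b AB ab _ hB].
- rewrite mulrCA -exprMn; apply: fcov_one.
    by rewrite mulr_ge0 //= ler_wpM2l.
  move=> _ _ [x Ax <-] [y Ay <-]; apply: (le_trans (hf x y)).
  by rewrite ler_wpM2l // hA.
- by rewrite image_setU mulrDr; exact: fcov_U.
- apply: fcov_le hB; last by rewrite ler_wpM2l // exprn_ge0.
  exact: image_subset.
Qed.

Lemma fcov_delta n s (d1 d2 : R) (A : set 'rV[R]_n) v : d1 <= d2 -> fcov s d1 A v -> fcov s d2 A v.
Proof.
move=> d12; elim=> {A v} [A d /andP[d0 hd] hA|A B a b _ hA _ hB|A B a b AB ab _ hB].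
- by apply: fcov_one => //; rewrite d0 (le_trans hd).
- exact: fcov_U.
- exact: fcov_le hB.
Qed.

Lemma fcov_bigU n s (delta : R) (I : eqType) (r : seq I) (F : I -> set 'rV[R]_n) A v :
  (0 < s)%N -> 0 <= delta -> (forall i, i \in r -> fcov s delta (F i) (v i)) ->
  (forall x, A x -> exists2 i, i \in r & F i x) -> fcov s delta A (\sum_(i <- r) v i).
Proof.
move=> s0 d0; elim: r A => [|i r IH] A hF hA.
  rewrite big_nil; apply: (@fcov_le _ _ _ _ set0 (hausdorff_const R s * 0 ^+ s)).
  - by move=> x /hA[].
  - by case: (s) s0 => // k _; rewrite expr0n mulr0.
  - by apply: fcov_one; rewrite ?lexx.
rewrite big_cons; apply: (@fcov_le _ _ _ _ (F i `|` (A `\` F i)) _ _ _ (lexx _)).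
  by move=> x Ax; have [|] := pselect (F i x); [left|right].
apply: fcov_U; first by apply: hF; exact: mem_head.
apply: IH => [j jr|x [/hA[j]]]; first by apply: hF; rewrite in_cons jr orbT.
by rewrite in_cons => /orP[/eqP->//|jr Fj _]; exists j.
Qed.

Lemma enorm_scale_sub n (t : R) (b x y : 'rV[R]_n) : 0 <= t ->
  enorm ((t *: x + b) - (t *: y + b)) <= t * enorm (x - y).
Proof. by move=> t0; rewrite opprD addrACA subrr addr0 -scalerBr enormZ ger0_norm. Qed.

Lemma fcov_covered s N l (d0 v : R) (A : set 'rV[R]_s) : (0 < s)%N -> 0 <= d0 ->
  fcov s d0 (@ucube R s) v -> covered N l A ->
  fcov s ((2 ^+ N)^-1 * d0) A ((size l)%:R / 2 ^+ (N * s) * v).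
Proof.
move=> s0 dp hv hl; have q0 : 0 < (2 ^+ N)^-1 :> R by rewrite invr_gt0 exprn_gt0.
have -> : (size l)%:R / 2 ^+ (N * s) * v = \sum_(k <- l) (2 ^+ N)^-1 ^+ s * v.
  by rewrite big_const_seq count_predT iter_addr_0 -[RHS]mulr_natl exprVn -exprM mulrA.
apply: (@fcov_bigU _ _ _ _ _ (fun k => cbox N k)) => //.
- by rewrite mulr_ge0 // ltW.
- move=> k _; rewrite /cbox cbox_ucube //; apply: fcov_lip hv; first exact: ltW.
  by move=> x y; apply: enorm_scale_sub; exact: ltW.
- by move=> x Ax; exists (cell N x); [exact: hl|exact: cell_cbox].
Qed.

(** Self-similarity: copying a cover of the unit cube into every cell of a fine grid costs [v] per
    unit of content and makes the diameters arbitrarily small. *)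
Lemma fcov_cont s (d0 v e delta : R) (A : set 'rV[R]_s) : (0 < s)%N -> 0 <= d0 ->
  fcov s d0 (@ucube R s) v -> 0 <= v -> bdd A -> 0 < e -> 0 < delta ->
  fcov s delta A ((cont A + e) * v).
Proof.
move=> s0 dp hv v0 bA e0 delta0.
have d1 : 0 < d0 + 1 by lra.
have [N0 hN0] := dyadic_small (divr_gt0 delta0 d1).
have [N [l [NN hl hs]]] := cont_approx N0 bA e0.
apply: (fcov_delta (d1 := (2 ^+ N)^-1 * d0)).
  have h : (2 ^+ N)^-1 <= delta / (d0 + 1).
    apply: le_trans (ltW hN0); rewrite lef_pV2 ?posrE ?exprn_gt0 //.
    by rewrite ler_eXn2l // ltr1n.
  apply: (le_trans (ler_wpM2r dp h)); rewrite mulrAC ler_pdivrMr // ler_wpM2l ?(ltW delta0) //; lra.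
apply: fcov_le (fcov_covered s0 dp hv hl) => //.
by rewrite ler_wpM2r // ltW.
Qed.

Lemma fcov_ge0 n s (delta : R) (A : set 'rV[R]_n) v : fcov s delta A v -> 0 <= v.
Proof.
elim=> {A v} [A d /andP[d0 hd] hA|A B a b _ hA _ hB|A B a b AB ab _ hB].
- by rewrite mulr_ge0 ?exprn_ge0 // ltW // hausdorff_const_gt0.
- exact: addr_ge0.
- exact: le_trans ab.
Qed.

(* Cover the inscribed ball by itself and the rest of the cube by tiny cubes, each
   covered in the same way: the infimal cost C satisfies C <= b + (1 - b) C, where b is
   the volume of the inscribed ball. *)
Lemma fcov_ucube s (e : R) : (0 < s)%N -> 0 < e ->
  exists2 d, 0 <= d & fcov s d (@ucube R s) (1 + e).
Proof.
move=> s0 e0.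
(* Every mesh [d] is allowed here, since [fcov_cont] later brings a cover down to any prescribed
   mesh. *)
pose S := [set v | exists2 d, 0 <= d & fcov s d (@ucube R s) v].
have S0 v : S v -> 0 <= v by move=> [d _ /fcov_ge0].
have Sne : S !=set0.
  exists (hausdorff_const R s * s%:R ^+ s); exists s%:R => //.
  apply: fcov_one; first by rewrite ler0n lexx.
  move=> x y hx hy; rewrite -[leRHS]mulr1; apply: enorm_le_sup => // i.
  have := hx i; have := hy i; rewrite !mxE !add0r ler_norml => /andP[? ?] /andP[? ?].
  by apply/andP; split; lra.
have hS : has_inf S by split => //; exists 0 => v; exact: S0.
pose C := inf S.
have CS v : S v -> C <= v by move=> Sv; apply: ge_inf => //; case: hS.
have C0 : 0 <= C by apply: lb_le_inf.
suff C1 : C <= 1.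
  have [v [d dp hv] vC] := inf_adherent e0 hS; exists d => //.
  by apply: fcov_le hv => //; apply: ltW; apply: (lt_le_trans vC); rewrite lerD2r.
(* A ball of diameter 1 costs exactly [b], and its content is at least [b]. *)
pose b := hausdorff_const R s.
have b0 : 0 < b by exact: hausdorff_const_gt0.
have bE : b = 2^-1 ^+ s * unit_ball_vol R s by rewrite exprVn mulrC.
suff : C <= b + (1 - b) * C by move=> h; nra.
pose p : {poly R} := b%:P + (1 - (1 - 'X) ^+ s * b%:P + 'X) * (C%:P + 'X).
have -> : b + (1 - b) * C = p.[0].
  by rewrite /p !(hornerM, hornerD, hornerN, hornerC, horner_exp, hornerX) subr0 expr1n mul1r !addr0.
apply: poly_ge_at0 => t t0 t1.
rewrite /p !(hornerM, hornerD, hornerN, hornerC, horner_exp, hornerX).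
pose c : 'rV[R]_s := const_mx 2^-1.
pose B (r : R) := [set x : 'rV[R]_s | enorm (x - c) <= r].
have Bimg r : 0 <= r -> B r = (fun x => 1 *: x + c) @` @eball R s r.
  move=> r0; apply/seteqP; split => [x hx|_ [x hx <-]].
    exists (x - c); last by rewrite scale1r subrK.
    by rewrite /eball /= -sqr_enorm ler_pXn2r ?nnegrE ?enorm_ge0.
  rewrite /B /= scale1r addrK -(ler_pXn2r (n := 2)) ?nnegrE ?enorm_ge0 //.
  by rewrite sqr_enorm.
have BQ : B (2^-1) `<=` @ucube R s.
  move=> x hx i; have := le_trans (coord_le_enorm _ _) hx => /(_ i).
  by rewrite !mxE ler_norml => /andP[? ?]; apply/andP; split; lra.
(* The slightly smaller ball is at positive distance from the rest of the cube, so their contents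
   add up to at most 1. *)
pose r := (1 - t) * 2^-1.
have r0 : 0 <= r by rewrite /r; lra.
pose Rst := @ucube R s `\` B 2^-1.
have bR : bdd Rst by apply: bdd_sub (@bdd_ucube R s) => x [].
have bB : bdd (B r) by rewrite Bimg //; apply: bdd_scale; exact: bdd_eball.
have cR : cont Rst <= 1 - (1 - t) ^+ s * b.
  have sp : sep (B r) Rst.
    pose g := t / 2 / s.+1%:R; have g0 : 0 < g by rewrite !divr_gt0 ?ltr0n.
    exists g => // x y hx [_ hy]; apply: contrapT => hn; apply: hy.
    have hc (k : 'I_s) : `|(y - x) ord0 k| <= g.
      rewrite leNgt; apply/negP => lt; apply: hn; exists k; move: lt.
      by rewrite !mxE distrC => /ltW.
    have := enorm_le_sup (ltW g0) hc; have := enormD (x - c) (y - x).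
    rewrite addrC addrA subrK /B /=; move: hx; rewrite /B /=.
    have : s%:R * g <= t / 2.
      rewrite mulrCA -[leRHS]mulr1 ler_wpM2l //; first by lra.
      by rewrite ler_pdivrMr ?ltr0n // mul1r ler_nat.
    rewrite /r; move: (_ * g) (enorm (x - c)) (enorm (y - x)) (enorm (y - c)) => *; lra.
  have := cont_sep bB bR sp.
  have : cont (B r `|` Rst) <= 1.
    apply: le_trans (@cont_ucube_le R s); apply: cont_mono; first exact: bdd_ucube.
    move=> x [hx|[]//]; apply: BQ; apply: le_trans hx _; rewrite /r; lra.
  have : (1 - t) ^+ s * b <= cont (B r).
    rewrite Bimg // cont_scale //; last exact: bdd_eball.
    rewrite expr1n mul1r; apply: le_trans (cont_eball_ge s r0).
    by rewrite /r exprMn -mulrA ler_wpM2l ?exprn_ge0 ?subr_ge0 ?(ltW t1) // bE ler_wpM2l ?exprn_ge0 // unit_ball_vol_le.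
  lra.
have [v [d dp hv] vC] := inf_adherent t0 hS.
have v0 := fcov_ge0 hv.
have k := fcov_cont s0 dp hv v0 bR t0 ltr01.
have kB : fcov s 1 (B 2^-1) b.
  rewrite -[b]mulr1 -[X in b * X](expr1n _ s); apply: fcov_one; first by rewrite ler01 lexx.
  move=> x y hx hy; have -> : x - y = (x - c) + - (1 *: (y - c)) by rewrite scale1r opprB addrA subrK.
  apply: (le_trans (enormD _ _)); rewrite -scaleN1r scale1r enormZ normrN1 mul1r.
  by move: hx hy; rewrite /B /=; lra.
have : S (b + (cont Rst + t) * v).
  exists 1 => //; apply: fcov_le (fcov_U kB k) => // x Qx.
  by have [|] := pselect (B 2^-1 x); [left|right].
move=> /CS /le_trans; apply; rewrite lerD2l.
have cR0 := cont_ge0 Rst.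
apply: (@le_trans _ _ ((1 - (1 - t) ^+ s * b + t) * v)); first by rewrite ler_wpM2r // lerD2r.
by rewrite ler_wpM2l ?(ltW vC) //; lra.
Qed.

Lemma fcov_isometry n s (f : 'rV[R]_s -> 'rV[R]_n) (A : set 'rV[R]_s) (e delta : R) :
  (0 < s)%N -> (forall x y, enorm (f x - f y) = enorm (x - y)) -> bdd A ->
  0 < e -> 0 < delta -> fcov s delta (f @` A) (cont A + e).
Proof.
move=> s0 hf bA e0 d0.
have cA := cont_ge0 A.
pose t := e / (cont A + e + 1) / 2; have t0 : 0 < t by rewrite !divr_gt0 //; lra.
have [d dp hd] := fcov_ucube s0 t0.
have e2 : 0 < e / 2 by lra.
have t2 : 0 <= 1 + t by lra.
have := fcov_cont s0 dp hd t2 bA e2 d0.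
have hf' x y : enorm (f x - f y) <= 1 * enorm (x - y) by rewrite mul1r hf.
move=> /(fcov_lip ler01 hf'); rewrite mul1r expr1n mul1r; apply: fcov_le => //.
have -> : (cont A + e / 2) * (1 + t) = cont A + e / 2 + (cont A + e / 2) * t by ring.
suff : (cont A + e / 2) * t <= e / 2 by lra.
have K0 : 0 < cont A + e + 1 by lra.
rewrite /t mulrA ler_pdivrMr // mulrA ler_pdivrMr //; nra.
Qed.

Lemma hausdorff_le n s (A : set 'rV[R]_n) (v : R) : (0 < s)%N ->
  (forall e delta, 0 < e -> 0 < delta -> fcov s delta A (v + e)) ->
  (hausdorff_measure s A <= v%:E)%E.
Proof.
move=> s0 h; apply: ge_ereal_sup => _ [delta /= d0 <-].
apply/lee_addgt0Pr => e e0; rewrite -EFinD.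
by apply: fcov_content; [exact: s0|exact: ltW|exact: h].
Qed.

End FiniteCovers.


(** * Projections, reflections, cells modulo the lattice, finiteness *)

Section Preliminaries.
Variable R : realType.

(** The rows of [B] are a basis of the image of [P] followed by vectors of its kernel, namely the
    remaining rows of [L] corrected by [1 - P]. *)
Lemma idem_conj n (P : 'M[R]_n) : P *m P = P ->
  exists2 B, B \in unitmx & P = invmx B *m pid_mx (\rank P) *m B.
Proof.
move=> hP; pose d := \rank P; pose L := row_ebase P.
have uL : L \in unitmx by exact: row_ebase_unit.
have eP : col_ebase P *m pid_mx d *m L = P by exact: mulmx_ebase.
have LP : (pid_mx d : 'M[R]_n) *m L *m P = pid_mx d *m L.
  have uC := col_ebase_unit P.
  by apply: (can_inj (mulKmx uC)); rewrite !mulmxA eP.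
pose B : 'M[R]_n := pid_mx d *m L + copid_mx d *m L *m (1%:M - P).
have dn : (d <= n)%N by exact: rank_leq_row.
have BP : B *m P = pid_mx d *m B.
  have hQ : (1%:M - P) *m P = 0 by rewrite mulmxBl mul1mx hP subrr.
  rewrite /B mulmxDl LP -[X in _ + X]mulmxA hQ mulmx0 addr0.
  rewrite mulmxDr !mulmxA pid_mx_id // mul_pid_mx_copid // !mul0mx addr0 //.
have uB : B \in unitmx.
  rewrite -row_free_unit -kermx_eq0; apply/eqP/row_matrixP => i.
  rewrite row0; set v := row i _.
  have vB : v *m B = 0 by rewrite -row_mul mulmx_ker row0.
  have v1 : v *m (pid_mx d : 'M[R]_n) = 0.
    have : v *m B *m P = 0 by rewrite vB mul0mx.
    rewrite -mulmxA BP mulmxA /B mulmxDr !mulmxA.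
    rewrite -(mulmxA v) pid_mx_id // -(mulmxA v (pid_mx d) (copid_mx d)) mul_pid_mx_copid //.
    rewrite mulmx0 !mul0mx addr0 => h.
    by apply: (can_inj (mulmxK uL)); rewrite h mul0mx.
  have v2 : v *m (copid_mx d : 'M[R]_n) = 0.
    have vc : v *m (copid_mx d : 'M[R]_n) = v by rewrite mulmxBr mulmx1 v1 subr0.
    move: vB; rewrite /B mulmxDr !mulmxA v1 mul0mx add0r vc mulmxBr mulmx1 => /eqP.
    rewrite subr_eq0 => /eqP h.
    have h2 : v *m L = v *m L *m col_ebase P *m (pid_mx d : 'M[R]_n) *m L.
      by rewrite -[RHS]mulmxA -[RHS]mulmxA (mulmxA (col_ebase P)) eP.
    have : v = v *m L *m col_ebase P *m (pid_mx d : 'M[R]_n).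
      by apply: (can_inj (mulmxK uL)).
    by move=> e; rewrite -vc {1}e -[LHS]mulmxA mul_pid_mx_copid // mulmx0.
  have -> : v = v *m (pid_mx d : 'M[R]_n) + v *m copid_mx d.
    by rewrite -mulmxDr addrC subrK mulmx1.
  by rewrite v1 v2 addr0.
by exists B => //; rewrite -mulmxA -BP mulmxA mulVmx // mul1mx.
Qed.

(** In a basis adapted to [P] the map is diagonal, with [\rank P] entries [1 + a] and ones
    elsewhere. *)
Lemma kap_proj_le n (P : 'M[R]_n) (a : R) : P *m P = P -> 0 <= a ->
  kap (1%:M + a *: P) <= (1 + a) ^+ \rank P.
Proof.
move=> hP a0; have [B uB eP] := idem_conj hP.
set d := \rank P in eP *; have dn : (d <= n)%N by exact: rank_leq_row.
pose D : 'M[R]_n := diag_mx (\row_i (if (i < d)%N then 1 + a else 1)).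
have eD : D = 1%:M + a *: pid_mx d.
  apply/matrixP => i j; rewrite !mxE; case: (eqVneq i j) => [->|ij].
    by rewrite eqxx /=; case: (j < d)%N; rewrite ?mulr1n ?mulr1 ?mulr0 ?addr0.
  by rewrite (_ : (_ == _ :> nat) = false) ?mulr0n ?mulr0 ?addr0 //; apply/negbTE.
have a1 : 0 < 1 + a by lra.
have uD : D \in unitmx.
  rewrite unitmxE det_diag unitfE; apply/prodf_neq0 => i _; rewrite mxE.
  by case: ifP; rewrite ?oner_eq0 // gt_eqF.
have -> : 1%:M + a *: P = invmx B *m D *m B.
  by rewrite eD mulmxDr mulmxDl mulmx1 mulVmx // -scalemxAr -scalemxAl -eP.
apply: (le_trans (kap_conj_le uB uD)); apply: (le_trans (kap_diag_le _)) => [i|].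
  by rewrite mxE; case: ifP => _ //; exact: ltW.
rewrite (eq_bigr (fun i : 'I_n => if (i < d)%N then 1 + a else 1)) => [|i _]; last by rewrite mxE.
by rewrite -big_mkcond /= (big_ord_narrow dn) prodr_const card_ord.
Qed.

(** Reflection in the hyperplane orthogonal to [v - u]. *)
Lemma householder n (u v : 'rV[R]_n) : dot u u = 1 -> dot v v = 1 ->
  exists2 O : 'M[R]_n, O *m O^T = 1%:M & v *m O = u.
Proof.
move=> u1 v1; have [->|uv] := eqVneq v u.
  by exists 1%:M; rewrite ?trmx1 ?mulmx1.
have [w wE] : {w | w = v - u} by exists (v - u).
have w0 : w != 0 by rewrite wE subr_eq0.
pose q := dot w w; have q0 : q != 0 by rewrite gt_eqF // dot_gt0.
have wq : w *m w^T = q%:M by apply/matrixP => i j; rewrite !ord1 -dotE !mxE mulr1n.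
have [S SE] : {S | S = w^T *m w} by exists (w^T *m w).
have SS : S *m S = q *: S.
  by rewrite SE mulmxA -(mulmxA w^T) wq mul_mx_scalar -scalemxAl.
exists (1%:M - (2 / q) *: S).
  have -> : (1%:M - (2 / q) *: S)^T = 1%:M - (2 / q) *: S.
    by rewrite SE linearB linearZ /= trmx1 trmx_mul trmxK.
  rewrite mulmxBl mul1mx mulmxBr mulmx1 -scalemxAl -scalemxAr SS !scalerA.
  have -> : 2 / q * (2 / q) * q = 2 / q + 2 / q by field.
  rewrite scalerDl; move: ((2 / q) *: S) => T.
  by rewrite opprB addrK subrK.
rewrite mulmxBr mulmx1 -scalemxAr SE mulmxA.
have -> : v *m w^T = (q / 2)%:M.
  apply/matrixP => i j; rewrite !ord1 -dotE !mxE mulr1n /q wE.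
  by rewrite !dotBr !dotBl u1 v1 (dotC v u); lra.
rewrite mul_scalar_mx scalerA (_ : 2 / q * (q / 2) = 1); last by field.
by rewrite scale1r wE subKr.
Qed.

(** The class of a cell modulo the integer lattice, as integer translations change the index by
    multiples of [2 ^ N]. There are as many classes as cells in a unit cube; the form [.-1.+1]
    serves [inord]. *)
Definition res n N (k : 'rV[int]_n) : {ffun 'I_n -> 'I_((2 ^ N).-1.+1)} :=
  [ffun i => inord `|(k ord0 i %% (2 ^ N)%:Z)%Z|].

Lemma res_eq n N (k l : 'rV[int]_n) : res N k = res N l ->
  exists z : 'rV[int]_n, forall i, k ord0 i = l ord0 i + z ord0 i * (2 ^ N)%:Z.
Proof.
move=> /ffunP h.
have p0 : (2 ^ N)%:Z != 0 :> int by rewrite eqz_nat -lt0n expn_gt0.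
have e i : (k ord0 i = l ord0 i %[mod (2 ^ N)%:Z])%Z.
  have := h i; rewrite !ffunE => /(congr1 val) /=.
  have b (a : int) : (`|(a %% (2 ^ N)%:Z)%Z| < (2 ^ N).-1.+1)%N.
    rewrite prednK ?expn_gt0 // -ltz_nat gez0_abs ?modz_ge0 // ltz_pmod //.
    by rewrite ltz_nat expn_gt0.
  rewrite !inordK // => /(congr1 Posz); rewrite !gez0_abs ?modz_ge0 //.
exists (\row_i ((k ord0 i %/ (2 ^ N)%:Z)%Z - (l ord0 i %/ (2 ^ N)%:Z)%Z)) => i.
rewrite mxE; have := divz_eq (k ord0 i) (2 ^ N)%:Z; have := divz_eq (l ord0 i) (2 ^ N)%:Z.
rewrite (e i) mulrBl; move: (_ %% _)%Z ((k ord0 i %/ _)%Z * _) ((l ord0 i %/ _)%Z * _).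
by move=> m a b -> ->; rewrite addrAC addrCA subrr addr0.
Qed.

Lemma card_res n N : #|{: {ffun 'I_n -> 'I_((2 ^ N).-1.+1)}}| = (2 ^ (N * n))%N.
Proof. by rewrite card_ffun !card_ord prednK ?expn_gt0 // expnM. Qed.

(** A sufficiently small cell contains at most one point of [A], so one chosen point per cell lists
    the whole set. *)
Lemma separated_listable n (A : set 'rV[R]_n) (lam : R) : 0 < lam -> bdd A ->
  (forall x y, A x -> A y -> x != y -> lam <= enorm (x - y)) ->
  exists r : seq 'rV[R]_n, [/\ uniq r, forall x, A x -> x \in r & forall x, x \in r -> A x].
Proof.
move=> l0 bA hA; have q0 : 0 < lam / n.+1%:R by rewrite divr_gt0 ?ltr0n.
have [N hN] := dyadic_small q0; have [s hs] := bdd_covered N bA.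
pose f k := xget (0 : 'rV[R]_n) [set x | A x /\ cell N x = k].
have main x : A x -> x = f (cell N x).
  move=> Ax; rewrite /f; case: xgetP => [y _ [Ay ey]|/(_ x)]; last by case.
  apply/eqP; apply: contraT => xy; have := hA _ _ Ax Ay xy.
  have hc i : `|(x - y) ord0 i| <= lam / n.+1%:R.
    by have := cell_near (esym ey) i; rewrite !mxE => h; apply: ltW; apply: lt_trans h hN.
  have := enorm_le_sup (ltW q0) hc; rewrite mulrCA => h1 h2.
  have := le_trans h2 h1; rewrite -[leLHS]mulr1 ler_pM2l // ler_pdivlMr ?ltr0n // mul1r.
  by rewrite ler_nat ltnn.
pose m x := `[< A x >].
exists (undup (seq.filter m (map f s))); split; first exact: undup_uniq.
  move=> x Ax; rewrite mem_undup mem_filter; apply/andP; split; first exact/asboolP.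
  by apply/mapP; exists (cell N x); [exact: hs|exact: main].
by move=> x; rewrite mem_undup mem_filter => /andP[/asboolP].
Qed.

Lemma seq_argmin (T : eqType) (r : seq T) (f : T -> R) : r != [::] ->
  exists2 x, x \in r & forall y, y \in r -> f x <= f y.
Proof.
elim: r => // a r IH _; have [->|r0] := eqVneq r [::].
  by exists a; rewrite ?mem_head // => y; rewrite inE => /eqP->.
have [x xr hx] := IH r0; have [h|h] := leP (f a) (f x).
  exists a; first exact: mem_head.
  by move=> y; rewrite in_cons => /orP[/eqP->//|/hx]; exact: le_trans.
exists x; first by rewrite in_cons xr orbT.
by move=> y; rewrite in_cons => /orP[/eqP->|/hx//]; exact: ltW.
Qed.

Lemma sep_enorm n (A B : set 'rV[R]_n) (c : R) : 0 < c ->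
  (forall x y, A x -> B y -> c <= enorm (x - y)) -> sep A B.
Proof.
move=> c0 h; have q0 : 0 < c / n.+1%:R by rewrite divr_gt0 ?ltr0n.
exists (c / n.+1%:R) => // x y Ax By; apply: contrapT => hn.
have hc (k : 'I_n) : `|(x - y) ord0 k| <= c / n.+1%:R.
  by rewrite leNgt; apply/negP => lt; apply: hn; exists k; move: lt; rewrite !mxE => /ltW.
have := le_trans (h _ _ Ax By) (enorm_le_sup (ltW q0) hc).
rewrite mulrCA -[leLHS]mulr1 ler_pM2l // ler_pdivlMr ?ltr0n // mul1r.
by rewrite ler_nat ltnn.
Qed.

End Preliminaries.


(** * Flags of projections and their Voronoi products *)

Section Flags.
Variable R : realType.

Definition below n t (P : nat -> 'M[R]_n) j (z : 'rV[R]_n) :=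
  forall i, (j < i < t)%N -> z *m P i = 0.

Record flag n t (P : nat -> 'M[R]_n) (lam : nat -> R) : Prop := Flag {
  flag_sym : forall j, (j < t)%N -> (P j)^T = P j;
  flag_idem : forall j, (j < t)%N -> P j *m P j = P j;
  flag_orth : forall i j, (i < t)%N -> (j < t)%N -> i != j -> P i *m P j = 0;
  flag_sum : \sum_(j < t) P j = 1%:M;
  flag_lam : forall j, (j < t)%N -> 0 < lam j;
  flag_sep : forall j z, (j < t)%N -> int_lattice z -> below t P j z ->
    z *m P j != 0 -> lam j <= enorm (z *m P j) }.

Definition good n (S : R) := exists t P lam,
  @flag n t P lam /\ \sum_(j < t) 2 * (\rank (P j))%:R / lam j <= S.

Lemma int_lattice0 n : @int_lattice R n 0.
Proof. by move=> i; rewrite mxE rpred0. Qed.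

Lemma int_latticeD n (x y : 'rV[R]_n) : int_lattice x -> int_lattice y -> int_lattice (x + y).
Proof. by move=> hx hy i; rewrite mxE rpredD. Qed.

Lemma int_latticeN n (x : 'rV[R]_n) : int_lattice x -> int_lattice (- x).
Proof. by move=> hx i; rewrite mxE rpredN. Qed.

Lemma int_latticeB n (x y : 'rV[R]_n) : int_lattice x -> int_lattice y -> int_lattice (x - y).
Proof. by move=> hx hy; apply: int_latticeD => //; exact: int_latticeN. Qed.

Definition intrv n (z : 'rV[int]_n) : 'rV[R]_n := map_mx intr z.

Lemma int_lattice_intrv n (z : 'rV[int]_n) : int_lattice (intrv z).
Proof. by move=> i; rewrite mxE intr_int. Qed.

Lemma cell_shift n N (x y : 'rV[R]_n) (z : 'rV[int]_n) :
  (forall i, cell N x ord0 i = cell N y ord0 i + z ord0 i * (2 ^ N)%:Z) ->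
  forall i, `|(x - y - intrv z) ord0 i| < (2 ^+ N)^-1.
Proof.
move=> h i; have e : cell N x = cell N (y + intrv z).
  apply/rowP => k; rewrite h !mxE mulrDr.
  have -> : 2 ^+ N * (z ord0 k)%:~R = (z ord0 k * (2 ^ N)%:Z)%:~R :> R.
    by rewrite intrM mulrC -natrX.
  by rewrite floorDrz ?intr_int // intrKfloor.
by have := cell_near e i; rewrite !mxE opprD addrA.
Qed.

Section VoronoiProduct.
Variables (n t : nat) (P : nat -> 'M[R]_n) (lam : nat -> R).
Hypothesis fP : flag t P lam.

(* The nonzero vectors of the lattice in the image of P_j; vor is the product of the Voronoi
   cells of these lattices. *)
Definition wall j : set 'rV[R]_n := [set p | p != 0 /\
  exists z, [/\ int_lattice z, below t P j z & p = z *m P j]].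

Definition vor : set 'rV[R]_n :=
  [set x | forall j p, (j < t)%N -> wall j p -> dot x p <= dot p p / 2].

Lemma flag_bound : exists2 l, 0 < l & forall j, (j < t)%N -> l <= lam j.
Proof.
have : forall m, (m <= t)%N -> exists2 l, 0 < l & forall j, (j < m)%N -> l <= lam j.
  elim=> [|m IH] mt; first by exists 1.
  have [l l0 hl] := IH (ltnW mt).
  exists (Num.min l (lam m)); first by rewrite lt_min l0 (flag_lam fP).
  move=> j; rewrite ltnS leq_eqVlt => /orP[/eqP->|jm]; first by rewrite ge_min lexx orbT.
  by rewrite ge_min hl.
exact.
Qed.

Lemma wall_enorm j p : (j < t)%N -> wall j p -> lam j <= enorm p.
Proof. by move=> jt [p0 [z [iz bz e]]]; rewrite e; apply: (flag_sep fP) => //; rewrite -e. Qed.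

Lemma wall_proj j p : (j < t)%N -> wall j p -> p *m P j = p.
Proof. by move=> jt [p0 [z [iz bz ->]]]; rewrite -mulmxA (flag_idem fP). Qed.

Lemma wall_proj0 i j p : (i < t)%N -> (j < t)%N -> i != j -> wall j p -> p *m P i = 0.
Proof.
move=> it jt ij [p0 [z [iz bz ->]]]; rewrite -mulmxA (flag_orth fP) ?mulmx0 //.
by rewrite eq_sym.
Qed.

Lemma dot_wall j p x : (j < t)%N -> wall j p -> dot x p = dot (x *m P j) p.
Proof. by move=> jt wp; rewrite dot_mxr (flag_sym fP) // (wall_proj jt wp). Qed.

Lemma wallB j z w : int_lattice z -> int_lattice w -> below t P j z -> below t P j w ->
  z *m P j != w *m P j -> wall j (z *m P j - w *m P j).
Proof.
move=> iz iw bz bw zw; split; first by rewrite subr_eq0.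
exists (z - w); split; first exact: int_latticeB.
  by move=> i ij; rewrite mulmxBl bz // bw // subr0.
by rewrite mulmxBl.
Qed.

Lemma wall_sep j p q : (j < t)%N -> wall j p -> wall j q -> p != q -> lam j <= enorm (p - q).
Proof.
move=> jt [_ [z [iz bz ->]]] [_ [w [iw bw ->]]] pq.
by apply: wall_enorm => //; exact: wallB.
Qed.

Lemma wallN j p : wall j p -> wall j (- p).
Proof.
move=> [p0 [z [iz bz e]]]; split; first by rewrite oppr_eq0.
exists (- z); split; first exact: int_latticeN.
  by move=> i ij; rewrite mulNmx bz // oppr0.
by rewrite mulNmx e.
Qed.

Lemma dot_add_small l a b x w j p : 0 <= b -> (forall j, (j < t)%N -> l <= lam j) ->
  (j < t)%N -> wall j p -> dot x p <= a * dot p p -> enorm w <= b * l ->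
  dot (x + w) p <= (a + b) * dot p p.
Proof.
move=> b0 hl jt wp hx hw; rewrite dotDl mulrDl; apply: lerD => //.
apply: (le_trans (dot_le_enorm _ _)).
have h : l <= enorm p by apply: le_trans (hl j jt) _; exact: wall_enorm.
rewrite -sqr_enorm expr2 mulrA; apply: ler_wpM2r; first exact: enorm_ge0.
by apply: (le_trans hw); rewrite ler_wpM2l.
Qed.

(** Take [p = z P_j] for the last [j] where it is nonzero. The inequality of [u] for [p] and that of
    [u - z] for [- p] squeeze [dot u p], so the cell and its translate by [z] meet only in a
    hyperplane. *)
Lemma vor_packing z : int_lattice z -> z != 0 -> exists j p,
  [/\ (j < t)%N, wall j p & forall u, vor u -> vor (u - z) -> dot u p = dot p p / 2].
Proof.
move=> iz z0.
have [j jt /andP[zj hj]] : exists2 j, (j < t)%N & (z *m P j != 0) &&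
    [forall i : 'I_t, (j < i)%N ==> (z *m P i == 0)].
  have [i0 hi0] : exists i : 'I_t, z *m P i != 0.
    apply: contrapT => h; case/negP: z0; rewrite -(mulmx1 z) -(flag_sum fP) mulmx_sumr.
    rewrite big1 // => i _; apply/eqP; apply: contrapT => /negP hi; apply: h; by exists i.
  have [j hj mj] := @arg_maxnP _ i0 (fun i => z *m P i != 0) (fun i : 'I_t => i : nat) hi0.
  exists j => //; rewrite hj; apply/forallP => i; apply/implyP => ji.
  by apply: contraTT ji => hi; rewrite -leqNgt; exact: mj.
have bz : below t P j z.
  move=> i /andP[ji it]; have /forallP/(_ (Ordinal it))/implyP/(_ ji)/eqP := hj; exact.
pose p := z *m P j.
have wp : wall j p by split => //; exists z.
exists j, p; split => // u hu huz.
have h1 := hu j p jt wp; have := huz j (- p) jt (wallN wp).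
rewrite !dotNr dotNl opprK dotBl (dot_wall z jt wp) -/p; lra.
Qed.

Lemma nearest_wall j y : (j < t)%N -> exists z, [/\ int_lattice z, below t P j z &
  forall w, int_lattice w -> below t P j w -> enorm (y *m P j - z *m P j) <= enorm (y *m P j - w *m P j)].
Proof.
move=> jt; pose c := enorm (y *m P j).
(* The lattice point 0 has distance [c], so the search is confined to a bounded and separated, hence
   finite, set. *)
pose A := [set q | exists z, [/\ int_lattice z, below t P j z, q = z *m P j & enorm (y *m P j - q) <= c]].
have bA : bdd A.
  exists (c + c) => q [z [_ _ _ hq]] i; apply: (le_trans (coord_le_enorm _ _)).
  have -> : q = y *m P j + - (1 *: (y *m P j - q)) by rewrite scale1r opprB addrC subrK.
  by apply: (le_trans (enormD _ _)); rewrite lerD2l -scaleN1r scale1r enormZ normrN1 mul1r.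
have sA p q : A p -> A q -> p != q -> lam j <= enorm (p - q).
  move=> [z [iz bz -> _]] [w [iw bw -> _]] zw.
  by apply: wall_enorm => //; exact: wallB.
have [r [_ Ar rA]] := separated_listable (flag_lam fP jt) bA sA.
have b0 : below t P j 0 by move=> i _; rewrite mul0mx.
have A0 : A 0.
  by exists 0; split; rewrite ?mul0mx ?subr0 //; exact: int_lattice0.
have r0 : r != [::] by apply: contraTneq (Ar _ A0) => ->.
have [q qr hq] := seq_argmin (fun q => enorm (y *m P j - q)) r0.
have [z [iz bz eq _]] := rA _ qr; exists z; split => // w iw bw.
have [hw|hw] := leP (enorm (y *m P j - w *m P j)) c.
  by rewrite -eq; apply: hq; apply: Ar; exists w.
by rewrite -eq; apply: le_trans (hq _ (Ar _ A0)) _; rewrite subr0; exact: ltW.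
Qed.

(** The factors are settled from the last to the first: the correction [w] for factor [k] is killed
    by all later projections and leaves their inequalities intact. *)
Lemma vor_covering x : exists2 z, int_lattice z & vor (x - z).
Proof.
suff : forall m, (m <= t)%N -> exists2 z, int_lattice z & forall j p, (t - m <= j < t)%N ->
    wall j p -> dot (x - z) p <= dot p p / 2.
  move=> /(_ t (leqnn t)) [z iz hz]; exists z => // j p jt wp.
  by apply: hz wp; rewrite subnn.
elim=> [|m IH] mt.
  exists 0; first exact: int_lattice0.
  by move=> j p; rewrite subn0 ltnNge andbN.
have [z iz hz] := IH (ltnW mt).
pose k := (t - m.+1)%N; have kt : (k < t)%N by rewrite /k; lia.
have [w [iw bw hw]] := nearest_wall (x - z) kt.
exists (z + w); first exact: int_latticeD.
move=> j p /andP[kj jt] wp; rewrite opprD addrA dotBl (dot_wall w jt wp).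
move: kj; rewrite -/k leq_eqVlt => /orP[/eqP kj|kj]; last first.
  rewrite bw ?kj // dot0l subr0; apply: (hz j p _ wp); rewrite jt andbT; move: kj; rewrite /k; lia.
rewrite -{j}kj in jt wp *.
have [_ [v [iv bv ep]]] := wp.
have bwv : below t P k (w + v) by move=> i hi; rewrite mulmxDl bw // bv // addr0.
have := hw (w + v) (int_latticeD iw iv) bwv; rewrite (mulmxDl w v) -ep.
rewrite -(ler_pXn2r (n := 2)) ?nnegrE ?enorm_ge0 // !sqr_enorm.
rewrite opprD addrA -mulmxBl; set u := (x - z - w) *m P k.
rewrite dotBl !dotBr (dotC p u) => h.
rewrite (dot_wall _ kt wp) -dotBl -mulmxBl -/u; lra.
Qed.

(** Pigeonhole on the torus: among [L + 1] equally spaced points from 0 to [x / 2], two are close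
    modulo an integer vector [z], nonzero if [x] is long. Both lie deep in the cell, so the cell and
    its translate by [z] share a point off the hyperplane of [vor_packing]. *)
Lemma vor_bounded : exists rho, forall x, vor x -> enorm x <= rho.
Proof.
have [l l0 hl] := flag_bound.
(* The rounding error is at most [l / 8], and [1 / 4 + 1 / 8 < 1 / 2] keeps the rounded points in
   the cell. *)
have [|N hN] := @dyadic_small R (l / 8 / n.+1%:R); first by rewrite !divr_gt0 ?ltr0n.
pose L := (2 ^ (N * n))%N; have L0 : 0 < L%:R :> R by rewrite ltr0n expn_gt0.
exists (L%:R * l / 4) => x vx; rewrite leNgt; apply/negP => xbig.
pose y (k : nat) := (k%:R / (2 * L%:R)) *: x.
pose f (k : 'I_L.+1) := res N (cell N (y k)).
have /injectivePn[k [k' kk' ekk']] : ~~ injectiveb f.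
  by apply/negP => /injectiveP /leq_card; rewrite card_res card_ord ltnn.
wlog lt : k k' kk' ekk' / (k < k')%N.
  move=> H; have := kk'; rewrite neq_ltn => /orP[|lt]; first exact: H.
  by apply: (H k' k) => //; rewrite eq_sym.
have [z hz] := res_eq (esym ekk').
have hw := cell_shift hz; set w := y k' - y k - intrv z in hw.
have wl : enorm w <= l / 8.
  have q0 : 0 <= (2 ^+ N)^-1 :> R by rewrite invr_ge0 exprn_ge0.
  apply: (le_trans (enorm_le_sup q0 (fun i => ltW (hw i)))).
  apply: (@le_trans _ _ (n%:R * (l / 8 / n.+1%:R))); first by rewrite ler_wpM2l ?ler0n // ltW.
  rewrite mulrCA -[leRHS]mulr1 ler_wpM2l ?divr_ge0 ?(ltW l0) //.
  by rewrite ler_pdivrMr ?ltr0n // mul1r ler_nat.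
have K0 : 0 < 2 * L%:R :> R by rewrite mulr_gt0.
have z0 : intrv z != 0.
  apply/negP => /eqP ez; move: wl; rewrite /w ez subr0 /y -scalerBl enormZ -mulrBl -natrB ?(ltnW lt) //.
  rewrite ger0_norm ?divr_ge0 ?ler0n ?(ltW K0) // mulrAC ler_pdivrMr //.
  have : 1 <= (k' - k)%:R :> R by rewrite ler1n subn_gt0.
  have := enorm_ge0 x; move: ((k' - k)%:R) (L%:R) L0 (enorm x) xbig => c d e a b a0 c1 h.
  have : a <= c * a by nra.
  lra.
have [j [p [jt wp hp]]] := vor_packing (int_lattice_intrv z) z0.
have quarter i q m : (m < L.+1)%N -> (i < t)%N -> wall i q -> dot (y m) q <= 1 / 4 * dot q q.
  move=> mL it wq; rewrite dotZl; have := vx i q it wq.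
  have c0 : 0 <= m%:R / (2 * L%:R) :> R by rewrite divr_ge0 ?ler0n ?(ltW K0).
  have c1 : m%:R / (2 * L%:R) <= 1 / 2 :> R.
    rewrite ler_pdivrMr // mulrA divfK // mul1r ler_nat; exact: mL.
  move=> /(ler_wpM2l c0) /le_trans; apply.
  have := dot_ge0 q; nra.
have h1 : vor (y k').
  move=> i q it wq; apply: (le_trans (quarter i q k' (ltn_ord _) it wq)).
  have := dot_ge0 q; lra.
have h2 : vor (y k' - intrv z).
  have -> : y k' - intrv z = y k + w by rewrite /w addrA [y k + _]addrCA subrr addr0.
  move=> i q it wq.
  have e8 : 0 <= 8^-1 :> R by [].
  have wl' : enorm w <= 8^-1 * l by rewrite mulrC.
  apply: (le_trans (dot_add_small e8 hl it wq (quarter i q k (ltn_ord _) it wq) wl')).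
  have := dot_ge0 q; lra.
have := hp _ h1 h2; have := quarter j p k' (ltn_ord _) jt wp.
by have := dot_gt0 (proj1 wp); lra.
Qed.

Lemma bdd_vor : bdd vor.
Proof.
have [rho h] := vor_bounded; exists rho => x vx i.
exact: le_trans (coord_le_enorm _ _) (h _ vx).
Qed.

(* A slightly shrunk copy of vor is disjoint from its integer translates even after
   rounding to the dyadic grid, so its cells are distinct modulo the integer lattice. *)
Lemma cont_vor_le1 : cont vor <= 1.
Proof.
rewrite -subr_ge0.
have -> : 1 - cont vor = (1 - (1 - 'X) ^+ n * (cont vor)%:P).[0].
  by rewrite !(hornerM, hornerD, hornerN, hornerC, horner_exp, hornerX) subr0 expr1n mul1r.
apply: poly_ge_at0 => e e0 e1.
rewrite !(hornerM, hornerD, hornerN, hornerC, horner_exp, hornerX) subr_ge0.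
have e1' : 0 < 1 - e by lra.
rewrite -(cont_scale 0 e1' bdd_vor).
set A := _ @` _; have bA : bdd A by apply: bdd_scale; exact: bdd_vor.
have [l l0 hl] := flag_bound.
(* Rounding moves points by at most [e / 4 * l], and [(1 - e) / 2 + e / 4 = 1 / 2 - e / 4] keeps the
   inequalities strict. *)
have [|N hN] := @dyadic_small R (e / 4 * l / n.+1%:R); first by rewrite !divr_gt0 ?mulr_gt0 ?divr_gt0 ?ltr0n.
have [s hs] := bdd_covered N bA.
pose m k := `[< exists2 x, A x & cell N x = k >].
pose s' := undup (seq.filter m s).
have hs' : covered N s' A.
  move=> x Ax; rewrite mem_undup mem_filter hs // andbT.
  by apply/asboolP; exists x.
apply: (le_trans (cont_le hs')).
rewrite ler_pdivrMr ?exprn_gt0 // mul1r -natrX ler_nat -card_res.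
pose a (k : 'rV[int]_n) : 'rV[R]_n := (2 ^+ N)^-1 *: intrv k.
have qN : 0 < (2 ^+ N)^-1 :> R by rewrite invr_gt0 exprn_gt0.
have strict k i q : k \in s' -> (i < t)%N -> wall i q -> dot (a k) q <= (1 / 2 - e / 4) * dot q q.
  rewrite mem_undup mem_filter => /andP[/asboolP[_ [x vx <-] ek] _] it wq.
  set y := (1 - e) *: x + 0 in ek.
  have -> : a k = y + (a k - y) by rewrite addrCA subrr addr0.
  have -> : 1 / 2 - e / 4 = (1 - e) / 2 + e / 4 by lra.
  have e4 : 0 <= e / 4 by lra.
  apply: (dot_add_small e4 hl it wq).
    rewrite /y addr0 dotZl; have := ler_wpM2l (ltW e1') (vx i q it wq); lra.
  have hw o : `|(a k - y) ord0 o| <= (2 ^+ N)^-1.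
    have := cell_cbox N y o; rewrite ek !mxE mulrC => /andP[h1 h2].
    by rewrite ler_norml; apply/andP; split; lra.
  apply: (le_trans (enorm_le_sup (ltW qN) hw)).
  apply: (@le_trans _ _ (n%:R * (e / 4 * l / n.+1%:R))); first by rewrite ler_wpM2l ?ler0n // ltW.
  rewrite mulrCA -[leRHS]mulr1 ler_wpM2l ?(mulr_ge0 e4 (ltW l0)) //.
  by rewrite ler_pdivrMr ?ltr0n // mul1r ler_nat.
have ri : {in s' &, injective (@res n N)}.
  move=> k k' ks ks' /res_eq[z hz].
  have [z0|z0] := eqVneq (intrv z) 0.
    apply/rowP => i; rewrite hz; have /rowP/(_ i) := z0; rewrite !mxE => /eqP.
    by rewrite intr_eq0 => /eqP->; rewrite mul0r addr0.
  have [j [p [jt wp hp]]] := vor_packing (int_lattice_intrv z) z0.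
  have va k0 : k0 \in s' -> vor (a k0).
    move=> k0s i q it wq; apply: (le_trans (strict _ _ _ k0s it wq)).
    have := dot_ge0 q; nra.
  have ek : a k - intrv z = a k'.
    apply/rowP => i; rewrite !mxE hz intrD intrM mulrDr -pmulrn natrX.
    by rewrite [X in _ + X - _](mulrCA) mulVf ?expf_neq0 // mulr1 addrK.
  have := hp _ (va _ ks); rewrite ek => /(_ (va _ ks')) eh.
  by exfalso; have := strict _ _ _ ks jt wp; have := dot_gt0 (proj1 wp); nra.
rewrite -(size_map (@res n N)).
have um : uniq (map (@res n N) s') by rewrite map_inj_in_uniq // undup_uniq.
by rewrite -(card_uniqP um) max_card.
Qed.

End VoronoiProduct.
End Flags.


(** * The cell is an integer parallelotope with finitely many facets *)

Section VoronoiTopology.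
Variable R : realType.

Lemma interiorP n (A : set 'rV[R]_n) x : interior A x <->
  exists2 e, 0 < e & forall y : 'rV[R]_n, (forall i, `|(y - x) ord0 i| < e) -> A y.
Proof.
split.
  move=> /nbhs_ballP[e /= e0 he]; exists e => // y hy; apply: he; split => // i j.
  by rewrite ord1 /ball /= distrC; have := hy j; rewrite !mxE.
move=> [e e0 he]; apply/nbhs_ballP; exists e => //= y hy; apply: he => i.
by have := (proj2 hy) ord0 i; rewrite /ball /= distrC !mxE.
Qed.

Lemma enorm_small n (e : R) : 0 < e -> exists2 d, 0 < d &
  forall w : 'rV[R]_n, (forall i, `|w ord0 i| < d) -> enorm w <= e.
Proof.
move=> e0; have q0 : 0 < e / n.+1%:R by rewrite divr_gt0 ?ltr0n.
exists (e / n.+1%:R) => // w hw.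
apply: (le_trans (enorm_le_sup (ltW q0) (fun i => ltW (hw i)))).
rewrite mulrCA -[leRHS]mulr1 ler_wpM2l ?(ltW e0) //.
by rewrite ler_pdivrMr ?ltr0n // mul1r ler_nat.
Qed.

Lemma closure_near n (A : set 'rV[R]_n) x e : closure A x -> 0 < e ->
  exists2 y, A y & enorm (y - x) <= e.
Proof.
move=> cx /(@enorm_small n)[d d0 hd].
have [|y [Ay yd]] := cx (ball x d); first exact: nbhsx_ballx.
exists y => //; apply: hd => i; rewrite !mxE distrC.
exact: (proj2 yd ord0 i).
Qed.

Lemma bdd_bounded n (A : set 'rV[R]_n) : bdd A -> bounded_set A.
Proof.
move=> [r hr]; exists `|r|; split; first exact: num_real.
move=> M rM x Ax /=; have -> : `|x| = mx_norm x by [].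
rewrite mx_normrE; apply: bigmax_le.
  exact: le_trans (normr_ge0 r) (ltW rM).
move=> [i j] _ /=; rewrite ord1; apply: le_trans (hr x Ax j) _.
exact: le_trans (ler_norm _) (ltW rM).
Qed.

Variables (n t : nat) (P : nat -> 'M[R]_n) (lam : nat -> R).
Hypothesis fP : flag t P lam.

Local Notation K := (vor t P).
Local Notation wall := (wall t P).

Lemma closed_vor : closed K.
Proof.
move=> x cx j p jt wp; rewrite leNgt; apply/negP => lt.
have p0 := enorm_gt0 (proj1 wp).
pose e := (dot x p - dot p p / 2) / 2 / enorm p.
have e0 : 0 < e by rewrite !divr_gt0 // subr_gt0.
have [y Ky hy] := closure_near cx e0.
have := Ky j p jt wp; have := dot_le_enorm (x - y) p.
have : enorm (x - y) <= e by rewrite -opprB -scaleN1r enormZ normrN1 mul1r.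
move=> /(ler_wpM2r (ltW p0)); rewrite /e divfK ?gt_eqF // dotBl; lra.
Qed.

Lemma convex_vor : convex_set_n K.
Proof.
move=> x y s Kx Ky s0 s1 j p jt wp; rewrite dotDl !dotZl.
have := Kx j p jt wp; have := Ky j p jt wp; nra.
Qed.

Lemma vor_ball l x : 0 < l -> (forall j, (j < t)%N -> l <= lam j) -> enorm x <= l / 2 -> K x.
Proof.
move=> l0 hl hx j p jt wp; rewrite -[x]add0r.
have h0 : dot (0 : 'rV[R]_n) p <= 0 * dot p p by rewrite dot0l mul0r.
have hx' : enorm x <= 2^-1 * l by rewrite mulrC.
have b0 : 0 <= 2^-1 :> R by [].
by have := dot_add_small fP b0 hl jt wp h0 hx'; rewrite !add0r mulrC.
Qed.

Lemma translateP (x y : 'rV[R]_n) (A : set 'rV[R]_n) : translate x A y <-> A (y - x).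
Proof.
split => [[k Ak <-]|h]; first by rewrite addrC addKr.
by exists (y - x) => //; rewrite addrC subrK.
Qed.

Lemma vor_parallelotope : integer_parallelotope K.
Proof.
have [l l0 hl] := flag_bound fP.
split; [split; [|split]|split].
- apply: bounded_closed_compact; last exact: closed_vor.
  by apply: bdd_bounded; exact: bdd_vor fP.
- exact: convex_vor.
- have l2 : 0 < l / 2 by lra.
  have [d d0 hd] := enorm_small n l2.
  exists 0; apply/interiorP; exists d => // y; rewrite subr0 => hy.
  by apply: (vor_ball l0 hl); exact: hd.
- apply/seteqP; split => // x _; have [z iz vz] := vor_covering fP x.
  by exists z => //; apply/translateP.
- move=> x y ix iy xy; rewrite -subset0 => u /interiorP[e e0 he].
  have yx : y - x != 0 by rewrite subr_eq0; apply/eqP => /esym.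
  have [j [p [jt wp hp]]] := vor_packing fP (int_latticeB iy ix) yx.
  have key v : (translate x K `&` translate y K) v -> dot (v - x) p = dot p p / 2.
    move=> [/translateP h1 /translateP h2]; apply: hp => //.
    by have -> : v - x - (y - x) = v - y by rewrite opprB addrA subrK.
  have p0 := enorm_gt0 (proj1 wp).
  (* An interior point of the intersection could be moved along [p], whereas [key] fixes its scalar
     product with [p]. *)
  pose s := e / 2 / enorm p; have s0 : 0 < s by rewrite !divr_gt0.
  have hu : (translate x K `&` translate y K) u by apply: he => i; rewrite subrr mxE normr0.
  have hv : (translate x K `&` translate y K) (u + s *: p).
    apply: he => i; rewrite addrC addKr mxE normrM gtr0_norm //.
    apply: (@le_lt_trans _ _ (s * enorm p)).
      by rewrite ler_wpM2l ?(ltW s0) // coord_le_enorm.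
    rewrite /s divfK ?gt_eqF //; lra.
  have := key _ hv; have := key _ hu; rewrite (_ : u + s *: p - x = (u - x) + s *: p); last by rewrite addrAC.
  rewrite (dotDl (u - x)) dotZl => -> .
  have := mulr_gt0 s0 (dot_gt0 (proj1 wp)); lra.
Qed.

Definition facet p : set 'rV[R]_n := [set x | K x /\ dot x p = dot p p / 2].

Lemma wall_list j rho : (j < t)%N -> exists r : seq 'rV[R]_n,
  [/\ uniq r, forall p, p \in r -> wall j p & forall p, wall j p -> enorm p <= rho -> p \in r].
Proof.
move=> jt; pose A := [set p | wall j p /\ enorm p <= rho].
have bA : bdd A by exists rho => p [_ hp] i; exact: le_trans (coord_le_enorm _ _) hp.
have sA p q : A p -> A q -> p != q -> lam j <= enorm (p - q).
  by move=> [wp _] [wq _]; exact: wall_sep fP _ _ _ jt wp wq.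
have [r [ur Ar rA]] := separated_listable (flag_lam fP jt) bA sA.
by exists r; split => // [p /rA[]//|p wp hp]; exact: Ar.
Qed.

Lemma slack_list (r : seq 'rV[R]_n) x : (forall p, p \in r -> dot x p < dot p p / 2) ->
  exists2 d, 0 < d & forall p, p \in r -> dot x p + d * enorm p <= dot p p / 2.
Proof.
elim: r => [|p r IH] h; first by exists 1.
have [|d d0 hd] := IH; first by move=> q qr; apply: h; rewrite in_cons qr orbT.
have hp := h p (mem_head _ _).
pose e := (dot p p / 2 - dot x p) / (enorm p + 1).
have q0 : 0 < enorm p + 1 by have := enorm_ge0 p; lra.
have e0 : 0 < e by rewrite divr_gt0 // subr_gt0.
exists (Num.min d e); first by rewrite lt_min d0.
move=> q; rewrite in_cons => /orP[/eqP->|qr].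
  have : Num.min d e * enorm p <= e * enorm p by rewrite ler_wpM2r ?enorm_ge0 // ge_min lexx orbT.
  have : e * (enorm p + 1) = dot p p / 2 - dot x p by rewrite /e divfK // gt_eqF.
  lra.
have : Num.min d e * enorm q <= d * enorm q by rewrite ler_wpM2r ?enorm_ge0 // ge_min lexx.
have := hd q qr; lra.
Qed.

(** If [enorm y <= rho + 1], walls longer than [2 * rho + 2] impose nothing on [y], by
    Cauchy-Schwarz. If the finitely many shorter ones were all strict at [x], a neighbourhood of [x]
    would lie in the cell. *)
Lemma boundary_facets : exists r : nat -> seq 'rV[R]_n,
  (forall j, (j < t)%N -> uniq (r j) /\ forall p, p \in r j -> wall j p) /\
  forall x, boundary K x -> exists2 j, (j < t)%N & exists2 p, p \in r j & facet p x.
Proof.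
have [rho0 hrho0] := vor_bounded fP; pose rho := Num.max rho0 0.
have rho_ge0 : 0 <= rho by rewrite le_max lexx orbT.
have hrho x : K x -> enorm x <= rho by move=> /hrho0 h; rewrite le_max h.
pose Q j (r : seq 'rV[R]_n) := (j < t)%N -> [/\ uniq r, forall p, p \in r -> wall j p &
  forall p, wall j p -> enorm p <= 2 * rho + 2 -> p \in r].
have ex j : exists r, Q j r.
  have [jt|jt] := boolP (j < t)%N; last by exists [::] => jt'; case/negP: jt.
  by have [r hr] := wall_list (2 * rho + 2) jt; exists r.
have [r hr] := choice ex.
exists r; split; first by move=> j jt; have [] := hr j jt.
move=> x [cx nix].
have Kx : K x by exact: closed_vor.
apply: contrapT => nf; apply: nix; apply/interiorP.
have : forall m, (m <= t)%N -> exists2 d, 0 < d &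
    forall j p, (j < m)%N -> p \in r j -> dot x p + d * enorm p <= dot p p / 2.
  elim=> [|m IH] mt; first by exists 1.
  have [d d0 hd] := IH (ltnW mt).
  have [|e e0 he] := @slack_list (r m) x.
    move=> p pr; have [_ /(_ p pr) wp _] := hr m mt.
    rewrite lt_def; have -> : dot x p <= dot p p / 2 by exact: Kx wp.
    rewrite andbT; apply/eqP => e; apply: nf; exists m => //; exists p => //.
  exists (Num.min d e); first by rewrite lt_min d0.
  move=> j p; rewrite ltnS leq_eqVlt => /orP[/eqP->|jm] pr.
    have := he p pr; have : Num.min d e * enorm p <= e * enorm p.
      by rewrite ler_wpM2r ?enorm_ge0 // ge_min lexx orbT.
    lra.
  have := hd j p jm pr; have : Num.min d e * enorm p <= d * enorm p.
    by rewrite ler_wpM2r ?enorm_ge0 // ge_min lexx.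
  lra.
move=> /(_ t (leqnn t))[d d0 hd].
have m0 : 0 < Num.min d 1 by rewrite lt_min d0 ltr01.
have [e e0 he] := enorm_small n m0; exists e => // y /he hy.
have hyd : enorm (y - x) <= d by apply: le_trans hy _; rewrite ge_min lexx.
have hy1 : enorm (y - x) <= 1 by apply: le_trans hy _; rewrite ge_min lexx orbT.
have ey : y = x + (y - x) by rewrite addrC subrK.
move=> j p jt wp; have [_ _ hin] := hr j jt.
have [/(hin p wp) pr|big] := leP (enorm p) (2 * rho + 2).
  rewrite ey dotDl; have := hd j p jt pr; have := dot_le_enorm (y - x) p.
  have := ler_wpM2r (enorm_ge0 p) hyd; lra.
apply: (le_trans (dot_le_enorm _ _)); rewrite -sqr_enorm.
have : enorm y <= rho + 1 by rewrite ey; apply: (le_trans (enormD _ _)); apply: lerD => //; exact: hrho.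
have := enorm_ge0 y; nra.
Qed.

End VoronoiTopology.


(** * Surface area of the cell by thickening facets *)

Section SurfaceArea.
Variable R : realType.

Lemma cont_box1_ge (a l : R) : 0 < l -> l <= cont (box (const_mx a : 'rV[R]_1) (const_mx l)).
Proof.
move=> l0; apply: (@le_trans _ _ (l ^+ 1 * cont (@ucube R 1))).
  by rewrite expr1 ler_peMr ?cont_ucube_ge // ltW.
rewrite -(cont_scale (const_mx a) l0 (@bdd_ucube R 1)); apply: cont_mono; first exact: bdd_box.
move=> _ [x hx <-] i; have := hx i; rewrite !mxE add0r => /andP[h1 h2].
have := ler_wpM2l (ltW l0) h1; have := ler_wpM2l (ltW l0) h2.
by rewrite mulr0 mulr1 => *; apply/andP; split; lra.
Qed.

Lemma enorm_orth n (O : 'M[R]_n) x : O *m O^T = 1%:M -> enorm (x *m O) = enorm x.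
Proof. by move=> hO; rewrite /enorm dot_mxr -mulmxA hO mulmx1. Qed.

Variables (s t : nat) (P : nat -> 'M[R]_(1 + s)) (lam : nat -> R).
Hypothesis fP : flag t P lam.

Local Notation K := (vor t P).
Local Notation wall := (wall t P).

Definition unit_row : 'rV[R]_(1 + s) := row_mx 1%:M 0.

Lemma dot_unit_row x : dot x unit_row = lsubmx x ord0 ord0.
Proof.
rewrite -{1}(hsubmxK x) dotE /unit_row tr_row_mx mul_row_col trmx0 mulmx0 addr0.
by rewrite trmx1 mulmx1.
Qed.

Definition uvec (p : 'rV[R]_(1 + s)) := (enorm p)^-1 *: p.

Lemma dot_uvec (p : 'rV[R]_(1 + s)) : p != 0 -> dot (uvec p) (uvec p) = 1.
Proof.
move=> p0; have h : enorm p != 0 by rewrite gt_eqF // enorm_gt0.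
by rewrite /uvec dotZl dotZr -sqr_enorm expr2 mulKf // mulVf.
Qed.

Lemma dot_uvecr x p : dot x (uvec p) = dot x p / enorm p.
Proof. by rewrite dotZr mulrC. Qed.

Lemma uvecE (p : 'rV[R]_(1 + s)) : p != 0 -> p = enorm p *: uvec p.
Proof. by move=> p0; rewrite scalerA mulfV ?scale1r // gt_eqF // enorm_gt0. Qed.

Lemma rotation_exists : exists rot : 'rV[R]_(1 + s) -> 'M[R]_(1 + s),
  forall p : 'rV[R]_(1 + s), p != 0 -> rot p *m (rot p)^T = 1%:M /\ unit_row *m rot p = uvec p.
Proof.
have ex (p : 'rV[R]_(1 + s)) : exists O : 'M[R]_(1 + s),
    p != 0 -> O *m O^T = 1%:M /\ unit_row *m O = uvec p; last first.
  by have [rot hrot] := choice ex; exists rot.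
have [->|p0] := eqVneq p 0; first by exists 0 => //; rewrite eqxx.
have e1 : dot unit_row unit_row = 1 by rewrite dot_unit_row /unit_row row_mxKl mxE eqxx.
by have [Q hQ1 hQ2] := householder (dot_uvec p0) e1; exists Q.
Qed.

Section Rotated.
Variable rot : 'rV[R]_(1 + s) -> 'M[R]_(1 + s).
Hypothesis rotP : forall p : 'rV[R]_(1 + s), p != 0 -> rot p *m (rot p)^T = 1%:M /\ unit_row *m rot p = uvec p.

(** Coordinates on the hyperplane [dot x p = dot p p / 2]: [rot p] carries the first axis to the
    direction of [p], and the hyperplane is at height [enorm p / 2]. *)
Definition lift_facet p (y : 'rV[R]_s) : 'rV[R]_(1 + s) :=
  row_mx (const_mx (enorm p / 2)) y *m rot p.

Definition flat_facet p : set 'rV[R]_s := [set y | K (lift_facet p y)].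

(** The slab over the facet, between distances [a] and [b] outside it. A positive [a] keeps slabs
    away from the cell and, within one factor, from each other. *)
Definition prism (a b : R) p : set 'rV[R]_(1 + s) :=
  img (rot p) (prodset (box (const_mx (enorm p / 2 + a)) (const_mx (b - a))) (flat_facet p)).

Lemma dot_lift_facet (p : 'rV[R]_(1 + s)) y : p != 0 -> dot (lift_facet p y) (uvec p) = enorm p / 2.
Proof.
move=> p0; have [h1 h2] := rotP p0.
by rewrite -h2 dot_mxr -mulmxA h1 mulmx1 dot_unit_row row_mxKl mxE.
Qed.

Lemma facet_lift (p x : 'rV[R]_(1 + s)) : p != 0 -> facet t P p x -> exists2 y, flat_facet p y & lift_facet p y = x.
Proof.
move=> p0 [Kx ex]; have [h1 h2] := rotP p0.
have h1' : (rot p)^T *m rot p = 1%:M by apply: mulmx1C.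
have ey : lift_facet p (rsubmx (x *m (rot p)^T)) = x.
  rewrite /lift_facet; have -> : const_mx (enorm p / 2) = lsubmx (x *m (rot p)^T).
    apply/matrixP => i j; rewrite !ord1 mxE -dot_unit_row dot_mxr trmxK h2 dot_uvecr ex.
    rewrite -sqr_enorm expr2 mulrAC mulfK // gt_eqF // enorm_gt0 //.
  by rewrite hsubmxK -mulmxA h1' mulmx1.
by exists (rsubmx (x *m (rot p)^T)) => //; rewrite /flat_facet /= ey.
Qed.

Lemma lift_facet_isometry (p : 'rV[R]_(1 + s)) x y : p != 0 -> enorm (lift_facet p x - lift_facet p y) = enorm (x - y).
Proof.
move=> p0; have [h1 _] := rotP p0.
rewrite -mulmxBl enorm_orth // opp_row_mx add_row_mx subrr /enorm; congr Num.sqrt.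
by rewrite dot_split row_mxKl row_mxKr dot0l add0r.
Qed.

Lemma bdd_flat_facet (p : 'rV[R]_(1 + s)) : p != 0 -> bdd (flat_facet p).
Proof.
move=> p0; have [rho hrho] := vor_bounded fP; have [h1 _] := rotP p0.
exists rho => y /hrho hy i; apply: le_trans hy; rewrite /lift_facet enorm_orth //.
have := coord_le_enorm (row_mx (const_mx (enorm p / 2)) y : 'rV[R]_(1 + s)) (rshift 1 i).
by rewrite row_mxEr.
Qed.

Lemma bdd_prism (a b : R) (p : 'rV[R]_(1 + s)) : p != 0 -> bdd (prism a b p).
Proof.
move=> p0; apply: bdd_img; apply: bdd_prodset; first exact: bdd_box.
exact: bdd_flat_facet.
Qed.

Lemma cont_prism (a b : R) (p : 'rV[R]_(1 + s)) : p != 0 -> a < b -> (b - a) * cont (flat_facet p) <= cont (prism a b p).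
Proof.
move=> p0 ab; have [h1 _] := rotP p0.
have h1' : (rot p)^T *m (rot p)^T^T = 1%:M by rewrite trmxK; apply: mulmx1C.
have bs : bdd (prodset (box (const_mx (enorm p / 2 + a) : 'rV[R]_1) (const_mx (b - a))) (flat_facet p)).
  by apply: bdd_prodset; [exact: bdd_box|exact: bdd_flat_facet].
have := cont_orth h1' (bdd_prism a b p0).
rewrite /prism img_comp h1 img1; apply: le_trans.
apply: le_trans (cont_prodset (bdd_box _ _) (bdd_flat_facet p0)).
by rewrite ler_wpM2r ?cont_ge0 // cont_box1_ge // subr_gt0.
Qed.

Lemma prism_decomp (a b : R) (p : 'rV[R]_(1 + s)) x : p != 0 -> prism a b p x -> exists f r,
  [/\ K f, dot f (uvec p) = enorm p / 2, a <= r <= b & x = f + r *: uvec p].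
Proof.
move=> p0 [z [hz1 hz2] <-]; have [h1 h2] := rotP p0.
exists (lift_facet p (rsubmx z)), (lsubmx z ord0 ord0 - enorm p / 2); split => //.
- exact: dot_lift_facet.
- have := hz1 ord0; rewrite !mxE => /andP[h3 h4]; apply/andP; split; lra.
rewrite -h2 scalemxAl -mulmxDl; congr (_ *m _).
rewrite /unit_row scale_row_mx scaler0 add_row_mx addr0 -[LHS]hsubmxK; congr row_mx.
apply/matrixP => i j; rewrite !ord1 !mxE eqxx mulr1 [RHS]addrC subrK.
by congr (z _ _); apply: val_inj.
Qed.

(** Among walls of equal direction only the shortest can touch the cell; a list of walls may also
    contain multiples such as [2 *: p]. *)
Lemma facet_empty p q j : (j < t)%N -> wall j p -> wall j q -> uvec p = uvec q ->
  enorm p < enorm q -> flat_facet q = set0.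
Proof.
move=> jt wp wq e lt; rewrite -subset0 => y /(_ j p jt wp).
have p0 := enorm_gt0 (proj1 wp).
have := dot_lift_facet y (proj1 wq); rewrite -e dot_uvecr.
move=> /(congr1 (fun u => u * enorm p)); rewrite divfK ?gt_eqF // => ->.
by rewrite -sqr_enorm; nra.
Qed.

(** For normals with scalar product [c < 1], the difference of points at heights [r] and [r'] has
    scalar product at least [r - r' * c] with the first normal and at most [r * c - r'] with the
    second. Hence twice its norm is at least [2 * a * (1 - c)]. For equal normals one slab is
    empty. *)
Lemma sep_prism (a b : R) j (p q : 'rV[R]_(1 + s)) : 0 < a -> (j < t)%N -> wall j p -> wall j q -> p != q ->
  sep (prism a b p) (prism a b q).
Proof.
move=> a0 jt wp wq pq.
have p0 := proj1 wp; have q0 := proj1 wq.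
have empty u : flat_facet u = set0 -> forall x, ~ prism a b u x.
  by move=> e x [z [_]]; rewrite e.
have [e|ne] := eqVneq (uvec p) (uvec q).
  have := pq; have [lt|lt|e2] := ltgtP (enorm p) (enorm q).
  - move=> _; have eq := facet_empty jt wp wq e lt.
    by exists 1 => // x y _ /(empty _ eq).
  - move=> _; have ep := facet_empty jt wq wp (esym e) lt.
    by exists 1 => // x y /(empty _ ep).
  - by rewrite (uvecE p0) (uvecE q0) e e2 eqxx.
pose c := dot (uvec p) (uvec q).
have c1 : c < 1.
  have : 0 < dot (uvec p - uvec q) (uvec p - uvec q) by rewrite dot_gt0 // subr_eq0.
  rewrite dotBl !dotBr !dot_uvec // (dotC (uvec q)) -/c; lra.
have e0 : 0 < a * (1 - c) by rewrite mulr_gt0 // subr_gt0.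
apply: (sep_enorm e0) => x y /(prism_decomp p0)[f [r [Kf ef /andP[r1 r2] ->]]].
move=> /(prism_decomp q0)[g [r' [Kg eg /andP[r1' r2'] ->]]].
set d := f + _ - _.
have h1 : r - r' * c <= dot d (uvec p).
  rewrite dotBl !dotDl (dotZl r) (dotZl r') dot_uvec // ef (dotC (uvec q)) -/c.
  have : dot g (uvec p) <= enorm p / 2.
    rewrite dot_uvecr ler_pdivrMr ?enorm_gt0 // mulrAC -expr2 sqr_enorm; exact: Kg wp.
  lra.
have h2 : r' - r * c <= dot (- d) (uvec q).
  rewrite dotNl dotBl !dotDl (dotZl r) (dotZl r') dot_uvec // eg -/c.
  have : dot f (uvec q) <= enorm q / 2.
    rewrite dot_uvecr ler_pdivrMr ?enorm_gt0 // mulrAC -expr2 sqr_enorm; exact: Kf wq.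
  lra.
have n1 u : u != 0 -> enorm (uvec u) = 1 by move=> u0; rewrite /enorm dot_uvec // sqrtr1.
have := dot_le_enorm d (uvec p); have := dot_le_enorm (- d) (uvec q).
rewrite !n1 // !mulr1 -scaleN1r enormZ normrN1 mul1r scaleN1r.
have : 0 <= (r + r' - a - a) * (1 - c) by apply: mulr_ge0; lra.
move: (enorm d) (dot d _) (dot (- d) _) h1 h2 => u v w; lra.
Qed.

Lemma sep_vor_prism a b j p : 0 < a -> (j < t)%N -> wall j p -> sep K (prism a b p).
Proof.
move=> a0 jt wp; have p0 := proj1 wp.
apply: (sep_enorm a0) => g x Kg /(prism_decomp p0)[f [r [Kf ef /andP[r1 r2] ->]]].
rewrite -opprB -scaleN1r enormZ normrN1 mul1r; set d := _ - _.
have h1 : r <= dot d (uvec p).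
  rewrite dotBl dotDl (dotZl r) dot_uvec // ef.
  have : dot g (uvec p) <= enorm p / 2.
    rewrite dot_uvecr ler_pdivrMr ?enorm_gt0 // mulrAC -expr2 sqr_enorm; exact: Kg wp.
  lra.
have := dot_le_enorm d (uvec p); rewrite [X in _ * X]/enorm dot_uvec // sqrtr1; lra.
Qed.

(** The preimage of [x] has its [P j] component divided by [1 + c] and the other components
    unchanged. *)
Lemma stretch_sub j c x : (j < t)%N -> 0 <= c ->
  (forall i q, (i < t)%N -> i != j -> wall i q -> dot x q <= dot q q / 2) ->
  (forall q, wall j q -> dot x q <= (1 + c) * (dot q q / 2)) ->
  img (1%:M + c *: P j) K x.
Proof.
move=> jt c0 h1 h2; have c1 : 0 < 1 + c by lra.
pose y := x - (c / (1 + c)) *: (x *m P j).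
exists y; last first.
  rewrite mulmxDr mulmx1 -scalemxAr /y mulmxBl -scalemxAl -mulmxA (flag_idem fP) //.
  rewrite scalerBr scalerA addrAC -addrA -addrA -[RHS]addr0; congr (_ + _).
  rewrite -(scaleNr (c * (c / (1 + c)))) -(scaleNr (c / (1 + c))) -!scalerDl (_ : _ + (_ + _) = 0) ?scale0r //.
  by field; rewrite gt_eqF.
move=> i q it wq; rewrite dotBl dotZl.
have [e|ij] := eqVneq i j; last first.
  have -> : dot (x *m P j) q = 0.
    by rewrite dot_mxr (flag_sym fP) // (wall_proj0 fP jt it _ wq) ?dot0r // eq_sym.
  by rewrite mulr0 subr0; exact: h1 wq.
rewrite e in wq; rewrite -(dot_wall fP x jt wq).
have -> : dot x q - c / (1 + c) * dot x q = dot x q / (1 + c) by field; rewrite gt_eqF.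
by rewrite ler_pdivrMr // mulrC; exact: h2.
Qed.

(* Thickening the facets orthogonal to the j-th factor by b enlarges vor to less than its
   image under 1 + (2 b / lam_j) P_j, whose volume is known. *)
Lemma sum_flat_facets j r : (j < t)%N -> uniq r -> (forall p, p \in r -> wall j p) ->
  \sum_(p <- r) cont (flat_facet p) <= 2 * (\rank (P j))%:R / lam j.
Proof.
move=> jt ur rw; have l0 := flag_lam fP jt.
set S := \sum_(p <- r) _; set d := \rank (P j).
have S0 : 0 <= S by apply: sumr_ge0 => p _; exact: cont_ge0.
pose q : {poly R} := \sum_(k < d) (1 + (2 / lam j)%:P * 'X) ^+ k * (2 / lam j)%:P + 'X * S%:P.
have -> : 2 * d%:R / lam j = q.[0].
  rewrite /q hornerD horner_sum (eq_bigr (fun=> 2 / lam j)) => [|k _]; last first.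
    by rewrite !(hornerM, hornerD, hornerC, horner_exp, hornerX) mulr0 addr0 expr1n mul1r.
  by rewrite sumr_const card_ord hornerM hornerX mul0r addr0 -[RHS]mulr_natr mulrAC.
apply: poly_ge_at0 => b b0 b1.
rewrite /q hornerD horner_sum hornerM hornerX hornerC.
under eq_bigr => k _ do rewrite !(hornerM, hornerD, hornerC, horner_exp, hornerX).
pose c := 2 / lam j * b; have c0 : 0 <= c by rewrite mulr_ge0 ?divr_ge0 ?ltW.
(* The gap below the slabs is of second order in [b], so it disappears in the limit after division
   by [b]. *)
pose a := b ^+ 2; have a0 : 0 < a by rewrite exprn_gt0.
have ab : a < b by rewrite /a expr2; nra.
have bK := bdd_vor fP.
pose U := fun x => exists2 p, p \in r & prism a b p x.
have r0 p : p \in r -> p != 0 by move=> /rw[].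
have bp p : p \in r -> bdd (prism a b p) by move=> pr; apply: bdd_prism; exact: r0.
have bU : bdd U by apply: (bdd_bigU bp).
have h1 : (b - a) * S <= cont U.
  rewrite mulr_sumr; apply: (@le_trans _ _ (\sum_(p <- r) cont (prism a b p))).
    rewrite big_seq [leRHS]big_seq; apply: ler_sum => p pr.
    by apply: cont_prism => //; exact: r0.
  apply: cont_sep_big => // [p pr x px|p p' pr pr' pp']; first by exists p.
  exact: (sep_prism b a0 jt (rw _ pr) (rw _ pr')).
have h2 : cont K + cont U <= cont (K `|` U).
  apply: cont_sep => //; apply: sep_bigU => p pr.
  exact: (sep_vor_prism b a0 jt (rw _ pr)).
have h3 : K `|` U `<=` img (1%:M + c *: P j) K.
  move=> x [Kx|[p pr /(prism_decomp (r0 _ pr))[f [u [Kf ef /andP[u1 u2] ->]]]]].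
    apply: stretch_sub => // [i v it _ wv|v wv]; first exact: Kx wv.
    apply: (le_trans (Kx j v jt wv)); have := dot_ge0 v; nra.
  have wp := rw _ pr.
  apply: stretch_sub => // [i v it ij wv|v wv]; rewrite dotDl dotZl.
    have -> : dot (uvec p) v = 0.
      rewrite (dot_wall fP (uvec p) it wv) /uvec -scalemxAl (wall_proj0 fP it jt ij wp).
      by rewrite scaler0 dot0l.
    by rewrite mulr0 addr0; exact: Kf wv.
  have n1 : enorm (uvec p) = 1 by rewrite /enorm dot_uvec ?sqrtr1 // r0.
  have hv : dot (uvec p) v <= enorm v by have := dot_le_enorm (uvec p) v; rewrite n1 mul1r.
  have lv := wall_enorm fP jt wv.
  have fv := Kf j v jt wv.
  have u0 : 0 <= u by apply: le_trans u1; exact: ltW.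
  (* Origin of [2 / lam j]: the displacement [b] is absorbed by the stretching because [enorm v] is
     at least [lam j]. *)
  have h : b * enorm v <= c * (dot v v / 2).
    rewrite -sqr_enorm /c; have -> : 2 / lam j * b * (enorm v ^+ 2 / 2) = b * enorm v * (enorm v / lam j).
      by field; rewrite gt_eqF.
    rewrite ler_peMr ?mulr_ge0 ?enorm_ge0 ?(ltW b0) //.
    by rewrite ler_pdivlMr // mul1r.
  have : u * dot (uvec p) v <= b * enorm v.
    apply: (@le_trans _ _ (u * enorm v)); first by rewrite ler_wpM2l.
    by rewrite ler_wpM2r ?enorm_ge0.
  rewrite mulrDl mul1r; lra.
have h4 : cont (K `|` U) <= (1 + c) ^+ d * cont K.
  apply: le_trans (cont_mono (bdd_img _ bK) h3) _.
  apply: le_trans (cont_img_le _ bK) _; apply: ler_wpM2r; first exact: cont_ge0.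
  by apply: kap_proj_le => //; exact: (flag_idem fP).
have K1 := cont_vor_le1 fP; have K0 := cont_ge0 K.
have e1 : 1 <= (1 + c) ^+ d by rewrite exprn_ege1 // lerDl.
(* Subtracting [cont K] leaves [((1 + c) ^+ d - 1) * cont K], and [cont K <= 1]. *)
have h5 : (b - a) * S <= (1 + c) ^+ d - 1 by nra.
have h6 : (1 + c) ^+ d - 1 = b * \sum_(i < d) ((1 + c) ^+ i * (2 / lam j)).
  by rewrite subrX1 addrAC subrr add0r -mulr_suml /c; ring.
have : (1 - b) * S <= \sum_(i < d) ((1 + c) ^+ i * (2 / lam j)).
  rewrite -(ler_pM2l b0) -h6; apply: le_trans h5; rewrite /a expr2; lra.
lra.
Qed.

End Rotated.

Lemma surface_area_vor : (0 < s)%N ->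
  (@surface_area R s.+1 K <= (\sum_(j < t) 2 * (\rank (P j))%:R / lam j)%:E)%E.
Proof.
move=> s0; have [rot rotP] := rotation_exists.
have [r [hr hb]] := boundary_facets fP.
apply: hausdorff_le => // e delta e0 d0.
pose M := \sum_(j < t) (size (r j))%:R : R.
have M0 : 0 <= M by apply: sumr_ge0 => j _; rewrite ler0n.
pose e' := e / (M + 1); have M1 : 0 < M + 1 by lra.
have e'0 : 0 < e' by rewrite divr_gt0.
apply: (@fcov_le _ _ _ _ _ (boundary K) (\sum_(j <- enum 'I_t) \sum_(p <- r j) (cont (flat_facet rot p) + e'))) => //.
  rewrite big_enum /=; apply: (@le_trans _ _ (\sum_(j < t) (2 * (\rank (P j))%:R / lam j + e' * (size (r j))%:R))).
    apply: ler_sum => j _; rewrite big_split /= lerD //.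
      by have [ur rw] := hr j (ltn_ord j); exact: (sum_flat_facets rotP (ltn_ord j)).
    by rewrite big_const_seq count_predT iter_addr_0 mulr_natr.
  rewrite big_split /= lerD2l -mulr_sumr -/M /e' mulrAC ler_pdivrMr // ler_wpM2l ?(ltW e0) //; lra.
apply: (fcov_bigU (F := fun j : 'I_t => [set x | exists2 p, p \in r j & facet t P p x]) s0 (ltW d0)); last first.
  by move=> x /hb[j jt h]; exists (Ordinal jt) => //; rewrite mem_enum.
move=> j _; apply: (fcov_bigU (F := fun p => facet t P p) s0 (ltW d0)) => // p pr.
have p0 : p != 0 by have [_ /(_ p pr)[]] := hr j (ltn_ord j).
have bF := bdd_flat_facet rotP p0.
apply: fcov_le (fcov_isometry s0 (fun x y => lift_facet_isometry rotP x y p0) bF e'0 d0) => //.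
by move=> x /(facet_lift rotP p0)[y hy <-]; exists y.
Qed.

End SurfaceArea.

Theorem good_parallelotope (R : realType) n (S : R) : (1 < n)%N -> good n S ->
  exists K : set 'rV[R]_n, integer_parallelotope K /\ (surface_area K <= S%:E)%E.
Proof.
case: n => [|s] // s0 [t [P [lam [fP hS]]]].
exists (vor t P); split; first exact: vor_parallelotope fP.
apply: (le_trans (surface_area_vor (s := s) fP s0)).
by rewrite lee_fin.
Qed.


(** * Extending a flag along an integer matrix *)

Section FlagExtension.
Variable R : realType.

(** Normal equations: for a basis [A] of the kernel the Gram matrix [G] is invertible, since
    [v *m G = 0] makes the norm of [v *m A] vanish. *)
Lemma orth_proj_ker n k (M : 'M[R]_(n, k)) : exists E : 'M[R]_n,
  [/\ E^T = E, E *m M = 0 & forall m (X : 'M[R]_(m, n)), X *m M = 0 -> X *m E = X].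
Proof.
have [A [fA eA]] : exists A : 'M[R]_(\rank (kermx M), n), row_free A /\ (A :=: kermx M)%MS.
  by exists (row_base (kermx M)); split; [exact: row_base_free|exact: eq_row_base].
pose G := A *m A^T.
have uG : G \in unitmx.
  rewrite -row_free_unit -kermx_eq0; apply/eqP/row_matrixP => i.
  rewrite row0; set v := row i _.
  have vG : v *m G = 0 by rewrite -row_mul mulmx_ker row0.
  have : v *m A = 0.
    apply/eqP; rewrite -dot_eq0 dotE trmx_mul mulmxA -(mulmxA v) -/G vG mul0mx mxE //.
  by move/eqP; rewrite mulmx_free_eq0 // => /eqP.
have AM : A *m M = 0 by apply/sub_kermxP; rewrite eA.
exists (A^T *m invmx G *m A); split.
- rewrite !trmx_mul trmxK trmx_inv /G trmx_mul trmxK mulmxA //.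
- by rewrite -mulmxA AM mulmx0.
- move=> m X /sub_kermxP; rewrite -eA => /submxP[W ->].
  by rewrite !mulmxA -(mulmxA W) -/G -(mulmxA W) mulmxV // mulmx1.
Qed.

Lemma enorm_proj_le n (Q : 'M[R]_n) x : Q^T = Q -> Q *m Q = Q -> enorm (x *m Q) <= enorm x.
Proof.
move=> sQ iQ; have [->|h] := eqVneq (x *m Q) 0.
  by rewrite /enorm dot0l sqrtr0 sqrtr_ge0.
have p0 := enorm_gt0 h; rewrite -(ler_pM2r p0) -expr2 sqr_enorm.
have -> : dot (x *m Q) (x *m Q) = dot x (x *m Q) by rewrite dot_mxr sQ -mulmxA iQ.
exact: dot_le_enorm.
Qed.

(** A nonzero integer has square at least 1. This turns a condition on supports into the norm bound
    [d] of [good_extend]. *)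
Lemma support_le_dot n (z : 'rV[R]_n) : int_lattice z ->
  #|[set i | z ord0 i != 0]%SET|%:R <= dot z z.
Proof.
move=> iz; rewrite -sum1_card natr_sum /dot [leLHS]big_mkcond; apply: ler_sum => i _.
by rewrite inE -expr2; case: ifP => zi; rewrite ?sqr_ge0 // sqr_intr_ge1.
Qed.

Lemma int_lattice_mulmx n k (z : 'rV[R]_n) (N : 'M[R]_(n, k)) :
  int_lattice z -> (forall i j, N i j \is a Num.int) -> int_lattice (z *m N).
Proof. by move=> iz iN j; rewrite mxE rpred_sum // => i _; rewrite rpredM. Qed.

(** A single factor: the unit cube, of surface area [2 * n]. *)
Lemma good_trivial n : good n (2 * n%:R : R).
Proof.
exists 1%N, (fun=> 1%:M), (fun=> 1); split; last first.
  by rewrite big_ord1 mxrank1 divr1.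
split => [j _|j _|i j|||j z _ iz _].
- by rewrite trmx1.
- by rewrite mulmx1.
- by rewrite !ltnS !leqn0 => /eqP-> /eqP->; rewrite eqxx.
- by rewrite big_ord1.
- by [].
- rewrite mulmx1 => z0; rewrite -(ler_pXn2r (n := 2)) ?nnegrE ?enorm_ge0 //.
  rewrite expr1n sqr_enorm; apply: le_trans (support_le_dot iz).
  rewrite ler1n card_gt0; apply/eqP => h; case/eqP: z0; apply/rowP => i; rewrite mxE.
  apply/eqP; apply: contraT => hi; suff : i \in (finset.set0 : {set 'I_n}) by rewrite finset.in_set0.
  by rewrite -h inE.
Qed.

(* The kernels of N R_j, where R_j projects on the factors j, ..., t - 1 of the given flag,
   increase from ker N to the whole space; the new flag is formed by the successive
   differences of the orthogonal projections on them. *)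
Lemma good_extend n k (N : 'M[R]_(n, k)) (s d S : R) :
  0 < s -> 0 < d -> (forall i j, N i j \is a Num.int) ->
  (forall x : 'rV[R]_n, enorm (x *m N) <= s * enorm x) ->
  (forall z : 'rV[R]_n, int_lattice z -> z *m N = 0 -> z != 0 -> d <= enorm z) ->
  good k S -> good n (2 * n%:R / d + s * S).
Proof.
move=> s0 d0 iN hs hd [t [Q [mu [fQ hS]]]].
pose T j : 'M[R]_k := \sum_(i < t | (j <= i)%N) Q i.
have QT a j : (a < t)%N -> Q a *m T j = if (j <= a)%N then Q a else 0.
  move=> ta; rewrite mulmx_sumr; case: ifP => ja; last first.
    rewrite big1 // => i ji; apply: (flag_orth fQ) => //.
    by apply: contraFneq ja => ->.
  rewrite (bigD1 (Ordinal ta)) //= (flag_idem fQ) // big1 ?addr0 // => i /andP[_ ia].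
  by apply: (flag_orth fQ) => //; rewrite eq_sym.
have TT i j : (i <= j)%N -> T i *m T j = T j.
  move=> ij; rewrite {1}/T mulmx_suml (eq_bigr (fun a : 'I_t => if (j <= a)%N then Q a else 0)).
    rewrite -big_mkcondr; apply: eq_bigl => a /=; apply/andP/idP => [[]//|ja]; split => //.
    exact: leq_trans ja.
  by move=> a _; rewrite QT.
have TQ j a : (a < t)%N -> (j <= a)%N -> T j *m Q a = Q a.
  move=> ta ja; apply: trmx_inj; rewrite trmx_mul (flag_sym fQ) //.
  have -> : (T j)^T = T j.
    by rewrite /T raddf_sum; apply: eq_bigr => i _; rewrite /= (flag_sym fQ).
  by rewrite QT // ja.
have T0 : T 0%N = 1%:M by rewrite -(flag_sum fQ).
have TS j : (j < t)%N -> T j = Q j + T j.+1.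
  move=> jt; rewrite /T (bigD1 (Ordinal jt)) //=; congr (_ + _); apply: eq_bigl => i.
  by rewrite ltn_neqAle andbC eq_sym.
have Tt : T t = 0 by rewrite /T big1 // => i; rewrite leqNgt ltn_ord.
have [E hE] := choice (fun j => orth_proj_ker (N *m T j)).
have Esym j : (E j)^T = E j by have [] := hE j.
have EN j : E j *m (N *m T j) = 0 by have [] := hE j.
have Efix j m (X : 'M[R]_(m, n)) : X *m (N *m T j) = 0 -> X *m E j = X.
  by have [_ _] := hE j; apply.
have EE i j : (i <= j)%N -> E i *m E j = E i.
  move=> ij; apply: Efix; rewrite -(TT i j ij) !mulmxA -(mulmxA _ N) EN mul0mx //.
have EE' i j : (i <= j)%N -> E j *m E i = E i.
  by move=> ij; apply: trmx_inj; rewrite trmx_mul !Esym EE.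
have Et : E t = 1%:M by rewrite -[LHS]mul1mx; apply: Efix; rewrite Tt !mulmx0.
pose P j := if j is m.+1 then E m.+1 - E m else E 0%N.
pose lam j := if j is m.+1 then mu m / s else d.
have PE j i : (j <= i)%N -> P j *m E i = P j.
  by case: j => [|m] ji; rewrite /= ?mulmxBl !EE // ltnW.
have EP j i : (j <= i)%N -> E i *m P j = P j.
  by case: j => [|m] ji; rewrite /= ?mulmxBr !EE' // ltnW.
have EP0 j m : (j <= m)%N -> E j *m P m.+1 = 0.
  by move=> jm; rewrite /= mulmxBr !EE ?subrr // ltnW.
have PE0 j m : (j <= m)%N -> P m.+1 *m E j = 0.
  by move=> jm; rewrite /= mulmxBl !EE' ?subrr // ltnW.
(* Telescoping: a vector killed by all differences of index above [j] lies in the image of [E j]. *)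
have fixE z j : (j <= t)%N -> (forall i, (j < i < t.+1)%N -> z *m P i = 0) -> z *m E j = z.
  move=> jt hz; have : forall m, (m <= t - j)%N -> z *m E (t - m)%N = z.
    elim=> [|m IH] mj; first by rewrite subn0 Et mulmx1.
    have e : (t - m = (t - m.+1).+1)%N by lia.
    have := hz (t - m)%N; rewrite e /= mulmxBr -e IH; last exact: ltnW.
    move=> h; apply/esym/eqP; rewrite -subr_eq0; apply/eqP; apply: h; lia.
  by move=> /(_ _ (leqnn _)); rewrite subKn.
exists t.+1, P, lam; split.
  split.
  - by case=> [|m] _ /=; rewrite ?linearB /= !Esym.
  - case=> [|m] mt /=; first by rewrite EE.
    by rewrite mulmxBl !mulmxBr (EE' m m.+1) // (EE m m.+1) // !EE // subrr subr0.
  - move=> i j it jt; rewrite neq_ltn => /orP[ij|ji].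
      by case: j jt ij => // m mt im; rewrite -(PE i m) // -mulmxA EP0 // mulmx0.
    by case: i it ji => // m mt jm; rewrite -(EP j m) // mulmxA PE0 // mul0mx.
  - rewrite -Et; elim: (t) => [|m IH]; first by rewrite big_ord1.
    by rewrite big_ord_recr /= IH addrC subrK.
  - case=> [|m] mt //=; rewrite divr_gt0 //; exact: (flag_lam fQ).
  - case=> [|m] z mt iz bz /= zP.
      have zE : z *m E 0%N = z by apply: fixE.
      move: zP; rewrite zE => z0; apply: hd => //.
      by rewrite -zE -(mulmx1 N) -T0 -mulmxA EN mulmx0.
    have zE : z *m E m.+1 = z by apply: fixE.
    rewrite ler_pdivrMr // mulrC.
    have mt' : (m < t)%N by [].
    have zT : z *m N *m T m.+1 = 0 by rewrite -{1}zE -!mulmxA EN mulmx0.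
    have ENQ : E m *m N *m Q m = 0.
      by rewrite -(TQ m m mt' (leqnn m)) !mulmxA -(mulmxA _ N) EN mul0mx.
    (* Only the component in [P m.+1] contributes, so the norm bound for [N] yields [mu m / s]. *)
    have zQ : z *m N *m Q m = z *m (E m.+1 - E m) *m N *m Q m.
      by rewrite mulmxBr zE !mulmxBl -[X in _ = _ - X]mulmxA -[X in _ = _ - X]mulmxA (mulmxA (E m)) ENQ mulmx0 subr0.
    apply: (@le_trans _ _ (enorm (z *m N *m Q m))).
      apply: (flag_sep fQ) => //; first exact: int_lattice_mulmx.
        by move=> i /andP[mi it]; rewrite -(TQ m.+1 i) // mulmxA zT mul0mx.
      (* If [z *m N *m Q m] vanished, [z] would already lie in the kernel defining [E m]. *)
      apply: contraNneq zP => h.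
      have : z *m E m = z.
        by apply: Efix; rewrite mulmxA (TS m) // mulmxDr h zT addr0.
      by rewrite mulmxBr zE => ->; rewrite subrr.
    rewrite zQ; apply: le_trans (hs _).
    by apply: enorm_proj_le; [exact: (flag_sym fQ)|exact: (flag_idem fQ)].
rewrite big_ord_recl /=; apply: lerD.
  rewrite ler_wpM2r ?invr_ge0 ?(ltW d0) // ler_wpM2l // ler_nat; exact: rank_leq_row.
apply: le_trans (ler_wpM2l (ltW s0) hS); rewrite mulr_sumr; apply: ler_sum => m _.
have m0 := flag_lam fQ (ltn_ord m).
rewrite /bump /= !add0n.
have -> : s * (2 * (\rank (Q m))%:R / mu m) = 2 * (\rank (Q m))%:R / (mu m / s).
  by rewrite invf_div; ring.
rewrite ler_wpM2r ?invr_ge0 ?divr_ge0 ?(ltW m0) ?(ltW s0) // ler_wpM2l // ler_nat.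
have [X XE] : exists X, X = E m.+1 - E m by exists (E m.+1 - E m).
rewrite -XE.
(* Multiplication by [N *m Q m] is injective on the image of [P m.+1], so the rank does not exceed
   that of [Q m]. *)
apply: (@leq_trans (\rank (X *m N *m Q m))); last exact: mxrankM_maxr.
have : (kermx (X *m N *m Q m) <= kermx X)%MS.
  apply/sub_kermxP; apply/row_matrixP => i; rewrite row_mul row0.
  set v := row i _.
  have vW : v *m (X *m N *m Q m) = 0 by rewrite -row_mul mulmx_ker row0.
  have XT : X *m N *m T m.+1 = 0.
    rewrite -mulmxA XE mulmxBl EN -(TT m m.+1 (leqnSn m)) (mulmxA N) (mulmxA (E m)) EN.
    by rewrite mul0mx subrr.
  have : v *m X *m E m = v *m X.
    apply: Efix; rewrite (TS m) // mulmxA mulmxDr.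
    by rewrite -!mulmxA in vW XT *; rewrite vW XT mulmx0 addr0.
  by rewrite -mulmxA XE -/(P m.+1) PE0 // mulmx0.
move=> /mxrankS; rewrite !mxrank_ker => h.
have := rank_leq_row X; have := rank_leq_row (X *m N *m Q m); lia.
Qed.

End FlagExtension.


(** * Hash families and the sparse matrix *)

Section HashFamilies.
Variable R : realType.

Definition upd n k (h : {ffun 'I_n -> 'I_k}) x v : {ffun 'I_n -> 'I_k} :=
  [ffun y => if y == x then v else h y].

(** Resampling one value preserves the uniform distribution: exchanging old and new value is an
    involution on the pairs [(h, v)]. *)
Lemma sum_resample n k (x : 'I_n) (F : {ffun 'I_n -> 'I_k} -> R) :
  \sum_h \sum_v F (upd h x v) = k%:R * \sum_h F h.
Proof.
pose phi (p : {ffun 'I_n -> 'I_k} * 'I_k) := (upd p.1 x p.2, p.1 x).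
have phiK : involutive phi.
  move=> [h v]; rewrite /phi /=; congr (_, _); last by rewrite ffunE eqxx.
  by apply/ffunP => y; rewrite !ffunE; case: eqP => [->|].
rewrite pair_bigA /= (reindex_inj (inv_inj phiK)) /=.
rewrite -(pair_bigA _ (fun h v => F (upd (upd h x v) x (h x)))) /= mulr_sumr.
apply: eq_bigr => h _; rewrite (eq_bigr (fun=> F h)) => [|v _].
  by rewrite sumr_const card_ord mulr_natl.
congr F; apply/ffunP => y; rewrite !ffunE; by case: eqP => [->|].
Qed.

(* Drawing the value at one more point multiplies the expected weight by at most 2 g. *)
Lemma sum_image_weight n k (g : R) (S : {set 'I_n}) : 0 <= g <= 1 ->
  #|S|%:R <= g * k%:R ->
  \sum_(h : {ffun 'I_n -> 'I_k}) g ^+ #|h @: S| <= (2 * g) ^+ #|S| * k%:R ^+ n.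
Proof.
move=> /andP[g0 g1].
have [m] := ubnP #|S|; elim: m S => // m IH S Sm hS.
have [->|[x xS]] := set_0Vmem S.
  rewrite (eq_bigr (fun=> 1)) => [|h _]; last by rewrite imset0 cards0 expr0.
  by rewrite sumr_const card_ffun !card_ord cards0 expr0 mul1r natrX.
pose T := S :\ x.
have cT : #|S| = #|T|.+1 by rewrite (cardsD1 x) xS.
have hT : #|T|%:R <= g * k%:R.
  by apply: le_trans hS; rewrite cT ler_nat.
have {}IH := IH T _ hT; rewrite -cT in IH; have {}IH := IH Sm.
have [k0|k0] := eqVneq k 0%N.
  by move: hS; rewrite k0 mulr0 cT => h; have := ler0n R #|T|; rewrite -natr1 in h; lra.
have kp : 0 < k%:R :> R by rewrite ltr0n lt0n.
rewrite -(ler_pM2l kp) -(sum_resample x (fun h => g ^+ #|h @: S|)).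
have -> : k%:R * ((2 * g) ^+ #|S| * k%:R ^+ n) = (2 * g * k%:R) * ((2 * g) ^+ #|T| * k%:R ^+ n).
  by rewrite cT exprS; ring.
have c0 : 0 <= 2 * g * k%:R by rewrite !mulr_ge0.
apply: le_trans (ler_wpM2l c0 IH); rewrite mulr_sumr; apply: ler_sum => h _.
have im v : upd h x v @: S = v |: (h @: T).
  rewrite -{1}(finset.setD1K xS) imsetU1 ffunE eqxx; congr (_ |: _).
  apply: eq_in_imset => y; rewrite in_setD1 => /andP[yx _].
  by rewrite ffunE (negbTE yx).
set A := h @: T; have A_T : (#|A| <= #|T|)%N by exact: leq_imset_card.
(* Values in [A] have weight 1 and number at most [g * k]; the others have weight [g] and number at
   most [k]. *)
apply: (@le_trans _ _ (\sum_(v : 'I_k) (g ^+ #|A| * (if v \in A then 1 else g)))).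
  apply: ler_sum => v _; rewrite im -/A cardsU1; case: (v \in A) => /=.
    by rewrite mulr1.
  by rewrite add1n exprS mulrC.
rewrite -mulr_sumr mulrC ler_wpM2r ?exprn_ge0 //.
rewrite (bigID (fun v => v \in A)) /= (eq_bigr (fun=> 1)) => [|v ->//].
rewrite sumr_const [X in _ + X](eq_bigr (fun=> g)) => [|v /negbTE->//].
rewrite sumr_const -mulrA mulrDl mul1r; apply: lerD.
  by rewrite -mulr_natl mulr1; apply: le_trans hT; rewrite ler_nat.
rewrite -[leLHS]mulr_natr ler_wpM2l // ler_nat; apply: leq_trans (max_card _) _; by rewrite card_ord.
Qed.

(** Markov's inequality for the weight [(g ^+ 2) ^+ #|h @: S|], which is at least [g ^+ #|S|] when
    [h] collapses [S]. *)
Lemma count_collapsing n k (g : R) (S : {set 'I_n}) : 0 < g <= 1 ->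
  #|S|%:R <= g ^+ 2 * k%:R ->
  #|[set h : {ffun 'I_n -> 'I_k} | (#|h @: S|.*2 <= #|S|)%N]%SET|%:R <= (2 * g) ^+ #|S| * k%:R ^+ n.
Proof.
move=> /andP[g0 g1] hS.
have g2 : 0 <= g ^+ 2 <= 1 by rewrite sqr_ge0 exprn_ile1 // ltW.
have := sum_image_weight g2 hS; move=> h.
rewrite -(ler_pM2l (exprn_gt0 #|S| g0)).
have -> : g ^+ #|S| * ((2 * g) ^+ #|S| * k%:R ^+ n) = (2 * g ^+ 2) ^+ #|S| * k%:R ^+ n.
  by rewrite mulrA -exprMn; congr (_ ^+ _ * _); ring.
apply: le_trans h; set Bad := [set h | _]%SET.
rewrite -[#|Bad|]sum1_card natr_sum mulr_sumr [leLHS]big_mkcond /=.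
apply: ler_sum => h _; rewrite inE; case: ifP => [hc|_]; last by rewrite exprn_ge0 // sqr_ge0.
rewrite mulr1 -exprM mul2n; apply: ler_wiXn2l => //; exact: ltW.
Qed.

Lemma sum_subsets n (x : R) : \sum_(S : {set 'I_n}) x ^+ #|S| = (1 + x) ^+ n.
Proof.
have lt (S : {set 'I_n}) : (#|S| < n.+1)%N.
  by rewrite ltnS; apply: leq_trans (max_card _) _; rewrite card_ord.
rewrite exprDn (partition_big (fun S => Ordinal (lt S)) predT) //=.
apply: eq_bigr => i _; rewrite expr1n mul1r.
rewrite (eq_bigr (fun=> x ^+ i)) => [|S /eqP <-//].
rewrite sumr_const; congr (_ *+ _).
have <- : #|[set A : {set 'I_n} | #|A| == i]%SET| = 'C(n, i) by rewrite card_draws card_ord.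
by apply: eq_card => S; rewrite [RHS]inE.
Qed.

(** Bernoulli's inequality for [(1 - x) ^+ n], whose product with [(1 + x) ^+ n] is at most 1. *)
Lemma exprD1_lt2 n (x : R) : 0 <= x -> n%:R * x < 1 / 2 -> (1 + x) ^+ n < 2.
Proof.
move=> x0 hx; have [->|n0] := eqVneq n 0%N; first by rewrite expr0; lra.
have n1 : 1 <= n%:R :> R by rewrite ler1n lt0n.
have x1 : x < 1 / 2 by nra.
have bern m : 1 - m%:R * x <= (1 - x) ^+ m.
  elim: m => [|m IH]; first by rewrite mul0r subr0.
  rewrite exprS -natr1; have := ler_wpM2l (_ : 0 <= 1 - x) IH.
  have q : 0 <= 1 - x by lra.
  move=> /(_ q); have := mulr_ge0 (ler0n R m) (sqr_ge0 x); nra.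
have p0 : 0 < (1 + x) ^+ n by rewrite exprn_gt0 //; lra.
have : (1 + x) ^+ n * (1 - x) ^+ n <= 1.
  rewrite -exprMn exprn_ile1 //; nra.
have := bern n; nra.
Qed.

Definition collapsed n k (S : {set 'I_n}) (h : {ffun 'I_n -> 'I_k}) := (#|h @: S|.*2 <= #|S|)%N.

(* The hash functions are chosen one at a time, each not increasing the sum of
   beta^((w - m) |S|) over the sets S collapsed by all m functions chosen so far. *)
Lemma hash_family n k w D (g : R) : (0 < k)%N -> 0 < g <= 1 -> D%:R <= g ^+ 2 * k%:R ->
  n%:R * (2 * g) ^+ w < 1 / 2 ->
  exists h : seq {ffun 'I_n -> 'I_k}, size h = w /\
    forall S : {set 'I_n}, S != finset.set0 -> (#|S| <= D)%N -> ~~ all (collapsed S) h.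
Proof.
move=> k0 g01 hD hw; set b := 2 * g in hw.
have b0 : 0 < b by case/andP: g01 => g0 _; rewrite mulr_gt0.
pose ok (S : {set 'I_n}) := (S != finset.set0) && (#|S| <= D)%N.
pose Phi (h : seq {ffun 'I_n -> 'I_k}) m :=
  \sum_(S : {set 'I_n} | ok S && all (collapsed S) h) (b ^+ (w - m)) ^+ #|S|.
have : forall m, (m <= w)%N -> exists2 h, size h = m & Phi h m < 1.
  elim=> [|m IH] mw.
    exists [::] => //; rewrite /Phi subn0.
    (* Initially the sum is at most [(1 + b ^+ w) ^+ n - 1], the contribution of all nonempty
       sets. *)
    have := exprD1_lt2 (exprn_ge0 w (ltW b0)) hw; rewrite -sum_subsets.
    rewrite (bigD1 finset.set0) //= cards0 expr0 => h.
    apply: (@le_lt_trans _ _ (\sum_(S : {set 'I_n} | S != finset.set0) (b ^+ w) ^+ #|S|)); last by lra.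
    rewrite [leLHS]big_mkcond [leRHS]big_mkcond; apply: ler_sum => S _.
    rewrite /ok andbT; case: (S != _) => //=; case: ifP => _ //.
    by rewrite !exprn_ge0 // ltW.
  have [h sh hPhi] := IH (ltnW mw).
  pose K := #|{: {ffun 'I_n -> 'I_k}}|%:R : R.
  have KE : K = k%:R ^+ n by rewrite /K card_ffun !card_ord natrX.
  have K0 : 0 < K by rewrite KE exprn_gt0 // ltr0n.
  (* A random [f] collapses [S] with probability at most [b ^+ #|S|], which offsets the growth of
     the weight of [S] by the inverse factor. *)
  have tot : \sum_f Phi (f :: h) m.+1 <= K * Phi h m.
    rewrite /Phi; under eq_bigr => f _ do rewrite big_mkcond.
    rewrite exchange_big /= [in leRHS]big_mkcond mulr_sumr; apply: ler_sum => S _.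
    case: ifP => [/andP[okS cS]|nS]; last first.
      by rewrite mulr0 big1 // => f _; case: ifP => // /andP[h1 /andP[_ h2]]; rewrite h1 h2 in nS.
    rewrite (eq_bigr (fun f => if collapsed S f then (b ^+ (w - m.+1)) ^+ #|S| else 0)); last first.
      by move=> f _; rewrite okS cS andbT.
    rewrite -big_mkcond sumr_const -mulr_natr.
    have e : (w - m = (w - m.+1).+1)%N by lia.
    rewrite e (exprS b) [(b * _) ^+ _]exprMn [leRHS]mulrA [leRHS]mulrC ler_wpM2l ?exprn_ge0 ?(ltW b0) //.
    have hS : #|S|%:R <= g ^+ 2 * k%:R.
      by apply: le_trans hD; rewrite ler_nat; case/andP: okS.
    rewrite KE [leRHS]mulrC; apply: le_trans (count_collapsing g01 hS).
    by rewrite le_eqVlt; apply/orP; left; apply/eqP; congr (_%:R); apply: eq_card => f; rewrite !inE.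
  have [f hf] : exists f, Phi (f :: h) m.+1 <= Phi h m.
    apply: contrapT => hn.
    have : K * Phi h m < \sum_f Phi (f :: h) m.+1.
      rewrite /K mulr_natl -sumr_const; apply: ltr_sum => [|f _].
        by apply/hasP; exists [ffun=> Ordinal k0]; rewrite ?mem_index_enum.
      by rewrite ltNge; apply/negP => hf; apply: hn; exists f.
    by move=> /lt_le_trans /(_ tot); rewrite ltxx.
  by exists (f :: h); rewrite /= ?sh //; exact: le_lt_trans hPhi.
move=> /(_ w (leqnn w))[h sh hPhi]; exists h; split => // S S0 SD; apply/negP => cS.
(* At [m = w] every surviving set has weight 1, so a total below 1 leaves none. *)
move: hPhi; rewrite /Phi subnn (bigD1 S) /=; last by rewrite /ok S0 SD.
rewrite expr0 expr1n ltNge lerDl => /negP; apply.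
by apply: sumr_ge0 => T _; rewrite exprn_ge0.
Qed.

(* Sort by hash value and cut the order into blocks of length s: adding the block number to
   the hash value bounds the fibres by s and separates everything h separates. *)
Lemma balanced_refinement n k s (h : {ffun 'I_n -> 'I_k}) : (0 < s)%N ->
  exists h' : 'I_n -> 'I_(k + n %/ s).+1,
    (forall v, (#|[set x | h' x == v]%SET| <= s)%N) /\ forall x y, h' x = h' y -> h x = h y.
Proof.
move=> s0.
pose below x := [set y | (h y < h x)%N || ((h y == h x) && (y < x)%N)]%SET.
pose pos x := #|below x|.
have posn x : (pos x <= n)%N by apply: leq_trans (max_card _) _; rewrite card_ord.
have lt x : (h x + pos x %/ s < (k + n %/ s).+1)%N.
  by rewrite ltnS leq_add ?leq_div2r // ltnW.
have sub x y : (h x < h y)%N || ((h x == h y) && (x < y)%N) -> (pos x < pos y)%N.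
  move=> xy; apply: proper_card; apply/properP; split.
    apply/fintype.subsetP => u; rewrite !inE; move: xy; rewrite -!val_eqE /=; lia.
  by exists x; rewrite !inE //; rewrite ltnn eqxx ltnn.
exists (fun x => Ordinal (lt x)).
(* Positions are sorted by hash value, so the block number is monotone in it and the sum determines
   the hash value. *)
have key x y : Ordinal (lt x) = Ordinal (lt y) -> h x = h y.
  move=> /(congr1 val) /= e; apply/eqP; apply: contraT => ne.
  have [l|l|l] := ltngtP (h x) (h y).
  - have := leq_div2r s (ltnW (sub x y _)); rewrite l => /(_ isT); lia.
  - have := leq_div2r s (ltnW (sub y x _)); rewrite l => /(_ isT); lia.
  - by case/negP: ne; apply/eqP; apply: val_inj.
split => // v; rewrite -[s in leqRHS]card_ord.
(* Elements of a fibre share the block, where the position modulo [s] tells them apart. *)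
pose f x : 'I_s := Ordinal (ltn_pmod (pos x) s0).
rewrite -(card_in_imset (f := f)); first exact: max_card.
move=> x y; rewrite !inE => /eqP ex /eqP ey /(congr1 val) /= em.
have exy := etrans ex (esym ey); have eh := key x y exy.
have ep : pos x = pos y.
  move: exy => /(congr1 val) /=; rewrite eh => /addnI ed.
  by rewrite (divn_eq (pos x) s) (divn_eq (pos y) s) ed em.
apply/eqP; apply: contraT; rewrite neq_ltn => /orP[l|l].
  by have := sub x y; rewrite eh eqxx l orbT ep ltnn => /(_ isT).
by have := sub y x; rewrite eh eqxx l orbT ep ltnn => /(_ isT).
Qed.

Lemma sqr_sum_le n (A : {set 'I_n}) (z : 'I_n -> R) :
  (\sum_(x in A) z x) ^+ 2 <= #|A|%:R * \sum_(x in A) z x ^+ 2.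
Proof.
have -> : #|A|%:R * \sum_(x in A) z x ^+ 2 =
    \sum_(x in A) \sum_(y in A) (z x ^+ 2 + z y ^+ 2) / 2.
  rewrite [RHS](eq_bigr (fun x => (#|A|%:R * z x ^+ 2 + \sum_(y in A) z y ^+ 2) / 2)); last first.
    by move=> x _; rewrite -mulr_suml big_split /= sumr_const mulr_natl.
  by rewrite -mulr_suml big_split /= sumr_const -mulr_sumr -[_ *+ _]mulr_natl; lra.
rewrite expr2 mulr_suml; apply: ler_sum => x _; rewrite mulr_sumr; apply: ler_sum => y _.
by have := sqr_ge0 (z x - z y); rewrite !expr2; lra.
Qed.

(** Otherwise every fibre inside [S] has at least two elements, and [S] is collapsed. *)
Lemma unique_image n k (S : {set 'I_n}) (h : {ffun 'I_n -> 'I_k}) : ~~ collapsed S h ->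
  exists2 x, x \in S & forall y, y \in S -> h y = h x -> y = x.
Proof.
move=> nc; apply: contrapT => hn; case/negP: nc; rewrite /collapsed.
have -> : #|S| = (\sum_(v in h @: S) #|[set y in S | h y == v]%SET|)%N.
  rewrite -sum1_card (partition_big_imset h) /=; apply: eq_bigr => v _.
  by rewrite -sum1_card; apply: eq_bigl => y; rewrite inE.
rewrite -muln2 -sum_nat_const; apply: leq_sum => v /imsetP[x xS ->].
rewrite ltnNge; apply/negP => c1; apply: hn; exists x => // y yS yx.
have /eqP/cards1P[u hu] : #|[set y in S | h y == h x]%SET| = 1%N.
  by apply/eqP; rewrite eqn_leq c1 card_gt0; apply/set0Pn; exists x; rewrite inE xS /=.
have : x \in [set u]%SET by rewrite -hu inE xS /=.
have : y \in [set u]%SET by rewrite -hu inE yS yx /=.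
by rewrite !inE => /eqP-> /eqP->.
Qed.

(** Row [x] marks the bin of [x] under each of the [w] functions. Bins hold at most [s] indices, so
    the squared norm grows by at most [w * s]. A nonzero integer kernel vector with at most [D]
    nonzero entries would have one alone in its bin, where the product could not vanish. *)
Lemma good_sparse n k w s D (g S : R) : (0 < k)%N -> (0 < w)%N -> (0 < s)%N -> 0 < g <= 1 ->
  D%:R <= g ^+ 2 * k%:R -> n%:R * (2 * g) ^+ w < 1 / 2 ->
  good (w * (k + n %/ s).+1) S ->
  good n (2 * n%:R / Num.sqrt D.+1%:R + Num.sqrt (w * s)%:R * S).
Proof.
move=> k0 w0 s0 g01 hD hw gS.
have [h [sh hh]] := hash_family k0 g01 hD hw.
pose B := (k + n %/ s).+1; pose h0 := [ffun _ : 'I_n => Ordinal k0].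
have [h' hP] := choice (fun i : 'I_w => balanced_refinement (nth h0 h i) s0).
pose I := ('I_w * 'I_B)%type.
have cI : #|{: I}| = (w * B)%N by rewrite card_prod !card_ord.
pose N : 'M[R]_(n, #|{: I}|) := \matrix_(x, c) (h' (enum_val c).1 x == (enum_val c).2)%:R.
have Nval (z : 'rV[R]_n) (p : I) : (z *m N) ord0 (enum_rank p) = \sum_(x in [set x | h' p.1 x == p.2]%SET) z ord0 x.
  rewrite mxE big_mkcond [RHS]big_mkcond; apply: eq_bigr => x _.
  by rewrite mxE enum_rankK inE; case: ifP; rewrite ?mulr1 ?mulr0.
apply: (@good_extend R n #|{: I}| N).
- by rewrite sqrtr_gt0 ltr0n muln_gt0 w0.
- by rewrite sqrtr_gt0 ltr0n.
- by move=> x c; rewrite mxE; case: (_ == _); rewrite ?rpred0 ?rpred1.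
- move=> z; rewrite -(ler_pXn2r (n := 2)) ?nnegrE ?enorm_ge0 ?mulr_ge0 ?sqrtr_ge0 ?enorm_ge0 //.
  rewrite exprMn !sqr_enorm sqr_sqrtr ?ler0n // {1}/dot.
  rewrite (reindex (@enum_rank I)) /=; last by apply: onW_bij; exact: enum_rank_bij.
  rewrite (eq_bigr (fun p : I => (\sum_(x in [set x | h' p.1 x == p.2]%SET) z ord0 x) ^+ 2)); last first.
    by move=> p _; rewrite Nval expr2.
  apply: (@le_trans _ _ (\sum_(p : I) s%:R * \sum_(x in [set x | h' p.1 x == p.2]%SET) z ord0 x ^+ 2)).
    apply: ler_sum => p _; apply: le_trans (sqr_sum_le _ _) _.
    rewrite ler_wpM2r //; first by apply: sumr_ge0 => x _; exact: sqr_ge0.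
    by rewrite ler_nat; have [] := hP p.1.
  rewrite -mulr_sumr natrM [w%:R * _]mulrC -mulrA ler_wpM2l ?ler0n //.
  rewrite -(pair_bigA _ (fun i v => \sum_(x in [set x | h' i x == v]%SET) z ord0 x ^+ 2)) /=.
  rewrite (eq_bigr (fun=> dot z z)); first by rewrite sumr_const card_ord mulr_natl.
  move=> i _; rewrite /dot (partition_big (h' i) predT) //=; apply: eq_bigr => v _.
  by apply: eq_big => [x|x _]; rewrite ?inE // expr2.
- move=> z iz zN z0; rewrite /enorm ler_sqrt ?dot_ge0 //.
  apply: le_trans (support_le_dot iz); rewrite ler_nat ltnNge; apply/negP => cD.
  set A := [set i | _]%SET in cD.
  have A0 : A != finset.set0.
    apply: contraNneq z0 => e; apply/eqP/rowP => i; rewrite mxE; apply/eqP; apply: contraT => zi.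
    suff : i \in (finset.set0 : {set 'I_n}) by rewrite finset.in_set0.
    by rewrite -e inE.
  have /allPn[f fh nc] := hh A A0 cD.
  have [x xA ux] := unique_image nc.
  have iw : (index f h < w)%N by rewrite -sh index_mem.
  pose i := Ordinal iw.
  have := Nval z (i, h' i x); rewrite zN mxE /=.
  rewrite (bigD1 x) ?inE //= big1 ?addr0 => [e|y].
    by move: xA; rewrite inE -e eqxx.
  rewrite inE => /andP[/eqP hy yx]; apply/eqP; apply: contraT => zy.
  have [_ /(_ y x hy)] := hP i; rewrite /= nth_index // => e.
  by case/negP: yx; apply/eqP; apply: ux; rewrite // inE.
- by rewrite cI.
Qed.

End HashFamilies.


(** * Iterating the recursion on the exponent *)

Section Growth.
Variable R : realType.

Definition growth (t : R) := exists2 C : R, 0 < C &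
  forall n, (0 < n)%N -> good n (C * n%:R `^ (2^-1 + t)).

Lemma good_le n (S S' : R) : S <= S' -> good n S -> good n S'.
Proof. by move=> SS' [t [P [lam [fP h]]]]; exists t, P, lam; split => //; exact: le_trans SS'. Qed.

Lemma growth_half : growth (1 / 2).
Proof.
exists 2 => // n n0; apply: good_le (good_trivial R n).
by rewrite (_ : 2^-1 + 1 / 2 = 1) ?powRr1 //; lra.
Qed.

Lemma nat_root c n : (0 < c)%N -> (0 < n)%N ->
  exists m, [/\ (0 < m)%N, (m ^ c <= n)%N & (n < (2 * m) ^ c)%N].
Proof.
move=> c0 n0; pose P m := (0 < m)%N && (m ^ c <= n)%N.
have ex : exists m, P m by exists 1%N; rewrite /P exp1n.
have ub m : P m -> (m <= n)%N.
  by move=> /andP[m0 h]; apply: leq_trans h; rewrite -{1}(expn1 m) leq_pexp2l.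
case: (ex_maxnP ex ub) => m /andP[m0 h] hmax; exists m; split => //.
rewrite ltnNge; apply/negP => h2; have : P (2 * m)%N by rewrite /P muln_gt0 m0.
by move=> /hmax; lia.
Qed.

(* With c functions, kernel vectors of norm about sqrt n / m^2 and bins of size m^2, where
   m is about n^(1/c), the recursion improves the exponent. *)
Lemma growth_step c (t q : R) : (3 <= c)%N -> 0 <= t -> 2 / c%:R <= q ->
  t * (1 - 2 / c%:R) <= q -> growth t -> growth q.
Proof.
move=> c3 t0 cq tq [C C0 hC].
have cp : 0 < c%:R :> R by rewrite ltr0n; lia.
pose w := c.+1; pose e := 2^-1 + t.
have e0 : 0 <= e by rewrite /e; lra.
pose C' := 8 + Num.sqrt w%:R * (C * (16 * w%:R) `^ e).
have sw : 0 < Num.sqrt w%:R :> R by rewrite sqrtr_gt0 ltr0n.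
have C2 : 0 <= Num.sqrt w%:R * (C * (16 * w%:R) `^ e).
  by rewrite mulr_ge0 ?sqrtr_ge0 // mulr_ge0 ?(ltW C0) // powR_ge0.
exists C' => [|n n0]; first by rewrite /C'; lra.
have [|m [m0 mn nm]] := @nat_root c n _ n0; first lia.
have np : 0 < n%:R :> R by rewrite ltr0n.
have n1 : 1 <= n%:R :> R by rewrite ler1n.
have mp : 0 < m%:R :> R by rewrite ltr0n.
have m1 : 1 <= m%:R :> R by rewrite ler1n.
pose x : R := n%:R `^ c%:R^-1.
have root (a : nat) : (a ^ c)%:R `^ c%:R^-1 = a%:R :> R.
  by rewrite natrX -powR_mulrn ?ler0n // -powRrM mulfV ?gt_eqF // powRr1 ?ler0n.
have mono (a b : nat) : (a <= b)%N -> a%:R `^ c%:R^-1 <= b%:R `^ c%:R^-1 :> R.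
  by move=> ab; apply: ge0_ler_powR; rewrite ?nnegrE ?ler0n ?invr_ge0 ?ler0n // ler_nat.
have mx : m%:R <= x by rewrite -(root m); exact: mono.
have xm : x <= 2 * m%:R by rewrite -natrM -(root (2 * m)%N); apply: mono; exact: ltnW.
have xp : 0 < x by exact: lt_le_trans mx.
have m2n : (m ^ 2 <= n)%N by apply: leq_trans mn; rewrite leq_pexp2l // ltnW.
pose k := (n %/ m ^ 2).+1; pose D := (n %/ (16 * m ^ 4))%N; pose g : R := (4 * m%:R)^-1.
have divle (a b : nat) : (0 < b)%N -> (a %/ b)%:R <= a%:R / b%:R :> R.
  by move=> b0; rewrite ler_pdivlMr ?ltr0n // -natrM ler_nat leq_trunc_div.
have divgt (a b : nat) : (0 < b)%N -> a%:R / b%:R < (a %/ b).+1%:R :> R.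
  by move=> b0; rewrite ltr_pdivrMr ?ltr0n // -natrM ltr_nat ltn_ceil.
have g0 : 0 < g by rewrite invr_gt0 mulr_gt0.
have g1 : g <= 1 by rewrite invf_le1 ?mulr_gt0 //; lra.
have hD : D%:R <= g ^+ 2 * k%:R.
  apply: (le_trans (divle _ _ _)); first by rewrite muln_gt0 expn_gt0 m0.
  have h := divgt n (m ^ 2)%N; rewrite expn_gt0 m0 in h; have {}h := ltW (h isT).
  have -> : n%:R / (16 * m ^ 4)%:R = g ^+ 2 * (n%:R / (m ^ 2)%:R) :> R.
    by rewrite /g natrM !natrX; field; rewrite gt_eqF.
  by rewrite ler_wpM2l ?sqr_ge0.
have hw : n%:R * (2 * g) ^+ w < 1 / 2.
  have -> : 2 * g = (2 * m%:R)^-1 by rewrite /g; field; rewrite gt_eqF.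
  rewrite exprVn ltr_pdivrMr ?exprn_gt0 ?mulr_gt0 // exprS.
  have : n%:R < (2 * m%:R) ^+ c :> R by rewrite -natrM -natrX ltr_nat.
  have : 0 < (2 * m%:R) ^+ c :> R by rewrite exprn_gt0 ?mulr_gt0.
  move: ((2 * m%:R) ^+ c) => y y0 ny; nra.
have s0 : (0 < m ^ 2)%N by rewrite expn_gt0 m0.
have g01 : 0 < g <= 1 by rewrite g0 g1.
have kk0 : (0 < w * (k + n %/ m ^ 2).+1)%N by rewrite muln_gt0.
have := good_sparse (ltn0Sn _) (ltn0Sn _) s0 g01 hD hw (hC _ kk0).
apply: good_le; rewrite -/e -/w.
have pn : 0 < n%:R `^ (2^-1 + q) by rewrite powR_gt0.
rewrite /C' [leRHS]mulrDl; apply: lerD.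
  have r0 : 0 < Num.sqrt n%:R :> R by rewrite sqrtr_gt0.
  have rr : Num.sqrt n%:R * Num.sqrt n%:R = n%:R :> R by rewrite -expr2 sqr_sqrtr // ltW.
  have h : Num.sqrt n%:R / (4 * m%:R ^+ 2) <= Num.sqrt D.+1%:R :> R.
    rewrite -(ler_pXn2r (n := 2)) ?nnegrE ?sqrtr_ge0 ?divr_ge0 ?sqrtr_ge0 ?mulr_ge0 ?sqr_ge0 //.
    rewrite sqr_sqrtr ?ler0n // expr_div_n sqr_sqrtr ?ler0n //.
    have h := divgt n (16 * m ^ 4)%N; rewrite muln_gt0 expn_gt0 m0 in h; have {}h := ltW (h isT).
    apply: le_trans h; rewrite natrM natrX (_ : (4 * m%:R ^+ 2) ^+ 2 = 16 * m%:R ^+ 4) //; ring.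
  have q0 : 0 < Num.sqrt n%:R / (4 * m%:R ^+ 2) :> R.
    by rewrite divr_gt0 // mulr_gt0 // exprn_gt0.
  apply: (@le_trans _ _ (2 * n%:R / (Num.sqrt n%:R / (4 * m%:R ^+ 2)))).
    by rewrite ler_wpM2l ?mulr_ge0 ?ler0n // lef_pV2 ?posrE // (lt_le_trans q0).
  have -> : 2 * n%:R / (Num.sqrt n%:R / (4 * m%:R ^+ 2)) = 8 * (m%:R ^+ 2 * Num.sqrt n%:R) :> R.
    by rewrite -{1}rr; move: (Num.sqrt n%:R) r0 => r r0; field; rewrite !gt_eqF.
  rewrite ler_wpM2l //; apply: (@le_trans _ _ (x ^+ 2 * Num.sqrt n%:R)).
    by rewrite ler_wpM2r ?(ltW r0) // ler_pXn2r ?nnegrE ?(ltW xp) // ltW.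
  have -> : x ^+ 2 = n%:R `^ (2 / c%:R).
    by rewrite -powR_mulrn ?(ltW xp) // -powRrM mulrC.
  rewrite -powR12_sqrt ?(ltW np) // mulrC -powRD; last by rewrite gt_eqF ?implybT.
  by apply: ler_powR => //; lra.
have sq : Num.sqrt (w * m ^ 2)%:R = Num.sqrt w%:R * m%:R :> R.
  by rewrite natrM natrX sqrtrM ?ler0n // sqrtr_sqr ger0_norm // ltW.
rewrite sq -!mulrA ler_wpM2l ?(ltW sw) // mulrCA ler_wpM2l ?(ltW C0) //.
have kle : (w * (k + n %/ m ^ 2).+1)%:R <= (16 * w%:R) * (n%:R / x ^+ 2) :> R.
  rewrite natrM [16 * _]mulrC -mulrA ler_wpM2l ?ler0n //.
  have h := divle n _ s0; rewrite natrX in h.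
  have one : 1 <= n%:R / m%:R ^+ 2 :> R.
    by rewrite ler_pdivlMr ?exprn_gt0 // mul1r -natrX ler_nat.
  have x4 : n%:R / m%:R ^+ 2 <= 4 * (n%:R / x ^+ 2).
    have -> : 4 * (n%:R / x ^+ 2) = n%:R / (x / 2) ^+ 2 by field; rewrite gt_eqF.
    rewrite ler_wpM2l ?(ltW np) // lef_pV2 ?posrE ?exprn_gt0 ?divr_gt0 //.
    by rewrite ler_pXn2r ?nnegrE ?divr_ge0 ?(ltW xp) ?(ltW mp) // ler_pdivrMr // mulrC.
  rewrite /k addSn -natr1 -natr1 natrD; lra.
have p1 : 0 <= 16 * w%:R :> R by rewrite -natrM ler0n.
have p2 : 0 <= n%:R / x ^+ 2 by rewrite divr_ge0 ?sqr_ge0 ?(ltW np).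
apply: (@le_trans _ _ (x * ((16 * w%:R) * (n%:R / x ^+ 2)) `^ e)).
  apply: ler_pM => //; rewrite ?powR_ge0 ?(ltW mp) //.
  apply: ge0_ler_powR => //; rewrite nnegrE ?ler0n //.
  exact: mulr_ge0.
rewrite (powRM _ p1 p2) mulrCA ler_wpM2l ?powR_ge0 //.
have nz : n%:R != 0 :> R by rewrite gt_eqF.
have -> : n%:R / x ^+ 2 = n%:R `^ (1 - 2 / c%:R).
  rewrite powRD; last by rewrite nz implybT.
  rewrite powRr1 ?(ltW np) // powRN; congr (_ / _).
  by rewrite -powR_mulrn ?(ltW xp) // -powRrM mulrC.
rewrite -powRrM /x -powRD; last by rewrite nz implybT.
apply: ler_powR => //.
have -> : c%:R^-1 + (1 - 2 / c%:R) * e = 2^-1 + t * (1 - 2 / c%:R) by rewrite /e; field; rewrite gt_eqF.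
by rewrite lerD2l.
Qed.

Lemma growth_small c : (3 <= c)%N -> growth (2 / c%:R).
Proof.
move=> c3; have cp : 0 < c%:R :> R by rewrite ltr0n; lia.
have c3r : 3 <= c%:R :> R by rewrite ler_nat.
pose y : R := 2 / c%:R; have y0 : 0 < y by rewrite divr_gt0.
have y1 : y < 1 by rewrite ltr_pdivrMr // mul1r; lra.
have iter j : growth (Num.max y ((1 - y) ^+ j / 2)).
  elim: j => [|j IH].
    have [h|h] := leP y ((1 - y) ^+ 0 / 2); first by rewrite expr0; exact: growth_half.
    apply: (@growth_step c (1 / 2)) growth_half => //; rewrite -/y //.
    rewrite expr0 in h; nra.
  apply: (@growth_step c _ _ c3) IH; rewrite -/y; first by rewrite le_max (ltW y0).
    by rewrite le_max lexx.
  rewrite maxr_pMl; last by lra.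
  rewrite ge_max !le_max; apply/andP; split.
    by apply/orP; left; nra.
  by apply/orP; right; rewrite (_ : _ / 2 * (1 - y) = (1 - y) ^+ j.+1 / 2) // exprS; ring.
have lt1 : `|1 - y| < 1 by rewrite ltr_norml; apply/andP; split; lra.
have y2 : 0 < y * 2 by lra.
have [N _ hN] := @cvgr_lt R _ _ _ (fun n => (1 - y) ^+ n) _ (cvg_expr lt1) (y * 2) y2.
have := iter N; rewrite (_ : Num.max _ _ = y) //; apply/max_idPl.
by rewrite ler_pdivrMr //; apply: ltW; apply: hN => /=.
Qed.

End Growth.


Lemma inf_nonneg (R : realType) (A : set R) : (forall x, A x -> 0 <= x) -> 0 <= inf A.
Proof.
move=> h; have [[x Ax]|nA] := pselect (exists x, A x).
  by apply: lb_le_inf; [exists x|exact: h].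
by rewrite (_ : A = set0) ?inf0 // -subset0 => x Ax; apply: nA; exists x.
Qed.

Theorem theorem1p1 (R : realType) :
  exists eps : nat -> R,
    (forall n, 0 <= eps n) /\ (eps @ \oo --> (0 : R)) /\
    forall n : nat, (2 <= n)%N ->
      exists K : set 'rV[R]_n,
        integer_parallelotope K /\
        (surface_area K <= ((n%:R) `^ (2^-1 + eps n))%:E)%E.
Proof.
pose A n := [set e : R | 0 <= e /\ exists K : set 'rV[R]_n,
  integer_parallelotope K /\ (surface_area K <= ((n%:R) `^ (2^-1 + e))%:E)%E].
have A0 n e : A n e -> 0 <= e by case.
have inv0 n : 0 < n.+1%:R^-1 :> R by rewrite invr_gt0.
exists (fun n => inf (A n) + n.+1%:R^-1); split; last split.
- by move=> n; apply: addr_ge0; [apply: inf_nonneg; exact: A0|exact: ltW].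
- apply/cvgrPdist_lt => d d0.
  pose c := (Num.truncn (8 / d)).+3.
  have c0 : 0 < c%:R :> R by rewrite ltr0n.
  have cd : 2 / c%:R <= d / 4.
    have := truncnS_gt (8 / d); rewrite -/(Num.truncn _) ltr_pdivrMr // => h.
    have hc : (Num.truncn (8 / d)).+1%:R <= c%:R :> R by rewrite ler_nat /c; lia.
    have := ler_wpM2r (ltW d0) hc; rewrite ler_pdivrMr //; lra.
  have [C C0 hC] := @growth_small R c isT.
  pose b := C `^ (4 / d); have b0 : 0 <= b by exact: powR_ge0.
  exists (Num.truncn b + Num.truncn (2 / d)).+2 => // n /= hn.
  have n2 : (1 < n)%N by apply: leq_trans hn; rewrite ltnS ltnS leq0n.
  have np : 0 < n%:R :> R by rewrite ltr0n ltnW.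
  have n1 : 1 <= n%:R :> R by rewrite ler1n ltnW.
  have d4 : 0 < d / 4 by lra.
  have Cn : C <= n%:R `^ (d / 4).
    have bn : b <= n%:R.
      have h := truncnS_gt b; apply: (le_trans (ltW h)); rewrite ler_nat.
      by apply: leq_trans hn; rewrite ltnS leqW // leq_addr.
    have := ge0_ler_powR (ltW d4) (_ : b \is Num.nneg) (_ : n%:R \is Num.nneg) bn.
    rewrite !nnegrE b0 (ltW np) => /(_ isT isT); rewrite /b -powRrM.
    have -> : 4 / d * (d / 4) = 1 by field; rewrite gt_eqF.
    by rewrite powRr1 // ltW.
  have Ad : A n (d / 2).
    split; first lra.
    have [K [iK hK]] := good_parallelotope n2 (hC n (ltnW n2)); exists K; split => //.
    apply: (le_trans hK); rewrite lee_fin.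
    apply: (@le_trans _ _ (n%:R `^ (d / 4) * n%:R `^ (2^-1 + 2 / c%:R))).
      by rewrite ler_wpM2r ?powR_ge0.
    rewrite -powRD; last by rewrite (gt_eqF np) implybT.
    by apply: ler_powR => //; lra.
  have i0 : 0 <= inf (A n) by apply: inf_nonneg; exact: A0.
  have i1 : inf (A n) <= d / 2 by apply: ge_inf => //; exists 0 => x; exact: A0.
  have i2 : n.+1%:R^-1 < d / 2.
    rewrite invf_plt ?posrE ?divr_gt0 // invf_div.
    apply: lt_le_trans (truncnS_gt _) _; rewrite ler_nat ltnS.
    by apply: leq_trans (ltnW hn); rewrite leqW // leq_addl.
  rewrite sub0r normrN ger0_norm; last by rewrite addr_ge0 // ltW.
  by have := ler_ltD i1 i2; rewrite -splitr.
- move=> n n2.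
  have np : 0 < n%:R :> R by rewrite ltr0n ltnW.
  have n1 : 1 <= n%:R :> R by rewrite ler1n ltnW.
  have ne : A n !=set0.
    exists (3 / 2); split; first lra.
    have [K [iK hK]] := good_parallelotope n2 (good_trivial R n); exists K; split => //.
    apply: (le_trans hK); rewrite lee_fin (_ : 2^-1 + 3 / 2 = 2%:R); last by lra.
    by rewrite powR_mulrn ?ler0n // expr2 ler_wpM2r ?ler0n // ler_nat.
  have hA : has_inf (A n) by split => //; exists 0 => x; exact: A0.
  have [e [e0 [K [iK hK]]] he] := inf_adherent (inv0 n) hA.
  exists K; split => //; apply: (le_trans hK); rewrite lee_fin.
  by apply: ler_powR => //; rewrite lerD2l ltW.
Qed.
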